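(* Let $\tau_0,\tau_1>0$, $n\ge1$, $\lambda_i>0$ with $\sum_{i=1}^n\lambda_i=1$, $a_i>0$, $\mu_i=\mathcal N(m_i,\Sigma_i)\in\mathcal G_d^1$, and let $\nu_*\in\mathcal G_d^1$ be a fixed point of the moment map $T$ (see context). Choose a smooth local chart $\chi$ of $\mathcal G_d^1$ around $\nu_*$, write $x_*=\chi(\nu_* )$, $\nu_x=\chi^{-1}(x)$, and assume $$H_*=D^2(\Phi\circ\chi^{-1})(x_* )\succ0$$ for one (equivalently, every) smooth local chart. Then $\nu_*$ is a strict local minimizer of $\Phi$. Let $b_*=b(\nu_* )$ and $B_*:=\tau_1b_*G_{\mathrm{FR},*}$, where $G_{\mathrm{FR},*}$ is the matrix of the Gaussian Fisher--Rao metric at $\nu_*$ in the chart. The generalized spectrum of $(H_*,B_* )$, and hence the quantities $\mu_*$ and $\rho_*$ below, is chart independent. With $\widehat T=\chi\circ T\circ\chi^{-1}$ (defined near $x_*$), $$D\widehat T(x_* )=I-B_*^{-1}H_*.$$ Define $\mu_*:=\lambda_{\min}(B_*^{-1/2}H_*B_*^{-1/2})$ and $\rho_*:=1-\mu_*$. Then $\mu_*\in(0,1]$, $\rho_*\in[0,1)$ and $\|D\widehat T(x_* )\|_{B_*}=\rho_*$. For every $q\in(\rho_*,1)$ there exist a neighborhood $V$ of $x_*$ in the chart domain and $r>0$ such that $\Phi(\nu_x)\ge\Phi(\nu_* )$ for $x\in V$, and $$\{x:\|x-x_*\|_{B_*}\le r\}\subset V,\qquad \mathcal U_r:=\{x:\|x-x_*\|_{B_*}<r\};$$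 the open ball $\mathcal U_r$ is invariant under $\widehat T$, and whenever $x_0\in\mathcal U_r$ the iterates $x_{k+1}=\widehat T(x_k)$ satisfy $$\|x_k-x_*\|_{B_*}\le q^k\|x_0-x_*\|_{B_*}.$$ The mass and objective errors satisfy $$|b(\nu_{x_k})-b_*|=O(q^k),\qquad \Phi(\nu_{x_k})-\Phi(\nu_* )=O(q^{2k}).$$
   Context: $\mathbb S_{++}^d$: real symmetric positive-definite $d\times d$ matrices; $\mathcal G_d^1=\{\mathcal N(m,\Sigma):m\in\mathbb R^d,\Sigma\in\mathbb S_{++}^d\}$, a smooth manifold identified with the open set $\mathbb R^d\times\mathbb S_{++}^d$. The Gaussian Fisher--Rao metric at $\mathcal N(m,\Sigma)$ on a tangent vector $(\dot m,H)$ is $\dot m^\top\Sigma^{-1}\dot m+\frac12\operatorname{tr}(\Sigma^{-1}H\Sigma^{-1}H)$. For $B\succ0$: $\|h\|_B^2=h^\top Bh$ and $\|A\|_B=\sup_{h\ne0}\|Ah\|_B/\|h\|_B$. Put $s=\tau_0+\tau_1$, $\theta=\tau_0/s$. For $\mu,\nu\in\mathcal G_d^1$, $$\mathsf A(\mu,\nu)=\inf_{p,q\in\mathcal P(\mathbb R^d)}\{W_2^2(p,q)+\tau_0\mathrm{KL}(p\mid\mu)+\tau_1\mathrm{KL}(q\mid\nu)\},$$ with $\mathrm{KL}$ the relative entropy and $W_2^2(p,q)\in[0,\infty]$ the squared quadratic Wasserstein cost. It is known that the minimizer $(p,q)$ is unique, that $p,q$ are nondegenerate Gaussians, and that their parameters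 and $\mathsf A$ depend real-analytically on $(\mu,\nu)$. Set $A_i(\nu)=\mathsf A(\mu_i,\nu)$, let $q_i(\nu)=\mathcal N(v_i,Q_i)$ be the second component of the minimizer for $(\mu_i,\nu)$, $\mathsf Z(\nu)=\sum_i\lambda_ia_i^\theta e^{-A_i(\nu)/s}$, $\omega_i(\nu)=\lambda_ia_i^\theta e^{-A_i(\nu)/s}/\mathsf Z(\nu)$, $b(\nu)=\mathsf Z(\nu)^{1/\theta}$, $\bar a=\sum_i\lambda_ia_i$, and $\Phi(\nu)=\tau_0(\bar a-\mathsf Z(\nu)^{1/\theta})$ (this equals the infimum over $b>0$ of $\sum_i\lambda_i\mathsf U_{\tau_0,\tau_1}(a_i\mu_i,b\nu)$, where $\mathsf U_{\tau_0,\tau_1}(\alpha,\beta)=\inf_\gamma\{\int\|x-y\|^2d\gamma+\tau_0\mathrm{KL}(\gamma_0\mid\alpha)+\tau_1\mathrm{KL}(\gamma_1\mid\beta)\}$ over finite nonnegative measures $\gamma$ on $\mathbb R^d\times\mathbb R^d$ with marginals $\gamma_0,\gamma_1$, with $\mathrm{KL}(\rho\mid\eta)=\int(r\log r-r+1)d\eta$, $r=d\rho/d\eta$, for finite measures). The moment map is $T(\nu)=\mathcal N(m^+,\Sigma^+)$ with $m^+=\sum_i\omega_i(\nu)v_i$ and $\Sigma^+=\sum_i\omega_i(\nu)[Q_i+(v_i-m^+)(v_i-m^+)^\top]$. *)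

(* Defs.v *)
From HB Require Import structures.
From mathcomp Require Import all_boot all_order all_algebra.
From mathcomp Require Import all_classical all_reals all_analysis.
From mathcomp Require Import measurable_realfun.
Import Order.TTheory GRing.Theory Num.Theory.
Import numFieldNormedType.Exports.

Set Implicit Arguments.
Unset Strict Implicit.
Unset Printing Implicit Defensive.

Local Open Scope classical_set_scope.
Local Open Scope ring_scope.

Section lebesgue_tuple.
Context {R : realType}.
Local Notation mR := (measurableTypeR R).

Definition tuple_cons n (z : mR * n.-tuple mR) : n.+1.-tuple mR :=
  [tuple of z.1 :: z.2].

Definition tuple_uncons n (x : n.+1.-tuple mR) : mR * n.-tuple mR :=
  (thead x, [tuple of behead x]).

Lemma measurable_tuple_cons n : measurable_fun [set: _] (@tuple_cons n).
Proof. exact: measurable_cons. Qed.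

Lemma measurable_tuple_uncons n : measurable_fun [set: _] (@tuple_uncons n).
Proof.
apply/measurable_fun_pair; first exact: measurable_tnth.
exact: measurable_behead.
Qed.

Lemma tuple_consK n : cancel (@tuple_cons n) (@tuple_uncons n).
Proof.
by case=> a t; rewrite /tuple_uncons/= theadE; congr pair; exact: val_inj.
Qed.

Section cons_measure.
Variables (n : nat) (mu : {sigma_finite_measure set (n.-tuple mR) -> \bar R}).

Definition cons_measure : set (n.+1.-tuple mR) -> \bar R :=
  pushforward (@lebesgue_measure R \x mu)%E (@tuple_cons n).

Let cons0 : cons_measure set0 = 0%E.
Proof. by rewrite /cons_measure /pushforward preimage_set0 measure0. Qed.

Let cons_ge0 A : (0 <= cons_measure A)%E.
Proof. by rewrite /cons_measure /pushforward measure_ge0. Qed.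

Let cons_sigma_additive : semi_sigma_additive cons_measure.
Proof.
move=> F mF tF mUF; rewrite /cons_measure /pushforward preimage_bigcup.
apply: measure_semi_sigma_additive.
- by move=> k; rewrite -[X in measurable X]setTI; exact: measurable_tuple_cons.
- apply/trivIsetP => /= i j _ _ ij; rewrite -preimage_setI.
  by move/trivIsetP : tF => /(_ _ _ _ _ ij) ->//; rewrite preimage_set0.
- rewrite -preimage_bigcup -[X in measurable X]setTI.
  exact: measurable_tuple_cons.
Qed.

HB.instance Definition _ := isMeasure.Build _ _ _
  cons_measure cons0 cons_ge0 cons_sigma_additive.

Let cons_sigma_finite : sigma_finite [set: _] cons_measure.
Proof.
have /sigma_finiteP[F [TF ndF Foo]] := sigma_finiteT (@lebesgue_measure R).
have /sigma_finiteP[G [TG ndG Goo]] := sigma_finiteT mu.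
have mFG k : measurable (F k `*` G k).
  by apply: measurableX; [case: (Foo k)|case: (Goo k)].
exists (fun k => @tuple_uncons n @^-1` (F k `*` G k)).
  rewrite -preimage_bigcup; apply/esym/seteqP; split => // x _.
  have : [set: mR] (tuple_uncons x).1 by [].
  rewrite TF => -[i _ Fi].
  have : [set: n.-tuple mR] (tuple_uncons x).2 by [].
  rewrite TG => -[j _ Gj].
  exists (maxn i j) => //; split.
    by move: Fi; exact/subsetPset/ndF/leq_maxl.
  by move: Gj; exact/subsetPset/ndG/leq_maxr.
move=> k; split.
  by rewrite -[X in measurable X]setTI; exact: measurable_tuple_uncons.
rewrite /cons_measure /pushforward -comp_preimage.
rewrite (_ : _ \o _ = id); last by apply/funext => z /=; rewrite tuple_consK.
have [mF ?] := Foo k; have [mG ?] := Goo k.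
by rewrite preimage_id product_measure1E// lte_mul_pinfty// ge0_fin_numE.
Qed.

HB.instance Definition _ := Measure_isSigmaFinite.Build _ _ _
  cons_measure cons_sigma_finite.

End cons_measure.

(* Lebesgue measure on R^n, with R^n carried by n.-tuple R and its product
   (i.e. Borel) sigma-algebra. *)
Fixpoint lebesgue_tuple n : {sigma_finite_measure set (n.-tuple mR) -> \bar R} :=
  match n with
  | 0 => \d_([tuple] : 0.-tuple mR)
  | n'.+1 => cons_measure (lebesgue_tuple n')
  end.

End lebesgue_tuple.

Section matrices.
Context {R : realType}.

Definition quadf n (A : 'M[R]_n) (x : 'cV[R]_n) : R := (x^T *m A *m x) 0 0.

Definition posdef n (A : 'M[R]_n) : Prop :=
  A^T = A /\ forall x : 'cV[R]_n, x != 0 -> 0 < quadf A x.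

(* The positive definite square root, unique when A is positive definite. *)
Definition sqrtmx n (A : 'M[R]_n) : 'M[R]_n :=
  xget 0 [set S | posdef S /\ S *m S = A].

Definition invsqrtmx n (A : 'M[R]_n) : 'M[R]_n := invmx (sqrtmx A).

Definition lambda_min n (A : 'M[R]_n) : R := inf [set l | eigenvalue A l].

(* The multiplicity of l as a generalized eigenvalue of the pair (H, B), i.e.
   the dimension of the space of the v such that H v = l B v. *)
Definition gen_eig_mult n (H B : 'M[R]_n) (l : R) : nat :=
  (n - \rank (H - l *: B)%R)%N.

Definition bnorm n (B : 'M[R]_n) (h : 'cV[R]_n) : R := Num.sqrt (quadf B h).

Definition opbnorm n (B A : 'M[R]_n) : R :=
  sup [set bnorm B (A *m h) / bnorm B h | h in [set h | h != 0]].

End matrices.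

Section calculus.
Context {R : realType}.

Fixpoint Ck_on (V W : normedModType R) (k : nat) (U : set V) (f : V -> W) : Prop :=
  match k with
  | 0 => forall x, U x -> {for x, continuous f}
  | k'.+1 => (forall x, U x -> differentiable f x) /\
             forall v, Ck_on k' U (fun x => 'd f x v)
  end.

Definition smooth_on (V W : normedModType R) (U : set V) (f : V -> W) : Prop :=
  forall k, Ck_on k U f.

Definition basis_vec n (i : 'I_n) : 'cV[R]_n := delta_mx i 0.

(* Column convention: jacobian_mx f x *m v = 'd f x v, unlike the library's 'J. *)
Definition jacobian_mx n m (f : 'cV[R]_n -> 'cV[R]_m) (x : 'cV[R]_n) : 'M[R]_(m, n) :=
  \matrix_(i, j) ('d f x (basis_vec j)) i 0.

Definition hessian_mx n (f : 'cV[R]_n -> R) (x : 'cV[R]_n) : 'M[R]_n :=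
  \matrix_(i, j) 'D_(basis_vec i) (fun y => 'D_(basis_vec j) f y) x.

End calculus.

Section gaussian.
Context {R : realType}.
Local Notation mR := (measurableTypeR R).

Definition col_of_tuple d (x : d.-tuple mR) : 'cV[R]_d := \col_i tnth x i.

Section gauss.
Variables (d : nat) (m : 'cV[R]_d) (S : 'M[R]_d).

Definition gauss_pdf (x : d.-tuple mR) : R :=
  (Num.sqrt ((2 * pi) ^+ d * \det S))^-1 *
  expR (- quadf (invmx S) (col_of_tuple x - m) / 2).

Lemma gauss_pdf_ge0 x : 0 <= gauss_pdf x.
Proof. by rewrite mulr_ge0 ?invr_ge0 ?sqrtr_ge0 ?expR_ge0. Qed.

Lemma measurable_gauss_pdf : measurable_fun [set: _] gauss_pdf.
Proof.
apply: measurable_funM => //; apply: measurableT_comp => //.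
apply: measurable_funM => //; apply: measurableT_comp => //.
have mx i : measurable_fun [set: d.-tuple mR]
    (fun x => (col_of_tuple x - m) i 0).
  under eq_fun do rewrite !mxE.
  by apply: measurable_funB => //; exact: measurable_tnth.
rewrite (_ : (fun _ => _) = (fun x => \sum_i
    (\sum_j (col_of_tuple x - m) j 0 * invmx S j i) *
    (col_of_tuple x - m) i 0)).
  apply: measurable_sum => i; apply: measurable_funM => //.
  by apply: measurable_sum => j; exact: measurable_funM.
apply/funext => x; rewrite /quadf mxE; apply: eq_bigr => i _.
by rewrite mxE; congr (_ * _); apply: eq_bigr => j _; rewrite mxE.
Qed.

Definition gauss (A : set (d.-tuple mR)) : \bar R :=
  (\int[lebesgue_tuple d]_(x in A) (gauss_pdf x)%:E)%E.

Let gauss0 : gauss set0 = 0%E.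
Proof. by rewrite /gauss integral_set0. Qed.

Let gauss_ge0 A : (0 <= gauss A)%E.
Proof. by apply: integral_ge0 => x _; rewrite lee_fin gauss_pdf_ge0. Qed.

Let gauss_sigma_additive : semi_sigma_additive gauss.
Proof.
move=> F mF tF mUF; rewrite /gauss ge0_integral_bigcup//.
- apply: is_cvg_ereal_nneg_natsum_cond => k _ _.
  exact: gauss_ge0.
- apply/measurable_funTS/measurableT_comp => //.
  exact: measurable_gauss_pdf.
- by move=> x _; rewrite lee_fin gauss_pdf_ge0.
Qed.

HB.instance Definition _ := isMeasure.Build _ _ _
  gauss gauss0 gauss_ge0 gauss_sigma_additive.

Let gauss_sigma_finite : sigma_finite [set: _] gauss.
Proof.
have /sigma_finiteP[F [TF ndF Foo]] := sigma_finiteT (@lebesgue_tuple R d).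
have mpdf k : measurable [set x | gauss_pdf x <= k%:R].
  rewrite -[X in measurable X]setTI.
  exact: measurable_fun_le measurable_gauss_pdf _.
exists (fun k => F k `&` [set x | gauss_pdf x <= k%:R]).
  apply/esym/seteqP; split => // x _.
  have : [set: d.-tuple mR] x by [].
  rewrite TF => -[i _ Fix].
  pose k := maxn i (Num.trunc (gauss_pdf x)).+1.
  exists k => //; split.
    have /subsetPset : (F i <= F k)%O by exact/ndF/leq_maxl.
    exact.
  apply: le_trans (ltW (Num.Theory.truncnS_gt _)) _.
  by rewrite ler_nat leq_maxr.
move=> k; have [mF Fk] := Foo k; split; first exact: measurableI.
set E := F k `&` _; have mE : measurable E by exact: measurableI.
have gE : (gauss E <= k%:R%:E * lebesgue_tuple d E)%E.
  rewrite -integral_cst//; apply: ge0_le_integral => //.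
  - by move=> x _; rewrite lee_fin gauss_pdf_ge0.
  - apply/measurable_funTS/measurableT_comp => //.
    exact: measurable_gauss_pdf.
  - by move=> x [_]; rewrite lee_fin.
apply: (le_lt_trans gE); rewrite lte_mul_pinfty ?lee_fin//.
by apply: le_lt_trans Fk; apply: le_measure; rewrite ?inE// => x [].
Qed.

HB.instance Definition _ := Measure_isSigmaFinite.Build _ _ _
  gauss gauss_sigma_finite.

End gauss.
End gaussian.

Section entropy_transport.
Context {R : realType} {dd : measure_display} {T : measurableType dd}.
Local Open Scope ereal_scope.

(* The entropy of finite measures; on probability measures it is the relative
   entropy, since the terms - r + 1 then integrate to 0. *)
Definition KL (rho : {finite_measure set T -> \bar R})
    (eta : {sigma_finite_measure set T -> \bar R}) : \bar R :=
  if `[< rho `<< eta >] then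
    \int[eta]_x (let r := fine (Radon_Nikodym (charge_of_finite_measure rho) eta x)
                 in (r * ln r - r + 1)%R%:E)
  else +oo.

Definition coupling (p q : probability T R) : set (probability (T * T)%type R) :=
  [set g | forall A, measurable A ->
     g (fst @^-1` A) = p A /\ g (snd @^-1` A) = q A].

End entropy_transport.

Section functional.
Context {R : realType}.
Local Notation mR := (measurableTypeR R).
Local Open Scope ereal_scope.
Variables (d : nat) (tau0 tau1 : R).
Implicit Types (mu nu : {sigma_finite_measure set (d.-tuple mR) -> \bar R})
  (p q : probability (d.-tuple mR) R).

Definition sqdist (x y : d.-tuple mR) : R :=
  (\sum_(i < d) (tnth x i - tnth y i) ^+ 2)%R.

Definition W2sq p q : \bar R :=
  ereal_inf [set \int[g]_z (sqdist z.1 z.2)%:E | g in coupling p q].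

Definition A_obj mu nu p q : \bar R :=
  W2sq p q + tau0%:E * KL p mu + tau1%:E * KL q nu.

Definition A_inf mu nu : \bar R :=
  ereal_inf [set A_obj mu nu pq.1 pq.2 | pq in [set: probability (d.-tuple mR) R *
                                                     probability (d.-tuple mR) R]].

Definition is_minimizer mu nu p q : Prop := A_obj mu nu p q = A_inf mu nu.

End functional.

(* N(m, S) is represented by the pair (m, S). *)
Notation gpar R d := ('cV[R]_d * 'M[R]_d)%type.

Section gaussian_family.
Context {R : realType} {d : nat}.
Implicit Types (mu nu : gpar R d).

Definition gaussians : set (gpar R d) := [set nu | posdef nu.2].

(* The symmetric bilinear form whose quadratic form is
   dm^T S^-1 dm + tr(S^-1 H S^-1 H) / 2 on a tangent vector (dm, H). *)
Definition fisher_rao nu (u w : gpar R d) : R :=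
  (u.1^T *m invmx nu.2 *m w.1) 0 0 +
  \tr (invmx nu.2 *m u.2 *m invmx nu.2 *m w.2) / 2.

Definition gdim : nat := (d + 'C(d.+1, 2))%N.

Definition sympart nu : gpar R d := (nu.1, 2^-1 *: (nu.2 + nu.2^T)).

(* Smoothness of ch_map on the relatively open set ch_dom of pairs (m, S) with S
   symmetric is expressed by precomposing with the linear projection S |-> (S + S^T)/2,
   which yields a function on an open set of R^d x M_d. *)
Record smooth_chart := SmoothChart {
  ch_dom : set (gpar R d);
  ch_cod : set 'cV[R]_gdim;
  ch_map : gpar R d -> 'cV[R]_gdim;
  ch_inv : 'cV[R]_gdim -> gpar R d;
  ch_dom_open : exists2 U, open U & ch_dom = gaussians `&` U;
  ch_cod_open : open ch_cod;
  ch_mapK : forall nu, ch_dom nu -> ch_cod (ch_map nu) /\ ch_inv (ch_map nu) = nu;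
  ch_invK : forall x, ch_cod x -> ch_dom (ch_inv x) /\ ch_map (ch_inv x) = x;
  ch_map_smooth : smooth_on (sympart @^-1` ch_dom) (ch_map \o sympart);
  ch_inv_smooth : smooth_on ch_cod ch_inv
}.

Definition fisher_rao_mx (c : smooth_chart) nu : 'M[R]_gdim :=
  let x := ch_map c nu in
  \matrix_(i, j) fisher_rao nu ('d (ch_inv c) x (basis_vec i))
                               ('d (ch_inv c) x (basis_vec j)).

End gaussian_family.
Arguments gdim d : clear implicits.
Arguments smooth_chart R d : clear implicits.

Section barycenter.
Context {R : realType} {d n : nat}.
Local Notation mR := (measurableTypeR R).
Variables (tau0 tau1 : R) (lam a : 'I_n -> R) (mus : 'I_n -> gpar R d).
Implicit Types (mu nu : gpar R d).

Definition gaussm nu : {sigma_finite_measure set (d.-tuple mR) -> \bar R} :=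
  gauss nu.1 nu.2.

Definition A_val mu nu : R := fine (A_inf tau0 tau1 (gaussm mu) (gaussm nu)).

(* The parameters (v, Q) of the second component of the minimizer; the default
   (0, 1) would only be returned if there were no Gaussian minimizer. *)
Definition q_par mu nu : gpar R d :=
  xget (0, 1%:M) [set vQ | gaussians vQ /\
    exists p q : probability (d.-tuple mR) R,
      is_minimizer tau0 tau1 (gaussm mu) (gaussm nu) p q /\
      forall A, measurable A -> q A = gaussm vQ A].

Definition tsum : R := tau0 + tau1.

Definition theta : R := tau0 / tsum.

Definition Zweight nu (i : 'I_n) : R :=
  lam i * (a i `^ theta) * expR (- A_val (mus i) nu / tsum).

Definition Zsum nu : R := \sum_i Zweight nu i.

Definition omega nu (i : 'I_n) : R := Zweight nu i / Zsum nu.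

Definition mass nu : R := Zsum nu `^ theta^-1.

Definition Phi nu : R := tau0 * (\sum_i lam i * a i - Zsum nu `^ theta^-1).

Definition moment_map nu : gpar R d :=
  let v i := (q_par (mus i) nu).1 in
  let Q i := (q_par (mus i) nu).2 in
  let mp := \sum_i omega nu i *: v i in
  (mp, \sum_i omega nu i *: (Q i + (v i - mp) *m (v i - mp)^T)).

End barycenter.

(* Main.v *)
(** The minimizer for (mu, nu) is an affine coupling whose linear part solves a Riccati
    equation; the log-density ratios of its marginals are quadratic dual potentials, so weak
    duality gives optimality and uniqueness.  Fixing the minimizer (p, q) at nu and varying nu
    gives A(mu, nu') - A(mu, nu) <= tau1 (KL(q | nu') - KL(q | nu)).  Since (p, q) depends
    continuously on nu, exchanging nu and nu' in this bound identifies the derivative of A in nu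
    as that of tau1 KL(q | nu) for fixed q.  Averaged over i, d Phi(nu) is minus tau1 b(nu)
    times the Fisher-Rao pairing with T(nu) - nu, up to a second-order term in the means.
    Differentiating once more at a fixed point gives H = B (I - DT).

    Convexity of exp turns the same bounds into Phi(nu) <= Phi(nu0) + tau1 b(nu0) KL(nu0 | nu)
    at a fixed point nu0.  The Hessian of the right-hand side there is B; hence H <= B, and
    I - B^-1 H is B-symmetric with spectrum in [0, 1).  Linear convergence follows by
    contraction, and the second-order expansion of Phi squares the rate for the objective. *)

From HB Require Import structures.
From mathcomp Require Import all_boot all_order all_algebra.
From mathcomp Require Import all_classical all_reals all_analysis.
From mathcomp Require Import measurable_realfun ring lra.
Require Import Defs.
Import Order.TTheory GRing.Theory Num.Theory.
Import numFieldNormedType.Exports.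

Set Implicit Arguments.
Unset Strict Implicit.
Unset Printing Implicit Defensive.

Local Open Scope classical_set_scope.
Local Open Scope ring_scope.

(** * Positive definite matrices *)

(** Only first derivatives of the minimizer are ever needed. The derivative of [Phi] pairs
    [bary_score] with the Fisher-Rao metric, and the score vanishes at a fixed point. The product
    rule there asks only for continuity of the mass, the metric and the chart differential, so no
    second derivative of a chart appears. The score itself is differentiable because the difference
    of two Riccati solutions satisfies an exact Lyapunov equation with a coercive operator; this
    replaces the implicit function theorem.

    Two obstacles shape the statements. For d >= 2 the symmetric matrices have empty interior among
    all matrices, so functions on the Gaussian manifold are precomposed with [sympart] before being
    differentiated, and open conditions are conditional on symmetry. Moreover the gradient in a
    chart is differentiated at the fixed point only, so second-order information comes from the mean
    value theorem with an unknown intermediate point instead of Taylor's formula. The symmetry of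
    the Hessian is read off from its assumed positive definiteness. *)

Section quadratic_forms.
Context {R : realType}.

Definition bilf n (A : 'M[R]_n) (x y : 'cV[R]_n) : R := (x^T *m A *m y) 0 0.

Definition psdmx n (A : 'M[R]_n) : Prop :=
  A^T = A /\ forall x, 0 <= quadf A x.

Lemma bilfE n (A : 'M[R]_n) x y : bilf A x y = \sum_i \sum_j x i 0 * A i j * y j 0.
Proof.
rewrite /bilf mxE exchange_big /=; apply: eq_bigr => j _.
by rewrite mxE big_distrl; apply: eq_bigr => i _; rewrite mxE.
Qed.

Lemma quadfE n (A : 'M[R]_n) x : quadf A x = bilf A x x.
Proof. by []. Qed.

Lemma bilfDl n (A : 'M[R]_n) x y z : bilf A (x + y) z = bilf A x z + bilf A y z.
Proof. by rewrite /bilf linearD !mulmxDl mxE. Qed.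

Lemma bilfDr n (A : 'M[R]_n) x y z : bilf A x (y + z) = bilf A x y + bilf A x z.
Proof. by rewrite /bilf mulmxDr mxE. Qed.

Lemma bilfZl n (A : 'M[R]_n) k x y : bilf A (k *: x) y = k * bilf A x y.
Proof. by rewrite /bilf linearZ /= -!scalemxAl mxE. Qed.

Lemma bilfZr n (A : 'M[R]_n) k x y : bilf A x (k *: y) = k * bilf A x y.
Proof. by rewrite /bilf -!scalemxAr mxE. Qed.

Lemma bilfNl n (A : 'M[R]_n) x y : bilf A (- x) y = - bilf A x y.
Proof. by rewrite -scaleN1r bilfZl mulN1r. Qed.

Lemma bilfNr n (A : 'M[R]_n) x y : bilf A x (- y) = - bilf A x y.
Proof. by rewrite -scaleN1r bilfZr mulN1r. Qed.

Lemma bilfBl n (A : 'M[R]_n) x y z : bilf A (x - y) z = bilf A x z - bilf A y z.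
Proof. by rewrite bilfDl bilfNl. Qed.

Lemma bilfBr n (A : 'M[R]_n) x y z : bilf A x (y - z) = bilf A x y - bilf A x z.
Proof. by rewrite bilfDr bilfNr. Qed.

Lemma bilf0l n (A : 'M[R]_n) y : bilf A 0 y = 0.
Proof. by rewrite /bilf linear0 !mul0mx mxE. Qed.

Lemma bilfDm n (A B : 'M[R]_n) x y : bilf (A + B) x y = bilf A x y + bilf B x y.
Proof. by rewrite /bilf mulmxDr mulmxDl mxE. Qed.

Lemma bilfZm n k (A : 'M[R]_n) x y : bilf (k *: A) x y = k * bilf A x y.
Proof. by rewrite /bilf -scalemxAr -scalemxAl mxE. Qed.

Lemma bilfNm n (A : 'M[R]_n) x y : bilf (- A) x y = - bilf A x y.
Proof. by rewrite -scaleN1r bilfZm mulN1r. Qed.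

Lemma bilfBm n (A B : 'M[R]_n) x y : bilf (A - B) x y = bilf A x y - bilf B x y.
Proof. by rewrite bilfDm bilfNm. Qed.

Lemma bilf_sym n (A : 'M[R]_n) x y : A^T = A -> bilf A x y = bilf A y x.
Proof.
move=> sA; rewrite /bilf -[in LHS](trmxK (_ *m y)) mxE !trmx_mul trmxK sA.
by rewrite mulmxA.
Qed.

Lemma bilf_mulr n (A B : 'M[R]_n) x y : bilf A x (B *m y) = bilf (A *m B) x y.
Proof. by rewrite /bilf !mulmxA. Qed.

Lemma quadf_congr n m (A : 'M[R]_n) (B : 'M[R]_(n, m)) x :
  quadf A (B *m x) = quadf (B^T *m A *m B) x.
Proof. by rewrite /quadf trmx_mul !mulmxA. Qed.

Lemma quadf0 n (A : 'M[R]_n) : quadf A 0 = 0.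
Proof. exact: bilf0l. Qed.

Lemma quadfZ n (A : 'M[R]_n) k x : quadf A (k *: x) = k ^+ 2 * quadf A x.
Proof. by rewrite !quadfE bilfZl bilfZr mulrA. Qed.

Lemma quadfDe n (A : 'M[R]_n) x y : A^T = A ->
  quadf A (x + y) = quadf A x + 2 * bilf A x y + quadf A y.
Proof.
move=> sA; rewrite !quadfE bilfDl !bilfDr (bilf_sym y x sA); ring.
Qed.

Lemma quadf1E n (x : 'cV[R]_n) : quadf 1%:M x = \sum_i x i 0 ^+ 2.
Proof.
rewrite /quadf mulmx1 mxE; apply: eq_bigr => i _; by rewrite mxE expr2.
Qed.

Lemma quadf1_ge0 n (x : 'cV[R]_n) : 0 <= quadf 1%:M x.
Proof. by rewrite quadf1E sumr_ge0// => i _; rewrite sqr_ge0. Qed.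

Lemma quadf1_eq0 n (x : 'cV[R]_n) : quadf 1%:M x = 0 -> x = 0.
Proof.
rewrite quadf1E => /eqP; rewrite psumr_eq0; last by move=> i _; rewrite sqr_ge0.
move=> /allP h; apply/colP => i; rewrite !mxE; apply/eqP.
by rewrite -sqrf_eq0; apply: (implyP (h i _)); rewrite ?mem_index_enum.
Qed.

Lemma quadf1_gt0 n (x : 'cV[R]_n) : x != 0 -> 0 < quadf 1%:M x.
Proof.
move=> x0; rewrite lt_neqAle quadf1_ge0 andbT eq_sym; apply: contra x0 => /eqP h.
exact/eqP/quadf1_eq0.
Qed.

Lemma posdef1 n : posdef (1%:M : 'M[R]_n).
Proof. by split; [rewrite trmx1|exact: quadf1_gt0]. Qed.

Lemma posdefZ n (k : R) (A : 'M[R]_n) : 0 < k -> posdef A -> posdef (k *: A).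
Proof.
move=> k0 [sA pA]; split; first by rewrite linearZ /= sA.
by move=> x x0; rewrite quadfE bilfZm mulr_gt0 // pA.
Qed.

Lemma posdefD n (A B : 'M[R]_n) : posdef A -> posdef B -> posdef (A + B).
Proof.
move=> [sA pA] [sB pB]; split; first by rewrite linearD /= sA sB.
by move=> x x0; rewrite quadfE bilfDm addr_gt0 ?pA ?pB.
Qed.

Lemma posdef_psd n (A : 'M[R]_n) : posdef A -> psdmx A.
Proof.
move=> [sA pA]; split=> // x; have [->|x0] := eqVneq x 0.
  by rewrite quadf0.
exact/ltW/pA.
Qed.

Lemma posdefDpsd n (A B : 'M[R]_n) : posdef A -> psdmx B -> posdef (A + B).
Proof.
move=> [sA pA] [sB pB]; split; first by rewrite linearD /= sA sB.
by move=> x x0; rewrite quadfE bilfDm ltr_wpDr ?pA ?pB.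
Qed.

Lemma posdef_unit n (A : 'M[R]_n) : posdef A -> A \in unitmx.
Proof.
move=> [sA pA]; rewrite -row_free_unit -kermx_eq0.
apply/eqP/row_matrixP => i; rewrite row0.
  apply/eqP/negP => /negP h.
  have h' : (row i (kermx A))^T != 0.
    by apply: contra h => /eqP/(congr1 trmx); rewrite trmxK linear0 => ->.
  have := pA _ h'; rewrite /quadf trmxK -row_mul mulmx_ker.
  by rewrite row0 mul0mx mxE ltxx.
Qed.

Lemma posdef_congr n (A B : 'M[R]_n) : B \in unitmx -> posdef A ->
  posdef (B^T *m A *m B).
Proof.
move=> uB [sA pA]; split; first by rewrite !trmx_mul trmxK sA mulmxA.
move=> x x0; rewrite -quadf_congr; apply: pA; apply: contra x0 => /eqP h.
by rewrite -(mulKmx uB x) h mulmx0.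
Qed.

Lemma psdmx_congr n m (A : 'M[R]_n) (B : 'M[R]_(n, m)) : psdmx A ->
  psdmx (B^T *m A *m B).
Proof.
move=> [sA pA]; split; first by rewrite !trmx_mul trmxK sA mulmxA.
by move=> x; rewrite -quadf_congr.
Qed.

Lemma trmx_posdef_inv n (A : 'M[R]_n) : A^T = A -> (invmx A)^T = invmx A.
Proof. by move=> sA; rewrite trmx_inv sA. Qed.

Lemma posdef_inv n (A : 'M[R]_n) : posdef A -> posdef (invmx A).
Proof.
move=> pA; have uA := posdef_unit pA.
have -> : invmx A = (invmx A)^T *m A *m invmx A.
  by rewrite (trmx_posdef_inv pA.1) mulVmx // mul1mx.
by apply: posdef_congr; rewrite ?unitmx_inv.
Qed.

(* A nonnegative quadratic polynomial in t whose constant term vanishes has no linear term. *)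
Lemma psd_ker n (A : 'M[R]_n) x : psdmx A -> quadf A x = 0 -> A *m x = 0.
Proof.
move=> [sA pA] qx; apply: quadf1_eq0.
set h := A *m x; set c := quadf 1%:M h.
have key t : 0 <= 2 * t * c + t ^+ 2 * quadf A h.
  have := pA (x + t *: h); rewrite (quadfDe _ _ sA) qx add0r quadfZ bilfZr mulrA.
  by rewrite (bilf_sym _ _ sA) {1}/bilf -mulmxA -/h /c /quadf mulmx1.
have c0 : 0 <= c := quadf1_ge0 h.
apply/eqP; rewrite eq_le c0 andbT leNgt; apply/negP => cp.
set q := quadf A h in key; have q0 : 0 <= q := pA h.
have := key (- (c / (q + 1))).
have -> : 2 * - (c / (q + 1)) * c + (- (c / (q + 1))) ^+ 2 * q
        = - (c / (q + 1)) ^+ 2 * (q + 2).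
  by field; rewrite gt_eqF // ltr_wpDl.
apply/negP; rewrite -ltNge mulNr oppr_lt0 mulr_gt0 ?exprn_gt0 ?divr_gt0 ?ltr_wpDl//.
Qed.

End quadratic_forms.

(** * Continuity of the matrix operations *)

Section continuity.
Context {R : realType}.

Lemma cvg_mx (T : Type) (F : set_system T) {FF : Filter F} m n
    (f : T -> 'M[R]_(m, n)) (l : 'M[R]_(m, n)) :
  (forall i j, f t i j @[t --> F] --> l i j) -> f t @[t --> F] --> l.
Proof.
move=> h A [P hP sA].
have : \forall t \near F, forall i j, P i j (f t i j).
  by apply: filter_forall => i; apply: filter_forall => j; apply: h; exact: hP.
by apply: filterS => t ht; exact: sA.
Qed.

Lemma cvg_mxE (T : Type) (F : set_system T) {FF : Filter F} m n
    (f : T -> 'M[R]_(m, n)) (l : 'M[R]_(m, n)) i j :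
  f t @[t --> F] --> l -> f t i j @[t --> F] --> l i j.
Proof. by move=> h; exact: (cvg_comp _ _ h (@coord_continuous _ _ _ i j l)). Qed.

Lemma cvg_tr (T : Type) (F : set_system T) {FF : Filter F} m n
    (f : T -> 'M[R]_(m, n)) (l : 'M[R]_(m, n)) :
  f t @[t --> F] --> l -> (f t)^T @[t --> F] --> l^T.
Proof.
move=> h; apply: cvg_mx => i j; rewrite mxE.
by under eq_fun do rewrite mxE; exact: cvg_mxE.
Qed.

Lemma trmx_continuous m n : continuous (@trmx R m n).
Proof.
move=> v; apply: (@cvg_tr _ (nbhs v) _ m n id v); exact: cvg_id.
Qed.

Lemma cvg_mulmx (T : Type) (F : set_system T) {FF : Filter F} m n p
    (f : T -> 'M[R]_(m, n)) (g : T -> 'M[R]_(n, p))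
    (a : 'M[R]_(m, n)) (b : 'M[R]_(n, p)) :
  f t @[t --> F] --> a -> g t @[t --> F] --> b ->
  f t *m g t @[t --> F] --> a *m b.
Proof.
move=> h k; apply: cvg_mx => i j; rewrite mxE.
under eq_fun do rewrite mxE.
apply: cvg_big => [|l _]; first exact: add_continuous.
by apply: cvgM; exact: cvg_mxE.
Qed.

Lemma cvg_det (T : Type) (F : set_system T) {FF : Filter F} n
    (f : T -> 'M[R]_n) (a : 'M[R]_n) :
  f t @[t --> F] --> a -> \det (f t) @[t --> F] --> \det a.
Proof.
move=> h; apply: cvg_big => [|s _]; first exact: add_continuous.
apply: cvgM; first exact: cvg_cst.
apply: cvg_big => [|i _]; last exact: cvg_mxE.
exact: mul_continuous.
Qed.

(** Cramer's rule: cofactors and determinant are polynomials in the entries, and the determinant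
    stays nonzero near the limit. *)
Lemma cvg_invmx (T : Type) (F : set_system T) {FF : Filter F} n
    (f : T -> 'M[R]_n) (a : 'M[R]_n) : a \in unitmx ->
  f t @[t --> F] --> a -> invmx (f t) @[t --> F] --> invmx a.
Proof.
move=> ua h.
have d0 : \det a != 0 by rewrite -unitfE -unitmxE.
have dc : \det (f t) @[t --> F] --> \det a by exact: cvg_det.
have ca : (\det (f t))^-1 *: \adj (f t) @[t --> F] --> invmx a.
  rewrite /invmx ua; apply: cvg_mx => i j; rewrite mxE.
  under eq_fun do rewrite mxE.
  apply: cvgM; first exact: cvgV.
  rewrite mxE; under eq_fun do rewrite mxE.
  apply: cvgM; first exact: cvg_cst.
  apply: cvg_det; apply: cvg_mx => k l; rewrite !mxE.
  by under eq_fun do rewrite !mxE; exact: cvg_mxE.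
apply: cvg_trans ca; apply: near_eq_cvg.
have : \forall t \near F, \det (f t) != 0.
  exact: (cvgr_neq0 _ dc).
by apply: filterS => t dt; rewrite /invmx unitmxE unitfE dt.
Qed.

Lemma cvg_mxtrace (T : Type) (F : set_system T) {FF : Filter F} n
    (f : T -> 'M[R]_n) (a : 'M[R]_n) :
  f t @[t --> F] --> a -> \tr (f t) @[t --> F] --> \tr a.
Proof.
move=> h; apply: cvg_big => [|s _]; first exact: add_continuous.
exact: cvg_mxE.
Qed.

Lemma cvg_bilf (T : Type) (F : set_system T) {FF : Filter F} n
    (A : T -> 'M[R]_n) (f g : T -> 'cV[R]_n) (a : 'M[R]_n) (x y : 'cV[R]_n) :
  A t @[t --> F] --> a -> f t @[t --> F] --> x -> g t @[t --> F] --> y ->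
  bilf (A t) (f t) (g t) @[t --> F] --> bilf a x y.
Proof.
move=> hA hf hg; apply: cvg_mxE; apply: cvg_mulmx => //; apply: cvg_mulmx => //.
exact: cvg_tr.
Qed.

Lemma cvg_bilfc (T : Type) (F : set_system T) {FF : Filter F} n (A : 'M[R]_n)
    (f g : T -> 'cV[R]_n) (x y : 'cV[R]_n) :
  f t @[t --> F] --> x -> g t @[t --> F] --> y ->
  bilf A (f t) (g t) @[t --> F] --> bilf A x y.
Proof.
by move=> hf hg; apply: (@cvg_bilf T F FF n (fun=> A)) => //; exact: cvg_cst.
Qed.

End continuity.

(** * Rayleigh quotients and square roots *)

Section rayleigh.
Context {R : realType}.

(** Let v minimize the form over the compact unit sphere, with minimum l. Then A - l is positive
    semidefinite and its form vanishes at v, so [psd_ker] makes v an eigenvector; neither Lagrange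
    multipliers nor complex eigenvalues enter. *)
Lemma rayleigh_min n (A : 'M[R]_n) : (0 < n)%N -> A^T = A ->
  exists l (v : 'cV[R]_n), [/\ quadf 1%:M v = 1, A *m v = l *: v &
    forall x, l * quadf 1%:M x <= quadf A x].
Proof.
move=> n0 sA.
pose S := [set v : 'rV[R]_n | quadf 1%:M v^T = 1].
have cS : compact S.
  apply: bounded_closed_compact.
    exists 1; split => // M M1 v Sv /=.
    rewrite [leLHS]/Num.norm/= mx_normrE; apply: bigmax_le => [|[i j] _].
      by rewrite (le_trans ler01) // ltW.
    rewrite /= ord1; apply: le_trans (ltW M1).
    have : v 0 j ^+ 2 <= 1.
      move: Sv; rewrite /S /= quadf1E => <-.
      rewrite (bigD1 j) //= mxE lerDl; apply: sumr_ge0 => k _; exact: sqr_ge0.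
    by move=> h; rewrite -(@ler_pXn2r _ 2) ?nnegrE // expr1n real_normK ?num_real.
  have -> : S = (fun v : 'rV[R]_n => bilf 1%:M v^T v^T) @^-1` [set 1] by [].
  apply: preimage_closed => [v _|]; last exact: closed_eq.
  exact: (cvg_bilfc (@trmx_continuous _ _ _ v) (@trmx_continuous _ _ _ v)).
pose i0 := Ordinal n0.
have S0 : S !=set0.
  exists (delta_mx 0 i0); rewrite /S /= quadf1E (bigD1 i0) //= !mxE !eqxx expr1n.
  by rewrite big1 ?addr0 // => i /negPf ii; rewrite !mxE ii expr0n.
have cf : {within S, continuous (fun v : 'rV[R]_n => bilf A v^T v^T)}.
  apply: continuous_subspaceT => v.
  exact: (cvg_bilfc (@trmx_continuous _ _ _ v) (@trmx_continuous _ _ _ v)).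
have [v0 /set_mem Sv minv] := compact_EVT_min S0 cS cf.
pose v := v0^T; pose l := quadf A v.
have ray x : l * quadf 1%:M x <= quadf A x.
  have [->|x0] := eqVneq x 0; first by rewrite !quadf0 mulr0.
  have q0 := quadf1_gt0 x0; set q := quadf _ x in q0 *.
  pose k := (Num.sqrt q)^-1.
  have kk : k ^+ 2 = q^-1 by rewrite exprVn sqr_sqrtr // ltW.
  have : (k *: x)^T \in S.
    by apply/mem_set; rewrite /S /= trmxK quadfZ kk mulVf // gt_eqF.
  move/minv; rewrite trmxK -/v -!quadfE -/l quadfZ kk mulrC.
  by rewrite ler_pdivlMr.
exists l, v; split => //.
have sB : (A - l%:M)^T = A - l%:M by rewrite linearB /= sA tr_scalar_mx.
have lE x : quadf (A - l%:M) x = quadf A x - l * quadf 1%:M x.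
  by rewrite !quadfE bilfBm -(scalemx1 _ l) bilfZm.
have : psdmx (A - l%:M) by split => // x; rewrite lE subr_ge0.
move/psd_ker => /(_ v); rewrite lE /l.
have -> : quadf 1%:M v = 1 by [].
rewrite mulr1 subrr => /(_ erefl); rewrite mulmxBl mul_scalar_mx => /eqP.
by rewrite subr_eq0 => /eqP.
Qed.

Lemma posdef_lbound n (A : 'M[R]_n) : posdef A ->
  exists2 c, 0 < c & forall x, c * quadf 1%:M x <= quadf A x.
Proof.
case: n A => [|n] A pA.
  by exists 1 => // x; rewrite (flatmx0 x) !quadf0 mulr0.
have [l [v [v1 Av ray]]] := rayleigh_min (ltn0Sn n) pA.1.
exists l => //.
have v0 : v != 0.
  by apply: contraTneq isT => v0; move: v1; rewrite v0 quadf0 => /eqP; rewrite eq_sym oner_eq0.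
have := pA.2 v v0; rewrite /quadf -mulmxA Av -scalemxAr mxE.
by move: v1; rewrite /quadf mulmx1 => ->; rewrite mulr1.
Qed.

(** The Householder reflection exchanging v and w. It supplies the orthogonal change of basis that
    splits off an eigenvector in [posdef_sqrt]. *)
Lemma reflection n (v w : 'cV[R]_n) : quadf 1%:M v = 1 -> quadf 1%:M w = 1 ->
  exists U : 'M[R]_n, [/\ U^T = U, U *m U = 1%:M & U *m w = v].
Proof.
move=> v1 w1; have [->|vw] := eqVneq v w.
  by exists 1%:M; rewrite trmx1 !mul1mx.
pose u := v - w; pose c := quadf 1%:M u.
have c0 : c != 0 by rewrite gt_eqF // quadf1_gt0 // subr_eq0.
have uu : u^T *m u = c%:M.
  by apply/matrixP => i j; rewrite !ord1 [RHS]mxE eqxx /c /quadf mulmx1.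
pose U := 1%:M - (2 / c) *: (u *m u^T); exists U.
have uw : u^T *m w = (- (c / 2))%:M.
  apply/matrixP => i j; rewrite !ord1 [RHS]mxE eqxx.
  have -> : (u^T *m w) 0 0 = bilf 1%:M u w by rewrite /bilf mulmx1.
  rewrite /c quadfE /u !bilfBl !bilfBr -!quadfE v1 w1 (bilf_sym w v) ?trmx1 // mulr1n; by field.
split; [by rewrite /U linearB /= trmx1 linearZ /= trmx_mul trmxK | |].
- rewrite /U mulmxBl mul1mx mulmxBr mulmx1 -scalemxAl -scalemxAr !mulmxA.
  rewrite -(mulmxA u) uu mul_mx_scalar -!scalemxAl scalerA.
  rewrite scalerA -scalerBl -addrA -opprD -scalerDl (_ : _ + (_ - _) = 0).
    by rewrite scale0r subr0.
  by field.
- rewrite /U mulmxBl mul1mx -scalemxAl -mulmxA uw mul_mx_scalar scalerA.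
  rewrite (_ : _ * _ = -1); last by field.
  by rewrite scaleN1r opprK /u addrCA subrr addr0.
Qed.

(** Induction on the dimension: a reflection carrying the first basis vector to an eigenvector
    conjugates A to a block diagonal matrix, and each of the two blocks has a square root. *)
Lemma posdef_sqrt n (A : 'M[R]_n) : posdef A ->
  exists S, posdef S /\ S *m S = A.
Proof.
elim: n A => [|n IH] A pA.
  by exists A; split => //; rewrite (flatmx0 A); apply: flatmx0.
have [l [v [v1 Av ray]]] := rayleigh_min (ltn0Sn n) pA.1.
have v0 : v != 0.
  by apply: contraTneq isT => v0; move: v1; rewrite v0 quadf0 => /eqP; rewrite eq_sym oner_eq0.
have l0 : 0 < l.
  have := pA.2 v v0; rewrite /quadf -mulmxA Av -scalemxAr mxE.
  by move: v1; rewrite /quadf mulmx1 => ->; rewrite mulr1.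
pose e : 'cV[R]_(1 + n) := delta_mx 0 0.
have e1 : quadf 1%:M e = 1.
  rewrite quadf1E (bigD1 0) //= !mxE !eqxx expr1n.
  by rewrite big1 ?addr0 // => i /negPf ii; rewrite !mxE ii expr0n.
have e00 : e 0 0 = 1 by rewrite mxE.
have ej0 j : j != 0 -> e j 0 = 0 by move=> /negPf jj; rewrite mxE jj.
have [U [sU UU Ue]] := @reflection n.+1 v e v1 e1.
have uU : U \in unitmx by have [] := mulmx1_unit UU.
pose B : 'M[R]_(1 + n) := U *m A *m U.
have pB : posdef B.
  by rewrite /B -{1}sU; apply: posdef_congr.
have Be : B *m e = l *: e.
  by rewrite /B -!mulmxA Ue Av -scalemxAr -Ue mulmxA UU mul1mx.
have Bl : lsubmx B = l *: e.
  rewrite -Be; apply/colP => i; rewrite mxE.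
  rewrite [RHS]mxE (bigD1 0) //= big1 ?addr0.
    rewrite e00 mulr1 (_ : lshift n 0 = 0) //; exact/val_inj.
  by move=> j jj; rewrite ej0 // mulr0.
have Bul : ulsubmx B = l%:M.
  apply/matrixP => i j; rewrite /ulsubmx !mxE.
  have := congr1 (fun M : 'M[R]_(1 + n, 1) => M (lshift n i) j) Bl.
  by rewrite !mxE !ord1 eqxx mulr1 => <-.
have Bdl : dlsubmx B = 0.
  apply/matrixP => i j; rewrite !mxE.
  have := congr1 (fun M : 'M[R]_(1 + n, 1) => M (rshift 1 i) j) Bl.
  by rewrite !mxE !ord1 /= mulr0.
have Bur : ursubmx B = 0.
  by apply: trmx_inj; rewrite trmx_ursub pB.1 Bdl trmx0.
have BE : B = block_mx l%:M 0 0 (drsubmx B).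
  by rewrite -{1}(submxK B) Bul Bdl Bur.
pose C := drsubmx B.
have pC : posdef C.
  split; first by rewrite /C trmx_drsub pB.1.
  move=> x x0; have := pB.2 (col_mx 0 x); rewrite col_mx_eq0 eqxx /= => /(_ x0).
  rewrite BE /quadf -/C tr_col_mx trmx0 mul_row_block !mul0mx add0r mulmx0 add0r.
  by rewrite mul_row_col mul0mx add0r.
have [S [pS SS]] := IH C pC.
pose D : 'M[R]_(1 + n) := block_mx (Num.sqrt l)%:M 0 0 S.
have DD : D *m D = B.
  rewrite /D mulmx_block !(mul0mx, mulmx0) !(addr0, add0r) SS -scalar_mxM.
  by rewrite -expr2 sqr_sqrtr ?ltW // [RHS]BE.
have pD : posdef D.
  split; first by rewrite /D tr_block_mx tr_scalar_mx !trmx0 pS.1.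
  move=> x x0; rewrite -(vsubmxK x) /quadf /D tr_col_mx mul_row_block.
  rewrite !mulmx0 addr0 add0r mul_row_col mxE mul_mx_scalar -scalemxAl mxE.
  have s0 : 0 < Num.sqrt l by rewrite sqrtr_gt0.
  have qu : quadf 1%:M (usubmx x) = ((usubmx x)^T *m usubmx x) 0 0.
    by rewrite /quadf mulmx1.
  rewrite -qu -/(quadf S (dsubmx x)).
  have [d0|d0] := eqVneq (dsubmx x) 0.
    rewrite d0 quadf0 addr0 mulr_gt0 // quadf1_gt0 //.
    apply: contra x0 => /eqP u0; apply/eqP; rewrite -(vsubmxK x) u0 d0.
    exact: col_mx0.
  by rewrite ltr_wpDl ?pS.2 // mulr_ge0 ?quadf1_ge0 // ltW.
exists (U *m D *m U); split.
  by rewrite -{1}sU; apply: posdef_congr.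
rewrite !mulmxA -(mulmxA (U *m D)) UU mulmx1 -(mulmxA U D D) DD /B !mulmxA UU mul1mx.
by rewrite -mulmxA UU mulmx1.
Qed.

Lemma det_posdef_gt0 n (A : 'M[R]_n) : posdef A -> 0 < \det A.
Proof.
move=> pA; have [S [pS <-]] := posdef_sqrt pA.
rewrite det_mulmx -expr2 exprn_even_gt0 //=.
by have := posdef_unit pS; rewrite unitmxE unitfE.
Qed.

(** With B = S S the trace is that of S A S, a sum of values of the form of A at the columns of
    S. *)
Lemma psdmx_tr_ge0 n (A B : 'M[R]_n) : psdmx A -> posdef B ->
  0 <= \tr (A *m B).
Proof.
move=> pA pB; have [S [pS <-]] := posdef_sqrt pB.
rewrite mulmxA mxtrace_mulC mulmxA; apply: sumr_ge0 => i _.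
have [_ /(_ (delta_mx i 0))] := psdmx_congr S pA; rewrite pS.1.
rewrite /quadf -mulmxA -colE trmx_delta -rowE => /le_trans; apply.
by rewrite !mxE.
Qed.

End rayleigh.

(** * Riccati and Lyapunov equations *)

Section riccati.
Context {R : realType}.

Lemma quadfBm n (A B : 'M[R]_n) x : quadf (A - B) x = quadf A x - quadf B x.
Proof. exact: bilfBm. Qed.

Lemma quadfZm n k (A : 'M[R]_n) x : quadf (k *: A) x = k * quadf A x.
Proof. exact: bilfZm. Qed.

(** Tested at an eigenvector of the least eigenvalue l of W, the hypothesis gives l^2 > c^2, and l
    bounds the form of W from below. *)
Lemma posdef_sub_scalar n (W : 'M[R]_n) c : 0 < c -> posdef W ->
  posdef (W *m W - c ^+ 2 *: 1%:M) -> posdef (W - c *: 1%:M).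
Proof.
case: n W => [|n] W c0 pW pWc.
  by rewrite (flatmx0 (_ - _)) -(flatmx0 W).
have [l [v [v1 Av ray]]] := rayleigh_min (ltn0Sn n) pW.1.
have v0 : v != 0.
  by apply: contraTneq isT => v0; move: v1; rewrite v0 quadf0 => /eqP; rewrite eq_sym oner_eq0.
have lE : quadf W v = l.
  rewrite /quadf -mulmxA Av -scalemxAr mxE.
  by move: v1; rewrite /quadf mulmx1 => ->; rewrite mulr1.
have l0 : 0 < l by rewrite -lE; exact: pW.2.
have lc : c < l.
  have := pWc.2 v v0; rewrite quadfBm quadfZm v1 mulr1 /quadf -!mulmxA Av.
  rewrite -!scalemxAr Av -!scalemxAr scalerA mxE -expr2.
  have -> : (v^T *m v) 0 0 = 1 by rewrite -v1 /quadf mulmx1.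
  by rewrite mulr1 subr_gt0 ltr_pXn2r // nnegrE ltW.
split; first by rewrite linearB linearZ /= trmx1 pW.1.
move=> x x0; rewrite quadfBm quadfZm subr_gt0.
by apply: lt_le_trans (ray x); rewrite ltr_pM2r // quadf1_gt0.
Qed.

Lemma posdef_sqr n (Y : 'M[R]_n) : posdef Y -> posdef (Y *m Y).
Proof.
move=> pY; have -> : Y *m Y = Y^T *m 1%:M *m Y by rewrite mulmx1 pY.1.
by apply: posdef_congr; [exact: posdef_unit|exact: posdef1].
Qed.

Lemma sqr_shift n (Y : 'M[R]_n) a :
  (Y + a *: 1%:M) *m (Y + a *: 1%:M) = Y *m Y + (2 * a) *: Y + a ^+ 2 *: 1%:M.
Proof.
rewrite mulmxDl !mulmxDr -!scalemxAl -!scalemxAr !mul1mx mulmx1 scalerA.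
by move: (Y *m Y) => Y2; apply/matrixP => i j; rewrite !mxE; ring.
Qed.

(** With N N = M1 and X = N L N the equation becomes X X + k X = K with a scalar k, solved by
    completing the square. Of the two inequalities, the first makes the covariance of p positive
    definite; the second makes the linearized equation coercive, on which the regularity of L in S1
    rests. *)
Lemma riccati_exists n (t0 t1 : R) (S0 S1 : 'M[R]_n) : 0 < t0 -> 0 < t1 ->
  posdef S0 -> posdef S1 ->
  let M0 := S0 + (2 / t0) *: 1%:M in
  let M1 := S1 + (2 / t1) *: 1%:M in
  exists L, [/\ posdef L, L *m M1 *m L + (2 / t0 - 2 / t1) *: L = M0,
    posdef (M0 - (2 / t0) *: L) &
    posdef (L - (2 / t1) *: invmx M1)].
Proof.
move=> t00 t10 pS0 pS1 M0 M1.
have a0 : 0 < 2 / t0 by rewrite divr_gt0.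
have a1 : 0 < 2 / t1 by rewrite divr_gt0.
have p1 := @posdef1 R n.
have pM0 : posdef M0 by apply: posdefD => //; exact: posdefZ.
have pM1 : posdef M1 by apply: posdefD => //; exact: posdefZ.
have [N [pN NN]] := posdef_sqrt pM1.
have uN := posdef_unit pN.
have sN := pN.1.
pose k := 2 / t0 - 2 / t1.
pose K := N *m M0 *m N.
have KE : K = N *m S0 *m N + (2 / t0) *: S1 + (2 / t0 * (2 / t1)) *: 1%:M.
  rewrite /K /M0 mulmxDr mulmxDl -scalemxAr mulmx1 -scalemxAl NN /M1 scalerDr.
  by rewrite scalerA addrA.
(* c is chosen so that (k / 2)^2 + (2 / t0) (2 / t1) = c^2. Hence K + (k / 2)^2 = D + c^2, which is
   W W below, and X = W - k / 2 = Y + 2 / t1. *)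
pose c := t0^-1 + t1^-1.
have c0 : 0 < c by rewrite addr_gt0 ?invr_gt0.
pose D := N *m S0 *m N + (2 / t0) *: S1.
have pD : posdef D.
  by apply: posdefD; [rewrite -{1}sN; exact: posdef_congr | exact: posdefZ].
have [W [pW WW]] : exists W, posdef W /\ W *m W = D + c ^+ 2 *: 1%:M.
  by apply: posdef_sqrt; apply: posdefD => //; apply: posdefZ => //; rewrite exprn_gt0.
pose Y := W - c *: 1%:M.
(* W W exceeds c^2 by the positive definite D, so W exceeds c. Both inequalities for L reduce to the
   positivity of Y. *)
have pY : posdef Y by apply: posdef_sub_scalar => //; rewrite WW addrK.
pose X := Y + (2 / t1) *: 1%:M.
have YY : Y *m Y = W *m W - (2 * c) *: W + c ^+ 2 *: 1%:M.
  by rewrite /Y -scaleNr sqr_shift sqrrN mulrN scaleNr.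
have XX : X *m X + k *: X = K.
  rewrite KE -/D /X sqr_shift YY WW /Y /k; move: (D) => D'.
  by apply/matrixP => i j; rewrite !mxE /c; field; rewrite !gt_eqF.
have XY : K - (2 / t0) *: X = Y *m Y + (2 / t1) *: Y.
  rewrite -XX /X sqr_shift YY WW /Y /k; move: (D) => D'.
  by apply/matrixP => i j; rewrite !mxE /c; field; rewrite !gt_eqF.
have sV : (invmx N)^T = invmx N by rewrite trmx_posdef_inv.
have uV : invmx N \in unitmx by rewrite unitmx_inv.
have VNN : invmx N *m M1 *m invmx N = 1%:M.
  by rewrite -NN mulmxA mulVmx // mul1mx mulmxV.
have M1V : invmx M1 = invmx N *m invmx N.
  have H : M1 *m (invmx N *m invmx N) = 1%:M.
    by rewrite -NN mulmxA -(mulmxA N N) mulmxV // mulmx1 mulmxV.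
  by rewrite -[LHS]mulmx1 -H mulKmx // posdef_unit.
have VKV : invmx N *m K *m invmx N = M0.
  by rewrite /K !mulmxA mulVmx // mul1mx -mulmxA mulmxV // mulmx1.
have linV (A B : 'M[R]_n) : invmx N *m (A + k *: B) *m invmx N =
    invmx N *m A *m invmx N + k *: (invmx N *m B *m invmx N).
  by rewrite mulmxDr mulmxDl -scalemxAr -scalemxAl.
have congV A : posdef A -> posdef (invmx N *m A *m invmx N).
  by move=> pA; rewrite -{1}sV; exact: posdef_congr.
have pL2 : posdef (invmx N *m X *m invmx N - (2 / t1) *: invmx M1).
  have -> : invmx N *m X *m invmx N - (2 / t1) *: invmx M1 = invmx N *m Y *m invmx N.
    by rewrite /X mulmxDr mulmxDl -scalemxAr mulmx1 -scalemxAl M1V addrK.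
  exact: congV.
exists (invmx N *m X *m invmx N); split => //.
- rewrite -(subrK ((2 / t1) *: invmx M1) (_ *m _ *m _)); apply: posdefD => //.
  by apply: posdefZ => //; exact: posdef_inv.
- rewrite -VKV -XX -/k linV; congr (_ + _).
  transitivity (invmx N *m X *m (invmx N *m M1 *m invmx N) *m X *m invmx N).
    by rewrite !mulmxA.
  by rewrite VNN mulmx1 !mulmxA.
- rewrite -VKV scalemxAl scalemxAr -mulmxBl -mulmxBr XY; apply: congV.
  by apply: posdefD; [exact: posdef_sqr|exact: posdefZ].
Qed.

(** Each half of the symmetrized product is the trace of a positive semidefinite matrix against W,
    built from E M and from E^T M respectively. As W dominates c M^-1, each is at least c times the
    Frobenius norm of E weighted by M. *)
Lemma lyapunov_coercive n (M W E : 'M[R]_n) c : posdef M ->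
  posdef (W - c *: invmx M) ->
  c * \tr (M *m E^T *m M *m E) <=
  \tr (M *m E^T *m M *m (2^-1 *: (E *m M *m W + W *m M *m E))).
Proof.
move=> pM pW; have uM := posdef_unit pM; have sM := pM.1.
have psG p (F : 'M[R]_(n, p)) : psdmx (F^T *m M *m F) by apply: psdmx_congr; exact: posdef_psd.
have key F : c * \tr (F^T *m M *m F *m invmx M) <= \tr (F^T *m M *m F *m W).
  have := psdmx_tr_ge0 (psG _ F) pW.
  by rewrite mulmxBr linearB /= -scalemxAr linearZ /= subr_ge0.
have e1 := key (E *m M); have e2 := key (E^T *m M).
rewrite -scalemxAr linearZ /= mulmxDr linearD /=.
have h1 : \tr ((E *m M)^T *m M *m (E *m M) *m invmx M) = \tr (M *m E^T *m M *m E).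
  by rewrite trmx_mul sM !mulmxA mulmxK.
have h2 : \tr ((E^T *m M)^T *m M *m (E^T *m M) *m invmx M) = \tr (M *m E^T *m M *m E).
  rewrite trmx_mul trmxK sM !mulmxA mulmxK // mxtrace_mulC !mulmxA.
  by rewrite mxtrace_mulC !mulmxA mxtrace_mulC !mulmxA.
have h3 : \tr ((E *m M)^T *m M *m (E *m M) *m W) = \tr (M *m E^T *m M *m (E *m M *m W)).
  by rewrite trmx_mul sM !mulmxA.
have h4 : \tr ((E^T *m M)^T *m M *m (E^T *m M) *m W) = \tr (M *m E^T *m M *m (W *m M *m E)).
  rewrite trmx_mul trmxK sM [RHS]mxtrace_mulC -!mulmxA [RHS]mxtrace_mulC !mulmxA.
  by [].
move: e1 e2; rewrite h1 h2 h3 h4; lra.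
Qed.

Lemma frobenius_eq0 n (N E : 'M[R]_n) : posdef N ->
  \tr (N *m N *m E^T *m (N *m N) *m E) = \sum_i \sum_j (N *m E *m N) i j ^+ 2.
Proof.
move=> pN; have -> : \tr (N *m N *m E^T *m (N *m N) *m E) =
    \tr ((N *m E *m N) *m (N *m E *m N)^T).
  rewrite !trmx_mul pN.1 mxtrace_mulC !mulmxA mxtrace_mulC !mulmxA.
  by rewrite mxtrace_mulC !mulmxA mxtrace_mulC !mulmxA.
rewrite /mxtrace; apply: eq_bigr => i _; rewrite mxE; apply: eq_bigr => j _.
by rewrite [_^T]/trmx mxE expr2.
Qed.

(** The form is tested at the sum and at the difference of two basis vectors. *)
Lemma psdmx_entry n (A : 'M[R]_n) i j : psdmx A -> `|A i j| <= (A i i + A j j) / 2.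
Proof.
move=> [sA pA].
have dE k l : bilf A (delta_mx k 0) (delta_mx l 0) = A k l.
  by rewrite /bilf trmx_delta -rowE -colE !mxE.
have sAij : A j i = A i j by rewrite -{1}sA mxE.
have := pA (delta_mx i 0 + delta_mx j 0); have := pA (delta_mx i 0 - delta_mx j 0).
rewrite !quadfE !bilfBl !bilfBr !bilfDl !bilfDr !dE sAij ler_norml => h1 h2.
apply/andP; split; lra.
Qed.

End riccati.

(** * Relative entropy *)

Section relative_entropy.
Context {R : realType} {dd : measure_display} {T : measurableType dd}.

(** Fenchel's inequality for exp and its conjugate r ln r - r, that is, the tangent line of exp at
    ln r; the case r = 0 is separate because of the logarithm. *)
Lemma young_entropy (r s : R) : 0 <= r -> r * s <= r * ln r - r + expR s.
Proof.
rewrite le_eqVlt => /predU1P[<-|r0].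
  by rewrite !mul0r subrr add0r expR_ge0.
have := expR_ge1Dx (s - ln r); rewrite expRB lnK ?posrE // ler_pdivlMr //.
by move=> h; lra.
Qed.

Lemma young_entropy_eq (r s : R) : 0 <= r -> r * s = r * ln r - r + expR s ->
  r = expR s.
Proof.
rewrite le_eqVlt => /predU1P[<-|r0].
  by rewrite !mul0r subrr add0r => /esym.
move=> h; have [sr|sr] := eqVneq (s - ln r) 0.
  by rewrite -[LHS]lnK ?posrE //; congr expR; lra.
have := expR_gt1Dx sr; rewrite expRB lnK ?posrE // ltr_pdivlMr //.
by move=> h'; exfalso; lra.
Qed.

Lemma entropy_ge0 (r : R) : 0 <= r -> 0 <= r * ln r - r + 1.
Proof. by move=> r0; have := young_entropy 0 r0; rewrite mulr0 expR0. Qed.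

Local Open Scope ereal_scope.
Variables (rho : {finite_measure set T -> \bar R})
  (eta : {sigma_finite_measure set T -> \bar R}).

Let f0 := Radon_Nikodym_SigmaFinite.f rho eta.
Let r x := fine (f0 x).

Section dominated.
Hypothesis rho_eta : rho `<< eta.

Let r_ge0 x : (0 <= r x)%R.
Proof. by rewrite fine_ge0// Radon_Nikodym_SigmaFinite.f_ge0. Qed.

Let rE x : (r x)%:E = f0 x.
Proof. by rewrite fineK// Radon_Nikodym_SigmaFinite.f_fin_num. Qed.

Let mr : measurable_fun setT r.
Proof.
apply: measurableT_comp => //.
exact: measurable_int (Radon_Nikodym_SigmaFinite.f_integrable rho_eta).
Qed.

Let mrl : measurable_fun setT (fun x => r x * ln (r x) - r x)%R.
Proof.
apply: measurable_funB => //; apply: measurable_funM => //.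
by apply: measurableT_comp => //; exact: measurable_ln.
Qed.

Lemma density_integral (g : T -> R) : measurable_fun setT g -> (forall x, 0 <= g x)%R ->
  \int[rho]_x (g x)%:E = \int[eta]_x (g x * r x)%:E.
Proof.
move=> mg g0; rewrite -(Radon_Nikodym_SigmaFinite.change_of_variables rho_eta)//.
- by apply: eq_integral => x _; rewrite EFinM rE.
- exact/measurable_EFinP.
Qed.

(** The derivative in the definition of [KL] is determined only almost everywhere. The
    representative [f0] is finite and nonnegative at every point, so pointwise inequalities apply to
    it. *)
Lemma KL_density : KL rho eta = \int[eta]_x (r x * ln (r x) - r x + 1)%:E.
Proof.
rewrite /KL; case: asboolP => // _.
have RNe : ae_eq eta setT (Radon_Nikodym (charge_of_finite_measure rho) eta) f0.
  exact/ae_eq_sym/ae_eq_Radon_Nikodym_SigmaFinite.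
have mRN : measurable_fun setT (Radon_Nikodym (charge_of_finite_measure rho) eta).
  exact: measurable_int (Radon_Nikodym_integrable _).
have mfRN : measurable_fun setT
    (fun x => fine (Radon_Nikodym (charge_of_finite_measure rho) eta x)).
  exact: measurableT_comp.
apply: ae_eq_integral => //.
- apply/measurable_EFinP; apply: measurable_funD => //.
  apply: measurable_funB => //; apply: measurable_funM => //.
  by apply: measurableT_comp => //; exact: measurable_ln.
- by apply/measurable_EFinP; exact: measurable_funD.
- by move: RNe; apply: filterS => x + _ => /(_ I) ->.
Qed.

(* The gap in Young's inequality [r s <= (r ln r - r) + exp s]. *)
Definition entropy_gap (s : T -> R) x : R :=
  (r x * ln (r x) - r x + expR (s x) - r x * s x)%R.

Let gap_ge0 s x : (0 <= entropy_gap s x)%R.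
Proof. by rewrite subr_ge0 young_entropy. Qed.

(** The Gibbs variational principle with its remainder: when the gap is integrated, the 1 in the
    entropy integrand cancels against the integral of [expR (s x)]. It yields the lower bound on
    [KL], its equality case, and the value for an explicit density. *)
Lemma KL_gap (s : T -> R) : eta setT = 1 -> measurable_fun setT s ->
  \int[eta]_x (expR (s x))%:E = 1 ->
  rho.-integrable setT (EFin \o s) ->
  KL rho eta = \int[eta]_x (entropy_gap s x)%:E + \int[rho]_x (s x)%:E.
Proof.
move=> eta1 ms es1 is_.
(* [KL] may be infinite, so subtraction is postponed: s is split into positive and negative parts,
   [key] is an equality between sums of nonnegative integrals, and only the finite terms are then
   moved across. *)
pose sp x := Num.max (s x) 0%R; pose sn x := Num.max (- s x)%R 0%R.
have msp : measurable_fun setT sp by exact: measurable_maxr.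
have msn : measurable_fun setT sn.
  by apply: measurable_maxr => //; exact: measurableT_comp.
have sp0 x : (0 <= sp x)%R by rewrite le_max lexx orbT.
have sn0 x : (0 <= sn x)%R by rewrite le_max lexx orbT.
have spn x : (s x = sp x - sn x)%R.
  by rewrite /sp /sn /Num.max; case: ifPn; case: ifPn => *; lra.
have mg : measurable_fun setT (entropy_gap s).
  apply: measurable_funB; last exact: measurable_funM.
  by apply: measurable_funD => //; exact: measurableT_comp.
have ip : \int[rho]_x (sp x)%:E < +oo.
  move/integrableP: is_ => [_]; apply: le_lt_trans; apply: ge0_le_integral => //.
  - by move=> x _; rewrite lee_fin.
  - exact/measurable_EFinP.
  - by apply: measurableT_comp => //; exact/measurable_EFinP.
  - by move=> x _; rewrite lee_fin ge_max ler_norm normr_ge0.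
have in_ : \int[rho]_x (sn x)%:E < +oo.
  move/integrableP: is_ => [_]; apply: le_lt_trans; apply: ge0_le_integral => //.
  - by move=> x _; rewrite lee_fin.
  - exact/measurable_EFinP.
  - by apply: measurableT_comp => //; exact/measurable_EFinP.
  - by move=> x _; rewrite lee_fin ge_max -normrN ler_norm normr_ge0.
have sE : \int[rho]_x (s x)%:E = \int[rho]_x (sp x)%:E - \int[rho]_x (sn x)%:E.
  under eq_integral do rewrite spn EFinB.
  rewrite integralB//; apply/integrableP; split.
  - exact/measurable_EFinP.
  - by under eq_integral do rewrite /= ger0_norm//.
  - exact/measurable_EFinP.
  - by under eq_integral do rewrite /= ger0_norm//.
have ip0 : 0 <= \int[rho]_x (sp x)%:E by apply: integral_ge0 => x _; rewrite lee_fin.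
have in0 : 0 <= \int[rho]_x (sn x)%:E by apply: integral_ge0 => x _; rewrite lee_fin.
have KL0 : 0 <= KL rho eta.
  by rewrite KL_density; apply: integral_ge0 => x _; rewrite lee_fin entropy_ge0.
have g0 : 0 <= \int[eta]_x (entropy_gap s x)%:E.
  by apply: integral_ge0 => x _; rewrite lee_fin.
have key : \int[eta]_x (entropy_gap s x)%:E + 1 + \int[rho]_x (sp x)%:E =
    KL rho eta + 1 + \int[rho]_x (sn x)%:E.
  have -> : \int[eta]_x (entropy_gap s x)%:E + 1 + \int[rho]_x (sp x)%:E =
      \int[eta]_x (entropy_gap s x + 1 + sp x * r x)%:E.
    under [RHS]eq_integral do rewrite EFinD.
    rewrite ge0_integralD//=; last 4 first.
    - by move=> x _; rewrite lee_fin addr_ge0.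
    - by apply/measurable_EFinP; exact: measurable_funD.
    - by move=> x _; rewrite lee_fin mulr_ge0.
    - by apply/measurable_EFinP; exact: measurable_funM.
    rewrite -density_integral//; congr (_ + _).
    under [RHS]eq_integral do rewrite EFinD.
    rewrite ge0_integralD//=; last 2 first.
    - by move=> x _; rewrite lee_fin.
    - exact/measurable_EFinP.
    by rewrite integral_cst//= eta1 mule1.
  rewrite KL_density [X in _ = _ + X]density_integral//.
  have -> : \int[eta]_x (r x * ln (r x) - r x + 1)%:E + 1 =
    \int[eta]_x (r x * ln (r x) - r x + 1)%:E + \int[eta]_x (expR (s x))%:E by rewrite es1.
  have me : measurable_fun setT (fun x => expR (s x)) by exact: measurableT_comp.
  rewrite -ge0_integralD//=; last 3 first.
  - by move=> x _; rewrite lee_fin entropy_ge0.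
  - by apply/measurable_EFinP; exact: measurable_funD.
  - exact/measurable_EFinP.
  rewrite -ge0_integralD//=; last 4 first.
  - by move=> x _; rewrite lee_fin addr_ge0// ?entropy_ge0// expR_ge0.
  - by apply/measurable_EFinP; apply: measurable_funD => //; exact: measurable_funD.
  - by move=> x _; rewrite lee_fin mulr_ge0.
  - by apply/measurable_EFinP; exact: measurable_funM.
  apply: eq_integral => x _; rewrite -!EFinD /entropy_gap; congr EFin.
  by rewrite [in X in (_ - X)%R]spn; ring.
move: key; rewrite sE.
move: ip in_ ip0 in0 KL0 g0.
move: (\int[rho]_x (sp x)%:E) (\int[rho]_x (sn x)%:E) (KL rho eta)
  (\int[eta]_x (entropy_gap s x)%:E) => [a| |] [b| |] [c| |] [d| |] //=.
by move=> _ _ _ _ _ _ [h]; rewrite -EFinB -EFinD; congr EFin; lra.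
Qed.

End dominated.

Lemma KL_ge0 : 0 <= KL rho eta.
Proof.
rewrite /KL; case: asboolP => // rho_eta; apply: integral_ge0 => x _.
rewrite lee_fin; case: (lerP 0 (fine (Radon_Nikodym (charge_of_finite_measure rho) eta x))).
  exact: entropy_ge0.
by move=> h; rewrite ln0 ?ltW// mulr0 sub0r; lra.
Qed.

Lemma KL_finite_dominates : KL rho eta < +oo -> rho `<< eta.
Proof. by rewrite /KL; case: asboolP. Qed.

(** By Young's inequality g r is at most the entropy integrand plus exp g. Finite entropy therefore
    transfers integrability from exponential moments under [eta] to plain moments under [rho]. *)
Lemma KL_finite_integrable (g : T -> R) : KL rho eta < +oo ->
  measurable_fun setT g -> (forall x, 0 <= g x)%R ->
  \int[eta]_x (expR (g x))%:E < +oo -> \int[rho]_x (g x)%:E < +oo.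
Proof.
move=> KLoo mg g0 ig; have dom := KL_finite_dominates KLoo.
rewrite density_integral//.
have mr : measurable_fun setT r.
  apply: measurableT_comp => //.
  exact: measurable_int (Radon_Nikodym_SigmaFinite.f_integrable dom).
have r_ge0 x : (0 <= r x)%R.
  by rewrite fine_ge0// Radon_Nikodym_SigmaFinite.f_ge0.
have mrl : measurable_fun setT (fun x => r x * ln (r x) - r x + 1)%R.
  apply: measurable_funD => //; apply: measurable_funB => //.
  apply: measurable_funM => //.
  by apply: measurableT_comp => //; exact: measurable_ln.
have me : measurable_fun setT (fun x => expR (g x)) by exact: measurableT_comp.
apply: (@le_lt_trans _ _ (KL rho eta + \int[eta]_x (expR (g x))%:E)); last first.
  by rewrite lte_add_pinfty.
rewrite KL_density// -ge0_integralD//=; last 3 first.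
- by move=> x _; rewrite lee_fin entropy_ge0.
- exact/measurable_EFinP.
- exact/measurable_EFinP.
apply: ge0_le_integral => //.
- by move=> x _; rewrite lee_fin mulr_ge0.
- by apply/measurable_EFinP; exact: measurable_funM.
- by apply/measurable_EFinP; exact: measurable_funD.
- move=> x _; rewrite lee_fin; have := young_entropy (g x) (r_ge0 x); rewrite mulrC.
  by lra.
Qed.

Section normalized.
Hypothesis eta1 : eta setT = 1.
Variable s : T -> R.
Hypothesis ms : measurable_fun setT s.
Hypothesis es1 : \int[eta]_x (expR (s x))%:E = 1.
Hypothesis is_ : rho.-integrable setT (EFin \o s).

Lemma KL_ge_integral : \int[rho]_x (s x)%:E <= KL rho eta.
Proof.
have [KLoo|] := ltP (KL rho eta) +oo; last by rewrite leye_eq => /eqP ->; exact: leey.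
have dom := KL_finite_dominates KLoo.
rewrite (KL_gap dom eta1 ms es1 is_) leeDr//.
apply: integral_ge0 => x _; rewrite lee_fin subr_ge0 young_entropy//.
by rewrite fine_ge0// Radon_Nikodym_SigmaFinite.f_ge0.
Qed.

(** Equality forces the nonnegative gap to vanish almost everywhere, and Young's inequality is an
    equality only for r = exp s. *)
Lemma KL_eq_integral_density : KL rho eta = \int[rho]_x (s x)%:E ->
  forall A, measurable A -> rho A = \int[eta]_(x in A) (expR (s x))%:E.
Proof.
move=> KLs A mA.
have is_fin := integrable_fin_num measurableT is_.
have dom : rho `<< eta.
  by apply: KL_finite_dominates; rewrite KLs ltey_eq is_fin.
have mr : measurable_fun setT r.
  apply: measurableT_comp => //.
  exact: measurable_int (Radon_Nikodym_SigmaFinite.f_integrable dom).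
have r_ge0 x : (0 <= r x)%R.
  by rewrite fine_ge0// Radon_Nikodym_SigmaFinite.f_ge0.
have mg : measurable_fun setT (entropy_gap s).
  apply: measurable_funB; last exact: measurable_funM.
  apply: measurable_funD; last exact: measurableT_comp.
  apply: measurable_funB => //; apply: measurable_funM => //.
  by apply: measurableT_comp => //; exact: measurable_ln.
have gap0 : \int[eta]_x `|(entropy_gap s x)%:E| = 0.
  under eq_integral do rewrite /= ger0_norm ?subr_ge0 ?young_entropy//.
  have := KL_gap dom eta1 ms es1 is_; rewrite KLs.
  move: is_fin; rewrite /=.
  case: (\int[rho]_x (s x)%:E) => // a _.
  case: (\int[eta]_x (entropy_gap s x)%:E) => // b [h]; congr EFin; lra.
move/ae_eq_integral_abs: gap0 => /(_ measurableT).
have /[swap]/[apply] gap0 : measurable_fun setT (EFin \o entropy_gap s).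
  exact/measurable_EFinP.
rewrite (Radon_Nikodym_SigmaFinite.f_integral dom)//.
apply: ae_eq_integral => //.
- apply: measurable_funTS.
  exact: measurable_int (Radon_Nikodym_SigmaFinite.f_integrable dom).
- by apply: measurable_funTS; apply/measurable_EFinP; exact: measurableT_comp.
- move: gap0; apply: filterS => x /(_ I) [] /eqP.
  rewrite subr_eq0 => /eqP h _; rewrite -(young_entropy_eq (r_ge0 x) (esym h)).
  by rewrite fineK// Radon_Nikodym_SigmaFinite.f_fin_num.
Qed.

Lemma KL_of_density :
  (forall A, measurable A -> rho A = \int[eta]_(x in A) (expR (s x))%:E) ->
  KL rho eta = \int[rho]_x (s x)%:E.
Proof.
move=> rhoE.
have me : measurable_fun setT (fun x => expR (s x)) by exact: measurableT_comp.
have dom : rho `<< eta.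
  apply/null_content_dominatesP => A mA eA0; rewrite rhoE//.
  apply: null_set_integral => //.
  by apply: measurable_funTS; exact/measurable_EFinP.
have r_ge0 x : (0 <= r x)%R.
  by rewrite fine_ge0// Radon_Nikodym_SigmaFinite.f_ge0.
have mr : measurable_fun setT r.
  apply: measurableT_comp => //.
  exact: measurable_int (Radon_Nikodym_SigmaFinite.f_integrable dom).
have re : ae_eq eta setT f0 (EFin \o (fun x => expR (s x))).
  apply: integral_ae_eq => //.
  - exact: Radon_Nikodym_SigmaFinite.f_integrable.
  - exact/measurable_EFinP.
  - by move=> E _ mE; rewrite -(Radon_Nikodym_SigmaFinite.f_integral dom)// rhoE.
rewrite (KL_gap dom eta1 ms es1 is_) (_ : \int[eta]_x _ = 0) ?add0e//.
rewrite -(integral0 eta setT); apply: ae_eq_integral => //.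
- apply/measurable_EFinP; apply: measurable_funB; last exact: measurable_funM.
  apply: measurable_funD => //.
  apply: measurable_funB => //; apply: measurable_funM => //.
  by apply: measurableT_comp => //; exact: measurable_ln.
- move: re; apply: filterS => x /(_ I) /= h _; congr EFin.
  rewrite /entropy_gap /r h /= expRK; lra.
Qed.

End normalized.
End relative_entropy.

(** * Gaussian measures *)

Section tuples.
Context {R : realType}.
Local Notation mR := (measurableTypeR R).

Definition tuple_of_col d (v : 'cV[R]_d) : d.-tuple mR := [tuple v i 0 | i < d].

Lemma tnth_tuple_of_col d (v : 'cV[R]_d) i : tnth (tuple_of_col v) i = v i 0.
Proof. by rewrite tnth_mktuple. Qed.

Lemma tuple_of_colK d : cancel (@tuple_of_col d) (@col_of_tuple R d).
Proof. by move=> v; apply/colP => i; rewrite mxE tnth_tuple_of_col. Qed.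

Lemma col_of_tupleK d : cancel (@col_of_tuple R d) (@tuple_of_col d).
Proof. by move=> x; apply: eq_from_tnth => i; rewrite tnth_tuple_of_col mxE. Qed.

Definition afft d (L : 'M[R]_d) (m : 'cV[R]_d) (x : d.-tuple mR) : d.-tuple mR :=
  tuple_of_col (L *m col_of_tuple x + m).

Lemma col_afft d L m (x : d.-tuple mR) :
  col_of_tuple (afft L m x) = L *m col_of_tuple x + m.
Proof. exact: tuple_of_colK. Qed.

Definition taddt d (x t : d.-tuple mR) : d.-tuple mR :=
  tuple_of_col (col_of_tuple x + col_of_tuple t).

Lemma col_taddt d (x t : d.-tuple mR) :
  col_of_tuple (taddt x t) = col_of_tuple x + col_of_tuple t.
Proof. exact: tuple_of_colK. Qed.

Lemma measurable_tuple (dd : measure_display) (T : measurableType dd) d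
    (g : T -> d.-tuple mR) :
  (forall i, measurable_fun setT (fun x => tnth (g x) i)) -> measurable_fun setT g.
Proof. by move=> h; apply/measurable_fun_tnthP => i; exact: h. Qed.

Lemma measurable_tnth_comp (dd : measure_display) (T : measurableType dd) d
    (g : T -> d.-tuple mR) i :
  measurable_fun setT g -> measurable_fun setT (fun x => tnth (g x) i).
Proof. by move=> /measurable_fun_tnthP; apply. Qed.

Lemma measurable_afft d L m : measurable_fun setT (@afft d L m).
Proof.
apply: measurable_tuple => i.
rewrite (_ : (fun x => _) = fun x => \sum_j L i j * tnth x j + m i 0); last first.
  apply/funext => x; rewrite tnth_tuple_of_col !mxE; congr (_ + _).
  by apply: eq_bigr => j _; rewrite mxE.
apply: measurable_funD => //; apply: measurable_sum => j.
by apply: measurable_funM => //; exact: measurable_tnth.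
Qed.

Lemma measurable_taddt (dd : measure_display) (T : measurableType dd) d
    (g h : T -> d.-tuple mR) :
  measurable_fun setT g -> measurable_fun setT h ->
  measurable_fun setT (fun x => taddt (g x) (h x)).
Proof.
move=> mg mh; apply: measurable_tuple => i.
rewrite (_ : (fun x => _) = fun x => tnth (g x) i + tnth (h x) i).
  by apply: measurable_funD; exact: measurable_tnth_comp.
by apply/funext => x; rewrite tnth_tuple_of_col !mxE.
Qed.

Lemma measurable_bilf d (A : 'M[R]_d) (dd : measure_display)
    (T : measurableType dd) (f g : T -> 'cV[R]_d) :
  (forall i, measurable_fun setT (fun x => f x i 0)) ->
  (forall i, measurable_fun setT (fun x => g x i 0)) ->
  measurable_fun setT (fun x => bilf A (f x) (g x)).
Proof.
move=> mf mg; rewrite (_ : (fun x => _) =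
    fun x => \sum_i \sum_j f x i 0 * A i j * g x j 0); last first.
  by apply/funext => x; rewrite bilfE.
apply: measurable_sum => i; apply: measurable_sum => j.
by apply: measurable_funM => //; exact: measurable_funM.
Qed.

Lemma measurable_quadf d (A : 'M[R]_d) m :
  measurable_fun setT (fun x : d.-tuple mR => quadf A (col_of_tuple x - m)).
Proof.
have h i : measurable_fun setT (fun x : d.-tuple mR => (col_of_tuple x - m) i 0).
  under eq_fun do rewrite !mxE.
  by apply: measurable_funB => //; exact: measurable_tnth.
exact: measurable_bilf.
Qed.

Lemma measurable_quadf0 d (A : 'M[R]_d) :
  measurable_fun setT (fun x : d.-tuple mR => quadf A (col_of_tuple x)).
Proof.
by have := measurable_quadf A 0; under eq_fun do rewrite subr0.
Qed.

Lemma col_of_tuple_cons d (z : mR * d.-tuple mR) :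
  col_of_tuple (tuple_cons z) =
  (col_mx (z.1%:M : 'M[R]_1) (col_of_tuple z.2) : 'cV[R]_(1 + d)).
Proof.
apply/matrixP => i j; rewrite !ord1 -(@splitK 1 d i); case: (@fintype.split 1 d i) => k /=.
  apply: etrans (esym (@col_mxEu R 1 d 1 _ _ k 0)).
  by rewrite !mxE !ord1 mulr1n (_ : lshift d 0 = ord0) ?tnth0 //; exact/val_inj.
apply: etrans (esym (@col_mxEd R 1 d 1 _ _ k 0)).
rewrite !mxE (_ : rshift 1 k = lift ord0 k); last exact/val_inj.
by rewrite tnthS; congr tnth; apply/val_inj.
Qed.

Lemma taddt_cons d (z s : mR * d.-tuple mR) :
  taddt (tuple_cons z) (tuple_cons s) = tuple_cons (z.1 + s.1, taddt z.2 s.2).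
Proof.
rewrite -[RHS]col_of_tupleK; congr tuple_of_col.
by rewrite !col_of_tuple_cons /= col_taddt; apply: (etrans (@add_col_mx _ 1 d 1 _ _ _ _)); rewrite raddfD.
Qed.

End tuples.

(** * Translation invariance and Gaussian integrals on R^d *)

Section lebesgue.
Context {R : realType}.
Local Notation mR := (measurableTypeR R).
Local Open Scope ereal_scope.

Lemma integral_lebesgue_shift (f : mR -> \bar R) (t : R) :
  measurable_fun setT f -> (forall x, 0 <= f x) ->
  \int[@lebesgue_measure R]_x f (x + t)%R = \int[@lebesgue_measure R]_x f x.
Proof.
move=> mf f0.
have mt : measurable_fun setT (fun x : mR => x + t : mR)%R by exact: measurable_funD.
transitivity (\int[pushforward (@lebesgue_measure R) (fun x : mR => x + t : mR)%R]_x f x).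
  by rewrite ge0_integral_pushforward// => x _; exact: f0.
apply: eq_measure_integral => A mA _; apply/esym.
apply: (@lebesgue_measure_unique R (pushforward (@lebesgue_measure R) (fun x : mR => x + t : mR)%R)) => //.
move=> _ [[a b]] _ <-; transitivity (@lebesgue_measure R `](a - t)%R, (b - t)%R]%classic).
  rewrite !lebesgue_measure_itv/= !lte_fin ltrD2r -!EFinB.
  by congr (if _ then _%:E else _); ring.
rewrite /pushforward; congr lebesgue_measure.
by apply/seteqP; split => x /=; rewrite !in_itv/= ltrBlDr lerBrDr.
Qed.

Lemma integral_tuple_cons d (f : d.+1.-tuple mR -> \bar R) :
  measurable_fun setT f -> (forall x, 0 <= f x) ->
  \int[lebesgue_tuple d.+1]_x f x =
  \int[lebesgue_tuple d]_y \int[@lebesgue_measure R]_x f (tuple_cons (x, y)).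
Proof.
move=> mf f0; rewrite /= /cons_measure ge0_integral_pushforward//.
- rewrite preimage_setT fubini_tonelli2//.
  - by apply: measurableT_comp => //; exact: measurable_tuple_cons.
  - by move=> x; exact: f0.
- exact: measurable_tuple_cons.
Qed.

Lemma integral_taddt d (f : d.-tuple mR -> \bar R) (t : d.-tuple mR) :
  measurable_fun setT f -> (forall x, 0 <= f x) ->
  \int[lebesgue_tuple d]_x f (taddt x t) = \int[lebesgue_tuple d]_x f x.
Proof.
elim: d f t => [|d IH] f t mf f0.
  by apply: eq_integral => x _; rewrite (tuple0 x) (tuple0 (taddt _ _)).
have mft : measurable_fun setT (fun x => f (taddt x t)).
  by apply: measurableT_comp => //; exact: measurable_taddt.
rewrite integral_tuple_cons// [RHS]integral_tuple_cons//.
have [t0 [s ->]] : exists t0 s, t = tuple_cons (t0, s).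
  exists (thead t), [tuple of behead t]; exact: tuple_eta.
under eq_integral => y _ do under eq_integral => x _ do rewrite taddt_cons /=.
under eq_integral => y _.
  rewrite (integral_lebesgue_shift t0 (f := fun x => f (tuple_cons (x, taddt y s)))); last 2 first.
  - apply: measurableT_comp => //; apply: measurableT_comp; first exact: measurable_tuple_cons.
    exact: measurable_fun_pair.
  - by move=> x; exact: f0.
  over.
apply: (IH (fun y => \int[lebesgue_measure]_x f (tuple_cons (x, y)))).
- apply: (measurable_fun_fubini_tonelli_G (fun z => f (tuple_cons z))) => //.
  by apply: measurableT_comp => //; exact: measurable_tuple_cons.
- by move=> x; apply: integral_ge0.
Qed.

Lemma integral_gauss1 (a c : R) : (0 < a)%R ->
  \int[@lebesgue_measure R]_x (expR (- (a * (x + c) ^+ 2) / 2))%:E =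
  (Num.sqrt (2 * pi / a))%:E.
Proof.
move=> a0; pose s := Num.sqrt a^-1.
have s0 : s != 0%R by rewrite gt_eqF// sqrtr_gt0 invr_gt0.
have s2 : (s ^+ 2 = a^-1)%R by rewrite sqr_sqrtr// invr_ge0 ltW.
have := integral_normal_pdf (- c)%R s; rewrite normal_pdfE//.
have -> : normal_peak s = (Num.sqrt (2 * pi / a))^-1%R.
  by rewrite /normal_peak s2; congr (Num.sqrt _)^-1%R; rewrite mulr2n; lra.
have k0 : (0 < Num.sqrt (2 * pi / a))%R by rewrite sqrtr_gt0 !mulr_gt0// ?pi_gt0 ?invr_gt0.
under eq_integral do rewrite EFinM.
have mn : measurable_fun setT (fun x : mR => (normal_fun (- c) s x)%:E).
  by apply/measurable_EFinP; exact: measurable_normal_fun.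
rewrite ge0_integralZl//; last first.
  by move=> x _; rewrite lee_fin expR_ge0.
move=> /(congr1 (fun e => (Num.sqrt (2 * pi / a))%:E * e)).
rewrite muleA -EFinM divff ?gt_eqF// mul1e mule1 => <-.
apply: eq_integral => x _; congr (expR _)%:E; rewrite /normal_fun s2 opprK.
by rewrite mulr2n; field; rewrite gt_eqF.
Qed.

Local Close Scope ereal_scope.
(** Induction on d by block elimination: completing the square in the first coordinate leaves a
    shifted one-dimensional Gaussian integral and the form of the Schur complement [S], and the
    determinant factors accordingly. *)
Lemma integral_gauss d (A : 'M[R]_d) : posdef A ->
  (\int[lebesgue_tuple d]_x (expR (- quadf A (col_of_tuple x) / 2))%:E =
  (Num.sqrt ((2 * pi) ^+ d / \det A))%:E)%E.
Proof.
elim: d A => [|d IH] A pA.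
  rewrite det_mx00 expr0 divr1 sqrtr1 /= integral_dirac//; last first.
    apply/measurable_EFinP; apply: measurableT_comp => //; apply: measurable_funM => //.
    apply: measurableT_comp => //; exact: measurable_quadf0.
  rewrite diracT mul1e; congr EFin; rewrite (flatmx0 (col_of_tuple _)) quadf0.
  by rewrite oppr0 mul0r expR0.
have mq k (B : 'M[R]_k) : measurable_fun setT
    (fun x : k.-tuple mR => (expR (- quadf B (col_of_tuple x) / 2))%:E).
  apply/measurable_EFinP; apply: measurableT_comp => //; apply: measurable_funM => //.
  by apply: measurableT_comp => //; exact: measurable_quadf0.
rewrite integral_tuple_cons//.
pose B : 'M[R]_(1 + d) := A.
pose a := B 0 0; pose b : 'rV[R]_d := ursubmx B; pose C := drsubmx B.
have aE : ulsubmx B = a%:M.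
  by apply/matrixP => i j; rewrite !ord1 !mxE eqxx mulr1n; congr (B _ _); exact/val_inj.
have bE : dlsubmx B = b^T by rewrite /b trmx_ursub; congr dlsubmx; rewrite pA.1.
have BE : B = block_mx a%:M b b^T C by rewrite -[LHS]submxK aE bE.
have a0 : (0 < a)%R.
  have e0 : (delta_mx 0 0 : 'cV[R]_(1 + d)) != 0%R.
    by apply/eqP => /matrixP /(_ 0%R 0%R); rewrite !mxE eqxx => /eqP; rewrite oner_eq0.
  by have := pA.2 _ e0; rewrite /quadf trmx_delta -rowE -colE !mxE.
pose S := (C - a^-1 *: (b^T *m b))%R.
have qE (x : R) (y : 'cV[R]_d) : (quadf B (col_mx (x%:M : 'M[R]_1) y) =
    a * (x + (b *m y) 0 0 / a) ^+ 2 + quadf S y)%R.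
  set u := (b *m y) 0 0.
  have bu : b *m y = u%:M := mx11_scalar _.
  have ub : y^T *m b^T = u%:M by rewrite -trmx_mul bu tr_scalar_mx.
  have qbb : quadf (b^T *m b) y = u ^+ 2.
    by rewrite /quadf mulmxA ub -mulmxA bu -scalar_mxM mxE eqxx mulr1n expr2.
  rewrite {1}/quadf BE tr_col_mx mul_row_block mul_row_col tr_scalar_mx !mulmxDl.
  rewrite ub -(mulmxA x%:M b y) bu -!scalar_mxM [y^T *m C *m y]mx11_scalar -/(quadf C y).
  rewrite /S quadfBm quadfZm qbb !mxE !eqxx !mulr1n; field.
  by rewrite gt_eqF.
have pS : posdef S.
  split.
    by rewrite /S linearB linearZ /= trmx_mul trmxK /C trmx_drsub; congr (drsubmx _ - _)%R; rewrite pA.1.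
  move=> y y0; pose x := (- ((b *m y) 0 0 / a))%R.
  have : (col_mx (x%:M : 'M[R]_1) y : 'cV[R]_(1 + d)) != 0%R.
    by rewrite col_mx_eq0 negb_and y0 orbT.
  by move/(pA.2 _); rewrite -/B qE /x addNr expr0n/= mulr0 add0r.
have detE : \det B = a * \det S.
  have H : B = block_mx 1%:M 0 (a^-1 *: b^T) 1%:M *m block_mx a%:M b 0 S.
    rewrite [LHS]BE mulmx_block !mul1mx !mul0mx !addr0.
    rewrite mul_mx_scalar scalerA mulfV ?gt_eqF// scale1r -scalemxAl /S.
    by rewrite addrC subrK.
  transitivity (\det (block_mx (1%:M : 'M[R]_1) 0 (a^-1 *: b^T) 1%:M *m block_mx a%:M b 0 S)).
    by congr (\det _).
  by rewrite det_mulmx det_lblock det_ublock !det1 det_scalar1 !mul1r.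
have inner (y : d.-tuple mR) :
    (\int[@lebesgue_measure R]_x (expR (- quadf A (col_of_tuple (tuple_cons (x, y))) / 2))%:E =
     (Num.sqrt (2 * pi / a))%:E * (expR (- quadf S (col_of_tuple y) / 2))%:E)%E.
  rewrite -(integral_gauss1 ((b *m col_of_tuple y) 0 0 / a) a0) -ge0_integralZr//.
  - apply: eq_integral => x _.
    by rewrite col_of_tuple_cons -EFinM -expRD [quadf A _]qE opprD mulrDl.
  - apply/measurable_EFinP; apply: measurableT_comp => //.
    apply: measurable_funM => //; apply: measurableT_comp => //.
    apply: measurable_funM => //; apply: measurable_funX.
    exact: measurable_funD.
under eq_integral do rewrite inner.
rewrite ge0_integralZl//; last exact: mq.
rewrite IH// -EFinM -sqrtrM; last by rewrite ltW// divr_gt0// mulr_gt0// pi_gt0.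
congr (Num.sqrt _)%:E; rewrite -[\det A]/(\det B) detE exprS invfM; lra.
Qed.

End lebesgue.

(** * Linear change of variables *)

Section linear_change.
Context {R : realType}.
Local Notation mR := (measurableTypeR R).

Lemma taddt_afft d (L : 'M[R]_d) (x y : d.-tuple mR) : L \in unitmx ->
  taddt (afft L 0 x) y = afft L 0 (taddt x (afft (invmx L) 0 y)).
Proof.
move=> uL; rewrite -[LHS]col_of_tupleK -[RHS]col_of_tupleK; congr tuple_of_col.
by rewrite col_taddt !col_afft col_taddt col_afft !addr0 mulmxDr mulKVmx.
Qed.

Lemma measurable_expR_quadf d (A : 'M[R]_d) m :
  measurable_fun setT (fun x : d.-tuple mR => expR (- quadf A (col_of_tuple x - m) / 2)).
Proof.
apply: measurableT_comp => //; apply: measurable_funM => //.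
by apply: measurableT_comp => //; exact: measurable_quadf.
Qed.

Lemma integral_gauss_center d (A : 'M[R]_d) m : posdef A ->
  (\int[lebesgue_tuple d]_x (expR (- quadf A (col_of_tuple x - m) / 2))%:E =
  (Num.sqrt ((2 * pi) ^+ d / \det A))%:E)%E.
Proof.
move=> pA.
transitivity (\int[lebesgue_tuple d]_x (expR (- quadf A (col_of_tuple x) / 2))%:E)%E; last first.
  exact: integral_gauss.
rewrite -[RHS](integral_taddt (f := fun x : d.-tuple mR => (expR (- quadf A (col_of_tuple x) / 2))%:E)
  (tuple_of_col (- m))).
- by apply: eq_integral => x _; rewrite col_taddt tuple_of_colK.
- apply/measurable_EFinP.
  by have := measurable_expR_quadf A 0; under eq_fun do rewrite subr0.
- by move=> x; rewrite lee_fin expR_ge0.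
Qed.

Lemma measurable_afft_comp (dd : measure_display) (T : measurableType dd) d
    (L : 'M[R]_d) m (g : T -> d.-tuple mR) :
  measurable_fun setT g -> measurable_fun setT (fun x => afft L m (g x)).
Proof. by move=> mg; apply: measurableT_comp => //; exact: measurable_afft. Qed.

(* Uniqueness of Haar measure, by Tonelli's theorem applied to f(Lx + y) G(y) with a
   Gaussian G; the Gaussian integrals then give the constant. *)
Lemma integral_linear d (L : 'M[R]_d) (f : d.-tuple mR -> \bar R) :
  L \in unitmx -> measurable_fun setT f -> (forall x, 0 <= f x)%E ->
  (`|\det L|%:E * \int[lebesgue_tuple d]_x f (afft L 0 x) =
   \int[lebesgue_tuple d]_x f x)%E.
Proof.
move=> uL mf f0.
have d0 : 0 < `|\det L| by rewrite normr_gt0 -unitfE -unitmxE.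
pose G (x : d.-tuple mR) : \bar R := (expR (- quadf 1%:M (col_of_tuple x) / 2))%:E.
have mG : measurable_fun setT G.
  apply/measurable_EFinP.
  by have := measurable_expR_quadf 1%:M (0 : 'cV[R]_d); under eq_fun do rewrite subr0.
have G0 x : (0 <= G x)%E by rewrite lee_fin expR_ge0.
pose k : R := Num.sqrt ((2 * pi) ^+ d).
have k0 : 0 < k by rewrite sqrtr_gt0 exprn_gt0// mulr_gt0// pi_gt0.
have IG : (\int[lebesgue_tuple d]_x G x = k%:E)%E.
  by rewrite /G integral_gauss ?det1 ?divr1//; exact: posdef1.
have IGL : (\int[lebesgue_tuple d]_x G (afft L 0 x) = (k / `|\det L|)%:E)%E.
  transitivity (\int[lebesgue_tuple d]_x (expR (- quadf (L^T *m L) (col_of_tuple x) / 2))%:E)%E.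
    by apply: eq_integral => x _; rewrite /G col_afft addr0 quadf_congr mulmx1.
  have pLL : posdef (L^T *m L).
    by rewrite -[L^T]mulmx1; apply: posdef_congr => //; exact: posdef1.
  rewrite integral_gauss//; congr EFin.
  rewrite det_mulmx det_tr -expr2 sqrtrM ?exprn_ge0// ?mulr_ge0 ?pi_ge0//.
  by rewrite sqrtrV ?sqr_ge0// sqrtr_sqr.
have mfL : measurable_fun setT (fun x => f (afft L 0 x)).
  by apply: measurableT_comp => //; exact: measurable_afft.
have mGL : measurable_fun setT (fun x => G (afft L 0 x)).
  by apply: measurableT_comp => //; exact: measurable_afft.
have e1 (y : d.-tuple mR) : (\int[lebesgue_tuple d]_x f (taddt (afft L 0 x) y) =
    \int[lebesgue_tuple d]_x f (afft L 0 x))%E.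
  rewrite -[RHS](integral_taddt (f := fun x => f (afft L 0 x)) (afft (invmx L) 0 y))//.
  by apply: eq_integral => x _; rewrite taddt_afft.
(* G is even, so y - L x may be replaced by L (x - L^-1 y), a translation in x. *)
have e2 (y : d.-tuple mR) : (\int[lebesgue_tuple d]_x G (taddt y (afft (- L) 0 x)) =
    \int[lebesgue_tuple d]_x G (afft L 0 x))%E.
  rewrite -[RHS](integral_taddt (afft (- invmx L) 0 y) mGL (fun x => G0 (afft L 0 x))).
  apply: eq_integral => x _; rewrite /G col_taddt !col_afft col_taddt col_afft !addr0.
  rewrite mulmxDr !mulNmx mulmxN mulKVmx//.
  by rewrite -[in LHS]opprB quadfE bilfNl bilfNr opprK.
have e3 (x : d.-tuple mR) : (\int[lebesgue_tuple d]_y (f (taddt (afft L 0 x) y) * G y) =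
   \int[lebesgue_tuple d]_y (f y * G (taddt y (afft (- L) 0 x))))%E.
  rewrite -[RHS](integral_taddt (f := fun y => (f y * G (taddt y (afft (- L) 0 x)))%E) (afft L 0 x)).
  - apply: eq_integral => y _; congr (f _ * _)%E.
      rewrite -[LHS]col_of_tupleK -[RHS]col_of_tupleK; congr tuple_of_col.
      by rewrite !col_taddt addrC.
    by rewrite /G !col_taddt !col_afft mulNmx !addr0 addrK.
  - apply: emeasurable_funM => //; apply: measurableT_comp => //.
    by apply: measurable_taddt.
  - by move=> y; rewrite mule_ge0.
have m1 : measurable_fun setT
    (fun z : d.-tuple mR * d.-tuple mR => (f (taddt (afft L 0 z.1) z.2) * G z.2)%E).
  apply: emeasurable_funM; apply: measurableT_comp => //.
  by apply: measurable_taddt => //; exact: measurable_afft_comp.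
have m2 : measurable_fun setT
    (fun z : d.-tuple mR * d.-tuple mR => (f z.2 * G (taddt z.2 (afft (- L) 0 z.1)))%E).
  apply: emeasurable_funM; apply: measurableT_comp => //.
  by apply: measurable_taddt => //; exact: measurable_afft_comp.
have key : ((\int[lebesgue_tuple d]_x f (afft L 0 x)) * k%:E =
    (\int[lebesgue_tuple d]_x f x) * (k / `|\det L|)%:E)%E.
  rewrite -IG -IGL -ge0_integralZl//; last by apply: integral_ge0.
  transitivity (\int[lebesgue_tuple d]_y \int[lebesgue_tuple d]_x (f (taddt (afft L 0 x) y) * G y))%E.
    apply: eq_integral => y _; rewrite ge0_integralZr//; first by rewrite e1.
    apply: measurableT_comp => //; apply: measurable_taddt => //.
    exact: measurable_afft.
  rewrite -(fubini_tonelli (fun z => (f (taddt (afft L 0 z.1) z.2) * G z.2)%E))//=; last first.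
    by move=> z; rewrite mule_ge0.
  under eq_integral do rewrite e3.
  rewrite (fubini_tonelli (fun z => (f z.2 * G (taddt z.2 (afft (- L) 0 z.1)))%E))//=; last first.
    by move=> z; rewrite mule_ge0.
  rewrite -ge0_integralZr//; last by apply: integral_ge0.
  apply: eq_integral => y _.
  transitivity (f y * \int[lebesgue_tuple d]_x G (taddt y (afft (- L) 0 x)))%E; last by rewrite e2.
  apply: ge0_integralZl.
  - exact: measurableT.
  - apply: measurableT_comp => //; apply: measurable_taddt => //.
    exact: measurable_afft.
  - by move=> x _; exact: G0.
  - exact: f0.
move: key => /(congr1 (fun e => (e * (k^-1 * `|\det L|)%:E)%E)).
rewrite -!muleA -!EFinM mulrA mulfV ?gt_eqF// mul1r muleC => ->.
by rewrite (_ : _ * _ = 1) ?mule1//; field; rewrite !gt_eqF.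
Qed.

End linear_change.

(** * Gaussian densities *)

Section gaussian_density.
Context {R : realType} {d : nat}.
Local Notation mR := (measurableTypeR R).
Implicit Types (m v : 'cV[R]_d) (S Q : 'M[R]_d).

Definition gauss_lnpdf m S (x : 'cV[R]_d) : R :=
  - ln ((2 * pi) ^+ d * \det S) / 2 - quadf (invmx S) (x - m) / 2.

Lemma gauss_pdfE m S x : posdef S ->
  gauss_pdf m S x = expR (gauss_lnpdf m S (col_of_tuple x)).
Proof.
move=> pS; rewrite /gauss_pdf /gauss_lnpdf expRD mulNr; congr (_ * expR _).
set a := _ * \det S.
have a0 : 0 < a.
  by rewrite mulr_gt0 ?det_posdef_gt0// exprn_gt0// mulr_gt0// pi_gt0.
have aE : a = expR (ln a / 2) ^+ 2.
  by rewrite -expRM_natl mulr_natl mulr2n -splitr lnK.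
by rewrite {1}aE sqrtr_sqr ger0_norm ?expR_ge0// mulNr expRN.
Qed.

Lemma measurable_gauss_lnpdf m S :
  measurable_fun setT (fun x : d.-tuple mR => gauss_lnpdf m S (col_of_tuple x)).
Proof.
apply: measurable_funB => //; apply: measurable_funM => //.
exact: measurable_quadf.
Qed.

Lemma gaussT m S : posdef S -> gauss m S setT = 1%E.
Proof.
move=> pS; rewrite /gauss /gauss_pdf; under eq_integral do rewrite EFinM.
rewrite ge0_integralZl//=.
- rewrite integral_gauss_center; last exact: posdef_inv.
  rewrite det_inv invrK -EFinM mulVf// gt_eqF// sqrtr_gt0 mulr_gt0 ?det_posdef_gt0//.
  by rewrite exprn_gt0// mulr_gt0// pi_gt0.
- by apply/measurable_EFinP; exact: measurable_expR_quadf.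
Qed.

(** An alias of [gauss] carrying the proof of positive definiteness, so that the probability
    structure is found from the term itself. *)
Definition gauss_prob m S of posdef S : set (d.-tuple mR) -> \bar R := gauss m S.

HB.instance Definition _ m S (pS : posdef S) :=
  Measure.copy (gauss_prob m pS) (gauss m S).

HB.instance Definition _ m S (pS : posdef S) :=
  @Measure_isProbability.Build _ _ R (gauss_prob m pS) (gaussT m pS).

(** [gauss] is given by its values on sets; uniqueness of the Radon-Nikodym derivative identifies
    that derivative with [gauss_pdf] and carries the formula over to functions. *)
Lemma integral_gauss_pdf m S (f : d.-tuple mR -> R) : posdef S ->
  measurable_fun setT f -> (forall x, 0 <= f x) ->
  (\int[gauss m S]_x (f x)%:E = \int[lebesgue_tuple d]_x (f x * gauss_pdf m S x)%:E)%E.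
Proof.
move=> pS mf f0.
have mp : measurable_fun setT (fun x => (gauss_pdf m S x)%:E).
  by apply/measurable_EFinP; exact: measurable_gauss_pdf.
have dom : gauss_prob m pS `<< lebesgue_tuple d.
  apply/null_content_dominatesP => A mA A0; apply: null_set_integral => //.
  exact: measurable_funTS.
transitivity (\int[gauss_prob m pS]_x (f x)%:E)%E; first by [].
rewrite (density_integral dom mf f0).
have re : ae_eq (lebesgue_tuple d) setT
    (Radon_Nikodym_SigmaFinite.f (gauss_prob m pS) (lebesgue_tuple d))
    (fun x => (gauss_pdf m S x)%:E).
  apply: integral_ae_eq => //.
  - exact: Radon_Nikodym_SigmaFinite.f_integrable.
  - by move=> E _ mE; rewrite -Radon_Nikodym_SigmaFinite.f_integral.
apply: ae_eq_integral => //.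
- apply/measurable_EFinP; apply: measurable_funM => //; apply: measurableT_comp => //.
  exact: measurable_int (Radon_Nikodym_SigmaFinite.f_integrable dom).
- by apply/measurable_EFinP; apply: measurable_funM => //; exact: measurable_gauss_pdf.
- by move: re; apply: filterS => x /(_ I) h _; rewrite h.
Qed.

Lemma gauss_density m S v Q : posdef S -> posdef Q ->
  forall A, measurable A -> (gauss v Q A = \int[gauss m S]_(x in A)
    (expR (gauss_lnpdf v Q (col_of_tuple x) - gauss_lnpdf m S (col_of_tuple x)))%:E)%E.
Proof.
move=> pS pQ A mA; rewrite integral_mkcond.
have iA : measurable_fun setT (\1_A : d.-tuple mR -> R) by exact: measurable_indic.
transitivity (\int[gauss m S]_x (\1_A x *
    expR (gauss_lnpdf v Q (col_of_tuple x) - gauss_lnpdf m S (col_of_tuple x)))%:E)%E; last first.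
  apply: eq_integral => x _; rewrite patchE indicE; case: ifP => _.
    by rewrite mul1r.
  by rewrite mul0r.
rewrite integral_gauss_pdf//.
- rewrite /gauss integral_mkcond; apply: eq_integral => x _; rewrite patchE indicE.
  case: ifP => _; last by rewrite !mul0r.
  by rewrite mul1r !gauss_pdfE// -expRD subrK.
- apply: measurable_funM => //; apply: measurableT_comp => //.
  by apply: measurable_funB; exact: measurable_gauss_lnpdf.
Qed.

Lemma integral_gauss_afft m S L t (f : d.-tuple mR -> R) :
  L \in unitmx -> posdef S -> measurable_fun setT f -> (forall x, 0 <= f x) ->
  (\int[gauss m S]_x (f (afft L t x))%:E =
   \int[gauss (L *m m + t) (L *m S *m L^T)]_x (f x)%:E)%E.
Proof.
move=> uL pS mf f0; set m' := _ + t; set S' := _ *m L^T.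
have pS' : posdef S'.
  by rewrite /S' -{1}[L]trmxK; apply: posdef_congr => //; rewrite unitmx_tr.
have d0 : 0 < `|\det L| by rewrite normr_gt0 -unitfE -unitmxE.
have uS := posdef_unit pS.
rewrite [RHS](integral_gauss_pdf m' pS' mf f0) (integral_gauss_pdf m (f := fun x => f (afft L t x)) pS); last 2 first.
- by apply: measurableT_comp => //; exact: measurable_afft.
- by move=> x; exact: f0.
have mg : measurable_fun setT (fun x => (f x * gauss_pdf m' S' x)%:E).
  by apply/measurable_EFinP; apply: measurable_funM => //; exact: measurable_gauss_pdf.
have g0 x : (0 <= (f x * gauss_pdf m' S' x)%:E)%E.
  by rewrite lee_fin mulr_ge0// gauss_pdf_ge0.
have mt : measurable_fun setT (fun x => (f (taddt x (tuple_of_col t)) *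
    gauss_pdf m' S' (taddt x (tuple_of_col t)))%:E).
  apply: (measurableT_comp (f := fun x => (f x * gauss_pdf m' S' x)%:E)) => //.
  exact: measurable_taddt.
rewrite -[RHS](integral_taddt (tuple_of_col t) mg g0) -[RHS](integral_linear uL mt (fun x => g0 _)).
have mtL : measurable_fun setT (fun x => (f (taddt (afft L 0 x) (tuple_of_col t)) *
    gauss_pdf m' S' (taddt (afft L 0 x) (tuple_of_col t)))%:E).
  by apply: (measurableT_comp mt); exact: measurable_afft.
rewrite -[RHS]ge0_integralZl; last 4 first.
- exact: measurableT.
- exact: mtL.
- by move=> x _; exact: g0.
- exact: ltW.
apply: eq_integral => x _; rewrite -EFinM; congr EFin.
have -> : taddt (afft L 0 x) (tuple_of_col t) = afft L t x.
  rewrite -[LHS]col_of_tupleK; congr tuple_of_col.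
  by rewrite col_taddt col_afft tuple_of_colK addr0.
rewrite [RHS]mulrCA; congr (_ * _).
have iS' : invmx S' = (invmx L)^T *m invmx S *m invmx L.
  have H : S' *m ((invmx L)^T *m invmx S *m invmx L) = 1%:M.
    rewrite /S' !mulmxA -(mulmxA (L *m S)) -trmx_mul mulVmx// trmx1 mulmx1.
    by rewrite -(mulmxA L) mulmxV// mulmx1 mulmxV.
  by rewrite -[LHS]mulmx1 -H mulKmx// posdef_unit.
rewrite /gauss_pdf col_afft mulrA; congr (_ * expR (- _ / 2)).
  have -> : (2 * pi) ^+ d * \det S' = (2 * pi) ^+ d * \det S * \det L ^+ 2.
    by rewrite /S' !det_mulmx det_tr; move: ((2 * pi) ^+ d) => a; ring.
  have w0 : 0 <= (2 * pi) ^+ d * \det S.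
    by rewrite ltW// mulr_gt0 ?det_posdef_gt0// exprn_gt0// mulr_gt0// pi_gt0.
  move: ((2 * pi) ^+ d * \det S) w0 => w w0; rewrite sqrtrM// sqrtr_sqr.
  by rewrite invfM mulrCA mulfV ?mulr1// gt_eqF.
rewrite iS' -quadf_congr; congr quadf.
by rewrite /m' opprD addrACA subrr addr0 -mulmxBr mulKmx.
Qed.

End gaussian_density.

(** * Expectations *)

Section expectation.
Context {R : realType} {dd : measure_display} {T : measurableType dd}.
Variable rho : probability T R.

(** Integrability travels with the value, so that linear combinations never meet a difference of
    infinities. *)
Definition has_mean (f : T -> R) (r : R) : Prop :=
  rho.-integrable setT (EFin \o f) /\ (\int[rho]_x (f x)%:E = r%:E)%E.

Lemma has_mean_ext f g r : f =1 g -> has_mean f r -> has_mean g r.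
Proof. by move=> /funext ->. Qed.

Lemma has_mean_cst r : has_mean (cst r) r.
Proof.
split; first exact: finite_measure_integrable_cst.
apply: etrans (integral_cst rho measurableT r%:E) _; rewrite -[RHS]mule1.
by congr (_ * _)%E; exact: probability_setT.
Qed.

Lemma has_meanD f g r s : has_mean f r -> has_mean g s ->
  has_mean (fun x => f x + g x) (r + s).
Proof.
move=> [fi fr] [gi gs]; split; last first.
  by under eq_integral do rewrite EFinD; rewrite integralD// fr gs.
have := integrableD measurableT fi gi; apply: eq_integrable => //.
Qed.

Lemma has_meanZ k f r : has_mean f r -> has_mean (fun x => k * f x) (k * r).
Proof.
move=> [fi fr]; split; last first.
  by under eq_integral do rewrite EFinM; rewrite integralZl// fr.
by have := integrableZl measurableT k fi; apply: eq_integrable.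
Qed.

Lemma has_mean_sum n (f : 'I_n -> T -> R) (r : 'I_n -> R) :
  (forall i, has_mean (f i) (r i)) -> has_mean (fun x => \sum_i f i x) (\sum_i r i).
Proof.
elim: n f r => [|n IH] f r fr.
  apply: (@has_mean_ext (cst 0)); first by move=> x; rewrite big_ord0.
  by rewrite big_ord0; exact: has_mean_cst.
apply: (@has_mean_ext (fun x => f ord0 x + \sum_i f (lift ord0 i) x)).
  by move=> x; rewrite big_ord_recl.
by rewrite big_ord_recl; apply: has_meanD => //; exact: IH.
Qed.

Lemma has_mean_unique f r s : has_mean f r -> has_mean f s -> r = s.
Proof. by move=> [_ fr] [_]; rewrite fr => -[]. Qed.

End expectation.

Lemma has_mean_eq_measure {R : realType} {dd : measure_display} {T : measurableType dd}
    (rho rho' : probability T R) f r :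
  (forall A, measurable A -> rho A = rho' A) -> has_mean rho f r -> has_mean rho' f r.
Proof.
move=> eqA [/integrableP[mf fi] fr].
have ei (g : T -> \bar R) : (\int[rho']_x g x = \int[rho]_x g x)%E.
  by apply: eq_measure_integral => A mA _; exact/esym/eqA.
by split; [apply/integrableP; split => //; rewrite ei|rewrite ei].
Qed.

(** * Second moments *)

Section second_moment.
Context {R : realType} {d : nat}.
Local Notation mR := (measurableTypeR R).
Implicit Types (x : d.-tuple mR) (m v : 'cV[R]_d) (S Q A : 'M[R]_d).

Lemma quadf1_shift (a m : 'cV[R]_d) :
  quadf 1%:M (a - m) <= 2 * quadf 1%:M a + 2 * quadf 1%:M m.
Proof.
rewrite !quadf1E -mulrDr -big_split /= mulr_sumr; apply: ler_sum => i _.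
by rewrite !mxE; have := sqr_ge0 (a i 0 + m i 0); rewrite !expr2; lra.
Qed.

Lemma quadf_bound A : exists2 K, 0 <= K & forall z, `|quadf A z| <= K * quadf 1%:M z.
Proof.
exists (\sum_i \sum_j `|A i j|).
  by apply: sumr_ge0 => i _; apply: sumr_ge0 => j _.
move=> z; rewrite quadfE bilfE mulr_suml; apply: le_trans (ler_norm_sum _ _ _) _.
apply: ler_sum => i _; rewrite mulr_suml; apply: le_trans (ler_norm_sum _ _ _) _.
apply: ler_sum => j _; rewrite !normrM mulrAC [leLHS]mulrC ler_wpM2l//.
have zi k : `|z k 0| ^+ 2 <= quadf 1%:M z.
  rewrite real_normK ?num_real// quadf1E (bigD1 k)//= lerDl.
  by apply: sumr_ge0 => l _; exact: sqr_ge0.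
have := zi i; have := zi j.
move: (quadf 1%:M z) `|z i 0| `|z j 0| => q a b; nra.
Qed.

Definition second_moment (rho : probability (d.-tuple mR) R) : Prop :=
  (\int[rho]_x (quadf 1%:M (col_of_tuple x))%:E < +oo)%E.

Lemma second_moment_integrable rho (g : d.-tuple mR -> R) C :
  second_moment rho -> measurable_fun setT g ->
  (forall x, `|g x| <= C * (1 + quadf 1%:M (col_of_tuple x))) ->
  rho.-integrable setT (EFin \o g).
Proof.
move=> m2 mg gC.
have i1 : rho.-integrable setT (fun x => (C * (1 + quadf 1%:M (col_of_tuple x)))%:E).
  apply: (@integrableZl _ _ _ _ _ measurableT C
    (EFin \o (fun x => 1 + quadf 1%:M (col_of_tuple x)))).
  apply: (@integrableD _ _ _ _ _ measurableT (EFin \o cst 1)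
    (EFin \o (fun x => quadf 1%:M (col_of_tuple x)))).
    exact: finite_measure_integrable_cst.
  apply/integrableP; split; first by apply/measurable_EFinP; exact: measurable_quadf0.
  by under eq_integral do rewrite /= ger0_norm ?quadf1_ge0//.
apply: le_integrable i1 => //; first exact/measurable_EFinP.
move=> x _ /=; rewrite lee_fin; apply: le_trans (gC x) _; exact: ler_norm.
Qed.

Lemma second_moment_quadf rho A m : second_moment rho ->
  rho.-integrable setT (fun x => (quadf A (col_of_tuple x - m))%:E).
Proof.
move=> m2; have [K K0 hK] := quadf_bound A.
have q0 : 0 <= quadf 1%:M m by exact: quadf1_ge0.
apply: (@second_moment_integrable _ (fun x => quadf A (col_of_tuple x - m)) (K * (2 + 2 * quadf 1%:M m))) => //.
  exact: measurable_quadf.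
move=> x; apply: le_trans (hK _) _; rewrite -mulrA ler_wpM2l//.
apply: le_trans (quadf1_shift _ _) _; have := quadf1_ge0 (col_of_tuple x).
by move: q0; move: (quadf 1%:M m) (quadf _ _) => a b a0 b0; nra.
Qed.

Lemma second_moment_lnpdf rho m S : second_moment rho ->
  rho.-integrable setT (fun x => (gauss_lnpdf m S (col_of_tuple x))%:E).
Proof.
move=> m2; rewrite /gauss_lnpdf.
apply: (@integrableB _ _ _ _ _ measurableT (EFin \o cst _) (EFin \o (fun x => quadf (invmx S) (col_of_tuple x - m) / 2))).
  exact: finite_measure_integrable_cst.
have := integrableZl measurableT 2^-1 (second_moment_quadf (invmx S) m m2).
by apply: eq_integrable => // x _ /=; rewrite -EFinM mulrC.
Qed.

Lemma gauss_exp_quadf m S : posdef S -> exists2 e, 0 < e &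
  (\int[gauss m S]_x (expR (e * quadf 1%:M (col_of_tuple x - m)))%:E < +oo)%E.
Proof.
move=> pS; have pV := posdef_inv pS; have [c c0 hc] := posdef_lbound pV.
(* c bounds the precision matrix from below. The exponent c / 4 removes c / 2 from the precision in
   the Gaussian exponent, which leaves a positive definite form. *)
exists (c / 4); first by rewrite divr_gt0.
have pA : posdef (invmx S - (c / 2) *: 1%:M).
  split; first by rewrite linearB linearZ /= trmx1 pV.1.
  move=> x x0; rewrite quadfBm quadfZm; have := hc x; have := quadf1_gt0 x0; nra.
have mq : measurable_fun setT (fun x : d.-tuple mR => expR (c / 4 * quadf 1%:M (col_of_tuple x - m))).
  by apply: measurableT_comp => //; apply: measurable_funM => //; exact: measurable_quadf.
rewrite (integral_gauss_pdf m pS mq (fun x => expR_ge0 _)).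
pose k := (Num.sqrt ((2 * pi) ^+ d * \det S))^-1.
have k0 : 0 <= k by rewrite invr_ge0 sqrtr_ge0.
have -> : (\int[lebesgue_tuple d]_x (expR (c / 4 * quadf 1%:M (col_of_tuple x - m)) *
    gauss_pdf m S x)%:E = k%:E * \int[lebesgue_tuple d]_x
    (expR (- quadf (invmx S - (c / 2) *: 1%:M) (col_of_tuple x - m) / 2))%:E)%E.
  rewrite -ge0_integralZl; last 4 first.
  - exact: measurableT.
  - by apply/measurable_EFinP; exact: measurable_expR_quadf.
  - by move=> x _; rewrite lee_fin expR_ge0.
  - by [].
  apply: eq_integral => x _; rewrite -EFinM /gauss_pdf -/k mulrCA -expRD.
  by congr (_ * expR _)%:E; rewrite quadfBm quadfZm; lra.
by rewrite integral_gauss_center// -EFinM ltry.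
Qed.

Lemma second_moment_of_exp (rho : probability (d.-tuple mR) R) m e : 0 < e ->
  (\int[rho]_x (e * quadf 1%:M (col_of_tuple x - m))%:E < +oo)%E -> second_moment rho.
Proof.
move=> e0 h; rewrite /second_moment.
have mq : measurable_fun setT (fun x => e * quadf 1%:M (col_of_tuple x - m)).
  by apply: measurable_funM => //; exact: measurable_quadf.
pose C := 2 * quadf 1%:M m.
have C0 : 0 <= C by rewrite mulr_ge0 ?quadf1_ge0.
have i1 : rho.-integrable setT (EFin \o (fun x => e * quadf 1%:M (col_of_tuple x - m))).
  apply/integrableP; split; first exact/measurable_EFinP.
  by under eq_integral do rewrite /= ger0_norm ?mulr_ge0 ?quadf1_ge0 ?(ltW e0)//.
have i2 := integrableD measurableT (finite_measure_integrable_cst rho C measurableT)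
  (integrableZl measurableT (2 / e) i1).
have : rho.-integrable setT (EFin \o (fun x => quadf 1%:M (col_of_tuple x))).
  apply: le_integrable i2 => //; first by apply/measurable_EFinP; exact: measurable_quadf0.
  move=> x _ /=; rewrite lee_fin ger0_norm ?quadf1_ge0//.
  rewrite ger0_norm ?addr_ge0 ?mulr_ge0 ?invr_ge0 ?quadf1_ge0 ?(ltW e0)//.
  rewrite mulrA divfK ?gt_eqF//.
  have := quadf1_shift (col_of_tuple x - m) (- m); rewrite opprK subrK.
  by rewrite [in X in _ + X]quadfE bilfNl bilfNr opprK -quadfE addrC.
move=> /integrableP[_]; apply: le_lt_trans; apply: ge0_le_integral => //.
- by move=> x _; rewrite lee_fin quadf1_ge0.
- by apply/measurable_EFinP; exact: measurable_quadf0.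
- by apply: measurableT_comp => //; apply/measurable_EFinP; exact: measurable_quadf0.
- by move=> x _; rewrite /= lee_fin ler_norm.
Qed.

(** A Gaussian has an exponential quadratic moment, so finite entropy relative to it gives second
    moments. Every competitor of finite objective thus integrates the quadratic dual potentials. *)
Lemma KL_second_moment (rho : probability (d.-tuple mR) R) m S : posdef S ->
  (KL rho (gauss m S) < +oo)%E -> second_moment rho.
Proof.
move=> pS KLoo; have [e e0 he] := gauss_exp_quadf m pS.
apply: (@second_moment_of_exp rho m e) => //.
apply: (KL_finite_integrable KLoo) => //.
- by apply: measurable_funM => //; exact: measurable_quadf.
- by move=> x; rewrite mulr_ge0 ?quadf1_ge0// ltW.
Qed.

Lemma gauss_second_moment m S (pS : posdef S) : second_moment (gauss_prob m pS).
Proof.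
have [e e0 he] := gauss_exp_quadf m pS.
apply: (@second_moment_of_exp _ m e) => //.
apply: le_lt_trans he; apply: ge0_le_integral => //.
- by move=> x _; rewrite lee_fin mulr_ge0 ?quadf1_ge0// ltW.
- apply/measurable_EFinP; apply: measurable_funM => //; exact: measurable_quadf.
- apply/measurable_EFinP; apply: measurableT_comp => //.
  by apply: measurable_funM => //; exact: measurable_quadf.
- by move=> x _; rewrite lee_fin; apply: le_trans (expR_ge1Dx _); rewrite lerDr.
Qed.

Lemma coord_norm (v : 'cV[R]_d) i : `|v i 0| <= 1 + quadf 1%:M v.
Proof.
have : `|v i 0| ^+ 2 <= quadf 1%:M v.
  rewrite real_normK ?num_real// quadf1E (bigD1 i)//= lerDl.
  by apply: sumr_ge0 => l _; exact: sqr_ge0.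
by move: (quadf _ _) `|_| => q a; nra.
Qed.

Lemma second_moment_coord rho i : second_moment rho ->
  rho.-integrable setT (fun x => (col_of_tuple x i 0)%:E).
Proof.
move=> m2; apply: (@second_moment_integrable _ (fun x => col_of_tuple x i 0) 1) => //.
  by under eq_fun do rewrite mxE; exact: measurable_tnth.
by move=> x; rewrite mul1r coord_norm.
Qed.

Lemma second_moment_coord2 rho i j : second_moment rho ->
  rho.-integrable setT (fun x => (col_of_tuple x i 0 * col_of_tuple x j 0)%:E).
Proof.
move=> m2; have := second_moment_quadf (delta_mx i j) 0 m2.
apply: eq_integrable => // x _; congr EFin; rewrite subr0 quadfE bilfE.
rewrite (bigD1 i)//= [X in X + _](bigD1 j)//= !mxE !eqxx mulr1.
rewrite big1 ?addr0 ?big1 ?addr0// => k.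
  move=> /negPf ki; rewrite big1// => l _; by rewrite !mxE ki /= mulr0 mul0r.
by move=> /negPf kj; rewrite !mxE kj andbF mulr0 mul0r.
Qed.

(** Functions of either sign are reduced to [integral_gauss_afft] through their positive and
    negative parts. The image parameters enter through equations so that any proof of their positive
    definiteness fits. *)
Lemma has_mean_gauss_afft m S L t v Q (f : d.-tuple mR -> R) r
    (pS : posdef S) (pQ : posdef Q) :
  L \in unitmx -> measurable_fun setT f ->
  v = L *m m + t -> Q = L *m S *m L^T ->
  has_mean (gauss_prob v pQ) f r <->
  has_mean (gauss_prob m pS) (fun x => f (afft L t x)) r.
Proof.
move=> uL mf vE QE; subst v Q; rename pQ into pS'.
have mfL : measurable_fun setT (fun x => f (afft L t x)).
  by apply: measurableT_comp => //; exact: measurable_afft.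
have eqi (g : d.-tuple mR -> R) : measurable_fun setT g -> (forall x, 0 <= g x) ->
   (\int[gauss_prob (L *m m + t) pS']_x (g x)%:E =
    \int[gauss_prob m pS]_x (g (afft L t x))%:E)%E.
  by move=> mg g0; exact: (esym (integral_gauss_afft m t uL pS mg g0)).
have eqn : (\int[gauss_prob (L *m m + t) pS']_x `|(f x)%:E| =
    \int[gauss_prob m pS]_x `|(f (afft L t x))%:E|)%E.
  by apply: (eqi (fun x => `|f x|)) => //; exact: measurableT_comp.
have mfp : measurable_fun setT (fun x => Num.max (f x) 0) by exact: measurable_maxr.
have mfn : measurable_fun setT (fun x => Num.max (- f x) 0).
  apply: measurable_maxr; last exact: measurable_cst.
  by apply: (measurableT_comp (f := @GRing.opp R)) => //; exact: oppr_measurable.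
have fp0 (a : R) : 0 <= Num.max a 0 by rewrite le_max lexx orbT.
have eqf : (\int[gauss_prob (L *m m + t) pS']_x (f x)%:E =
    \int[gauss_prob m pS]_x (f (afft L t x))%:E)%E.
  have ep : (\int[gauss_prob (L *m m + t) pS']_x (fun x => (f x)%:E)^\+ x =
      \int[gauss_prob m pS]_x (fun x => (f (afft L t x))%:E)^\+ x)%E.
    transitivity (\int[gauss_prob (L *m m + t) pS']_x (Num.max (f x) 0)%:E)%E.
      by apply: eq_integral => x _; rewrite funeposE -EFin_max.
    apply: etrans (eqi (fun x => Num.max (f x) 0) mfp (fun x => fp0 (f x))) _.
    by apply: eq_integral => x _; rewrite funeposE -EFin_max.
  have en : (\int[gauss_prob (L *m m + t) pS']_x (fun x => (f x)%:E)^\- x =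
      \int[gauss_prob m pS]_x (fun x => (f (afft L t x))%:E)^\- x)%E.
    transitivity (\int[gauss_prob (L *m m + t) pS']_x (Num.max (- f x) 0)%:E)%E.
      by apply: eq_integral => x _; rewrite funenegE -EFin_max.
    apply: etrans (eqi (fun x => Num.max (- f x) 0) mfn (fun x => fp0 (- f x))) _.
    by apply: eq_integral => x _; rewrite funenegE -EFin_max.
  exact: (etrans (integralE _ _ _) (etrans (f_equal2 (fun a b => a - b)%E ep en)
    (esym (integralE _ _ _)))).
split=> -[/integrableP[_ fi] fr]; split.
- by apply/integrableP; split; [exact/measurable_EFinP|rewrite -eqn].
- by rewrite -eqf.
- by apply/integrableP; split; [exact/measurable_EFinP|rewrite eqn].
- by rewrite eqf.
Qed.

End second_moment.

(** * Mean and covariance of a Gaussian *)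

Section gaussian_moments.
Context {R : realType} {d : nat}.
Local Notation mR := (measurableTypeR R).
Implicit Types (x : d.-tuple mR) (m v : 'cV[R]_d) (S Q A : 'M[R]_d).

Let std : probability (d.-tuple mR) R := gauss_prob 0 (@posdef1 R d).

Lemma measurable_coord i : measurable_fun setT (fun x => col_of_tuple x i 0).
Proof. by under eq_fun do rewrite mxE; exact: measurable_tnth. Qed.

(** The sign change of one coordinate preserves the standard Gaussian, so moments odd in that
    coordinate vanish. *)
Let flip i : 'M[R]_d := diag_mx (\row_j (if j == i then -1 else 1)).

Let flip_sqr i : flip i *m flip i = 1%:M.
Proof.
rewrite /flip mulmx_diag -diag_const_mx; congr diag_mx; apply/rowP => j.
by rewrite !mxE; case: ifP => _; rewrite ?mulrNN mulr1.
Qed.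

Let flip_tr i : (flip i)^T = flip i.
Proof. by rewrite tr_diag_mx. Qed.

Let flip_coord i j x :
  col_of_tuple (afft (flip i) 0 x) j 0 = (if j == i then -1 else 1) * col_of_tuple x j 0.
Proof. by rewrite col_afft addr0 mul_diag_mx !mxE. Qed.

Let std_flip i (f : d.-tuple mR -> R) r : measurable_fun setT f ->
  has_mean std f r -> has_mean std (fun x => f (afft (flip i) 0 x)) r.
Proof.
move=> mf fr.
have uF : flip i \in unitmx by have [] := mulmx1_unit (flip_sqr i).
have E1 : flip i *m 1%:M *m (flip i)^T = 1%:M by rewrite mulmx1 flip_tr flip_sqr.
have E2 : 0 = flip i *m 0 + 0 :> 'cV[R]_d by rewrite mulmx0 addr0.
exact: ((has_mean_gauss_afft r (@posdef1 R d) (@posdef1 R d) uF mf E2 (esym E1)).1 fr).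
Qed.

Let std_coord i : has_mean std (fun x => col_of_tuple x i 0) 0.
Proof.
have fi := second_moment_coord i (gauss_second_moment 0 (@posdef1 R d)).
have fin := integrable_fin_num measurableT fi.
have h : has_mean std (fun x => col_of_tuple x i 0)
    (fine (\int[std]_x (col_of_tuple x i 0)%:E)) by split => //; rewrite fineK.
have h2 := std_flip i (measurable_coord i) h.
have h3 := has_mean_ext (fun x => flip_coord i i x) h2.
have := has_meanZ (-1) h; move: h3; rewrite eqxx => h3 /(has_mean_unique h3).
by move: h; move: (fine _) => r h rE; rewrite (_ : 0 = r)//; lra.
Qed.

Let std_coord2 i j : i != j ->
  has_mean std (fun x => col_of_tuple x i 0 * col_of_tuple x j 0) 0.
Proof.
move=> ij.
have fi := second_moment_coord2 i j (gauss_second_moment 0 (@posdef1 R d)).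
have fin := integrable_fin_num measurableT fi.
have h : has_mean std (fun x => col_of_tuple x i 0 * col_of_tuple x j 0)
    (fine (\int[std]_x (col_of_tuple x i 0 * col_of_tuple x j 0)%:E)) by split => //; rewrite fineK.
have mf : measurable_fun setT (fun x => col_of_tuple x i 0 * col_of_tuple x j 0).
  by apply: measurable_funM; exact: measurable_coord.
have h2 := std_flip i mf h.
have h3 : has_mean std (fun x => -1 * (col_of_tuple x i 0 * col_of_tuple x j 0))
    (fine (\int[std]_x (col_of_tuple x i 0 * col_of_tuple x j 0)%:E)).
  apply: has_mean_ext h2 => x; rewrite !flip_coord eqxx eq_sym (negPf ij); ring.
have := has_meanZ (-1) h => /(has_mean_unique h3).
by move: h; move: (fine _) => r h rE; rewrite (_ : 0 = r)//; lra.
Qed.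

(* The exact value comes from 1 + e u <= exp(e u) for e of both signs, the right-hand side
   being a Gaussian integral. *)
Let std_coord_sqr i : has_mean std (fun x => col_of_tuple x i 0 * col_of_tuple x i 0) 1.
Proof.
have fi := second_moment_coord2 i i (gauss_second_moment 0 (@posdef1 R d)).
have fin := integrable_fin_num measurableT fi.
pose r := fine (\int[std]_x (col_of_tuple x i 0 * col_of_tuple x i 0)%:E).
have h : has_mean std (fun x => col_of_tuple x i 0 * col_of_tuple x i 0) r.
  by split => //; rewrite fineK.
have r0 : 0 <= r.
  by rewrite fine_ge0//; apply: integral_ge0 => x _; rewrite lee_fin -expr2 sqr_ge0.
(* e is chosen so that the tilted exponent has matrix D, the identity with i-th diagonal entry s^2;
   the Gaussian integral is then det(D)^(-1/2) = 1 / s. *)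
have key s : 0 < s -> (1 - s ^+ 2) / 2 * r + 1 <= s^-1.
  move=> s0; set e := (1 - s ^+ 2) / 2.
  pose D : 'M[R]_d := diag_mx (\row_j (if j == i then s ^+ 2 else 1)).
  have qD z : quadf D z = quadf 1%:M z - 2 * e * (z i 0 * z i 0).
    rewrite quadf1E /quadf mul_mx_diag mxE /= (bigD1 i)//= [in RHS](bigD1 i)//=.
    rewrite !mxE eqxx /e.
    rewrite (_ : \sum_(j | j != i) _ = \sum_(j | j != i) z j 0 ^+ 2); last first.
      by apply: eq_bigr => j /negPf ji; rewrite !mxE ji mulr1 expr2.
    by move: (\sum_(j | _) _) => q; field.
  have pD : posdef D.
    split; first by rewrite tr_diag_mx.
    move=> z z0; rewrite /quadf mul_mx_diag mxE /=.
    have nn j : 0 <= (\matrix_(i0, j0) (z^T i0 j0 * (\row_j1 (if j1 == i then s ^+ 2 else 1)) 0 j0)) (0 : 'I_1) j * z j 0.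
      rewrite !mxE mulrAC mulr_ge0//; first by rewrite -expr2 sqr_ge0.
      by case: ifP => _ //; rewrite sqr_ge0.
    rewrite lt_neqAle sumr_ge0// andbT eq_sym; apply: contra z0 => /eqP.
    move/eqP; rewrite psumr_eq0// => /allP hz; apply/eqP/colP => j; rewrite [RHS]mxE.
    have := hz j (mem_index_enum _); rewrite !mxE mulrAC mulf_eq0 => /orP[|].
      by rewrite mulf_eq0 orbb => /eqP.
    by case: ifP => _; rewrite ?oner_eq0// sqrf_eq0 gt_eqF.
  have detD : \det D = s ^+ 2.
    rewrite det_diag (bigD1 i)//= mxE eqxx big1 ?mulr1// => j /negPf ji.
    by rewrite mxE ji.
  have c0 : 0 < Num.sqrt ((2 * pi) ^+ d) :> R by rewrite sqrtr_gt0 exprn_gt0// mulr_gt0// pi_gt0.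
  have mq : measurable_fun setT (fun x => expR (e * (col_of_tuple x i 0 * col_of_tuple x i 0))).
    apply: measurableT_comp => //; apply: measurable_funM => //.
    by apply: measurable_funM; exact: measurable_coord.
  have Ie : (\int[gauss 0 1%:M]_x (expR (e * (col_of_tuple x i 0 * col_of_tuple x i 0)))%:E = (s^-1)%:E)%E.
    rewrite (integral_gauss_pdf 0 (@posdef1 R d) mq (fun x => expR_ge0 _)).
    transitivity ((Num.sqrt ((2 * pi) ^+ d))^-1%:E * \int[lebesgue_tuple d]_x
       (expR (- quadf D (col_of_tuple x - 0) / 2))%:E)%E.
      rewrite -ge0_integralZl; last 4 first.
      - exact: measurableT.
      - by apply/measurable_EFinP; exact: measurable_expR_quadf.
      - by move=> x _; rewrite lee_fin expR_ge0.
      - by rewrite lee_fin invr_ge0 ltW.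
      apply: eq_integral => x _; rewrite -EFinM /gauss_pdf det1 mulr1 mulrCA -expRD invmx1.
      by congr (_ * expR _)%:E; rewrite subr0 qD; field.
    rewrite integral_gauss_center// detD -EFinM sqrtrM ?exprn_ge0 ?mulr_ge0 ?pi_ge0//.
    by rewrite sqrtrV ?sqr_ge0// sqrtr_sqr ger0_norm ?(ltW s0)// mulKf// gt_eqF.
  have h1 := has_meanD (has_meanZ e h) (has_mean_cst std 1).
  have le1 : (\int[std]_x (e * (col_of_tuple x i 0 * col_of_tuple x i 0) + cst 1 x)%:E <=
     \int[gauss 0 1%:M]_x (expR (e * (col_of_tuple x i 0 * col_of_tuple x i 0)))%:E)%E.
    apply: (le_integral (mu := std) measurableT h1.1).
      apply/integrableP; split; first exact/measurable_EFinP.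
      under eq_integral do rewrite /= ger0_norm ?expR_ge0//.
      by rewrite [X in (X < _)%E]Ie ltry.
    by move=> x _; rewrite lee_fin addrC expR_ge1Dx.
  by move: le1; rewrite h1.2 Ie lee_fin.
suff -> : 1 = r by [].
(* At s = 1 the two sides of [key] coincide, with slopes -r and -1. A value of s slightly above 1
   excludes r < 1, one slightly below excludes r > 1; the offsets (1 - r) / 4 and (1 - 1 / r) / 4
   are small enough. *)
apply/eqP; rewrite eq_le; apply/andP; split; rewrite leNgt; apply/negP => r1.
- have := key (1 + (1 - r) / 4).
  set t := (1 - r) / 4; have rE : r = 1 - 4 * t by rewrite /t; field.
  have t0 : 0 < t by rewrite /t; lra.
  have t1 : 4 * t <= 1 by move: r0; rewrite rE; lra.
  have st : 0 < 1 + t by lra.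
  move=> /(_ st); rewrite -(ler_pM2r st) mulVf ?gt_eqF// rE; nra.
- pose t := 1 - r^-1.
  have rp : 0 < r by lra.
  have rV : r * r^-1 = 1 by rewrite mulfV// gt_eqF.
  have V0 : 0 < r^-1 by rewrite invr_gt0.
  have t0 : 0 < t by rewrite /t; nra.
  have t1 : t < 1 by rewrite /t; lra.
  have st : 0 < 1 - t / 4 by lra.
  have := key _ st; rewrite -(ler_pM2r st) mulVf ?gt_eqF//.
  have : r * (1 - t) = 1 by rewrite /t opprB addrC subrK.
  nra.
Qed.

Variables (v : 'cV[R]_d) (Q : 'M[R]_d) (pQ : posdef Q).

Lemma gauss_mean i : has_mean (gauss_prob v pQ) (fun x => col_of_tuple x i 0) (v i 0).
Proof.
have [S [pS SS]] := posdef_sqrt pQ.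
have uS := posdef_unit pS.
have E1 : S *m 1%:M *m S^T = Q by rewrite mulmx1 pS.1.
have E2 : S *m 0 + v = v by rewrite mulmx0 add0r.
apply: (has_mean_gauss_afft _ (@posdef1 R d) pQ uS (measurable_coord i) (esym E2) (esym E1)).2.
apply: (@has_mean_ext _ _ _ _ (fun x => \sum_k S i k * col_of_tuple x k 0 + cst (v i 0) x)).
  by move=> x; rewrite col_afft !mxE.
rewrite -[X in has_mean _ _ X]add0r; apply: has_meanD; last exact: has_mean_cst.
have := has_mean_sum (fun l => has_meanZ (S i l) (std_coord l)).
by rewrite big1// => l _; rewrite mulr0.
Qed.

(** The square root of Q maps the standard Gaussian to this one; in the expanded product the terms
    of first order and the mixed moments vanish. *)
Lemma gauss_covariance m i j : has_mean (gauss_prob v pQ)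
  (fun x => (col_of_tuple x - m) i 0 * (col_of_tuple x - m) j 0)
  ((Q + (v - m) *m (v - m)^T) i j).
Proof.
have [S [pS SS]] := posdef_sqrt pQ.
have uS := posdef_unit pS.
have E1 : S *m 1%:M *m S^T = Q by rewrite mulmx1 pS.1.
have E2 : S *m 0 + v = v by rewrite mulmx0 add0r.
have mf : measurable_fun setT (fun x => (col_of_tuple x - m) i 0 * (col_of_tuple x - m) j 0).
  apply: measurable_funM; under eq_fun do rewrite !mxE;
    by apply: measurable_funB => //; exact: measurable_tnth.
apply: (has_mean_gauss_afft _ (@posdef1 R d) pQ uS mf (esym E2) (esym E1)).2.
pose a := v - m.
apply: (@has_mean_ext _ _ _ _ (fun x => \sum_k \sum_l S i k * S j l * (col_of_tuple x k 0 * col_of_tuple x l 0) +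
  (a j 0 * \sum_k S i k * col_of_tuple x k 0 + (a i 0 * \sum_k S j k * col_of_tuple x k 0 +
  cst (a i 0 * a j 0) x)))).
  move=> x; rewrite col_afft -addrA -/a.
  have sE k : (S *m col_of_tuple x + a) k 0 = (\sum_l S k l * col_of_tuple x l 0) + a k 0.
    by rewrite !mxE.
  rewrite !sE mulrDl !mulrDr mulr_suml -!addrA; congr (_ + _).
    apply: eq_bigr => k _; rewrite mulr_sumr; apply: eq_bigr => l _; ring.
  by rewrite /cst; ring.
have lin k b : has_mean std (fun x => b * \sum_l S k l * col_of_tuple x l 0) 0.
  have := has_meanZ b (has_mean_sum (fun l => has_meanZ (S k l) (std_coord l))).
  by rewrite big1 ?mulr0// => l _; rewrite mulr0.
have -> : (Q + a *m a^T) i j = (\sum_k \sum_l S i k * S j l * (k == l)%:R) + (0 + (0 + a i 0 * a j 0)).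
  rewrite !add0r mxE -E1 mulmx1; congr (_ + _); last first.
    by rewrite mxE big_ord1 [a^T 0 j]mxE.
  rewrite mxE; apply: eq_bigr => k _; rewrite (bigD1 k)//= eqxx mulr1 big1 ?addr0 ?[S^T k j]mxE//.
  by move=> l /negPf lk; rewrite eq_sym lk mulr0.
apply: has_meanD; last first.
  apply: has_meanD; [exact: lin|apply: has_meanD; [exact: lin|exact: has_mean_cst]].
apply: has_mean_sum => k; apply: has_mean_sum => l; apply: has_meanZ.
by case: eqVneq => [->|kl]; [exact: std_coord_sqr|exact: std_coord2].
Qed.

Lemma gauss_quadf A m : has_mean (gauss_prob v pQ)
  (fun x => quadf A (col_of_tuple x - m)) (\tr (A *m (Q + (v - m) *m (v - m)^T))).
Proof.
set C := Q + _.
have sC : C^T = C by rewrite /C linearD /= trmx_mul trmxK pQ.1.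
apply: (@has_mean_ext _ _ _ _ (fun x => \sum_i \sum_j A i j *
   ((col_of_tuple x - m) i 0 * (col_of_tuple x - m) j 0))).
  by move=> x; rewrite quadfE bilfE; apply: eq_bigr => i _; apply: eq_bigr => j _; ring.
rewrite (_ : \tr _ = \sum_i \sum_j A i j * C i j); last first.
  rewrite /mxtrace; apply: eq_bigr => i _; rewrite mxE; apply: eq_bigr => j _.
  by rewrite -[in LHS]sC [C^T j i]mxE.
apply: has_mean_sum => i; apply: has_mean_sum => j; apply: has_meanZ.
exact: gauss_covariance.
Qed.

End gaussian_moments.

(** * Relative entropy between Gaussians *)

Section gaussian_entropy.
Context {R : realType} {d : nat}.
Local Notation mR := (measurableTypeR R).
Implicit Types (m v : 'cV[R]_d) (S Q : 'M[R]_d).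

(* The part of KL(q | N(m, S)) that depends on (m, S), for q = N(v, Q). *)
Definition cross_entropy (q nu : gpar R d) : R :=
  (ln (\det nu.2) + \tr (invmx nu.2 *m (q.2 + (q.1 - nu.1) *m (q.1 - nu.1)^T))) / 2.

Lemma integral_exp_gauss_lnpdf m S v Q : posdef S -> posdef Q ->
  (\int[gauss m S]_x (expR (gauss_lnpdf v Q (col_of_tuple x) -
     gauss_lnpdf m S (col_of_tuple x)))%:E = 1)%E.
Proof. by move=> pS pQ; rewrite -gauss_density// gaussT. Qed.

Lemma measurable_lnpdfB m S v Q : measurable_fun setT
  (fun x : d.-tuple mR => gauss_lnpdf v Q (col_of_tuple x) - gauss_lnpdf m S (col_of_tuple x)).
Proof. by apply: measurable_funB; exact: measurable_gauss_lnpdf. Qed.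

Lemma integrable_lnpdfB (rho : probability (d.-tuple mR) R) m S v Q : second_moment rho ->
  rho.-integrable setT (EFin \o
  (fun x : d.-tuple mR => gauss_lnpdf v Q (col_of_tuple x) - gauss_lnpdf m S (col_of_tuple x))).
Proof.
move=> m2; have := integrableB measurableT (second_moment_lnpdf v Q m2) (second_moment_lnpdf m S m2).
by apply: eq_integrable.
Qed.

Lemma gauss_KL v Q m S (pQ : posdef Q) : posdef S ->
  KL (gauss_prob v pQ) (gauss m S) =
  (cross_entropy (v, Q) (m, S) - (ln (\det Q) + d%:R) / 2)%:E.
Proof.
move=> pS.
rewrite (KL_of_density (gaussT m pS) (measurable_lnpdfB m S v Q)
  (integral_exp_gauss_lnpdf m v pS pQ) (integrable_lnpdfB m S v Q (gauss_second_moment v pQ))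
  (gauss_density m v pS pQ)).
have lnE S' : posdef S' -> ln ((2 * pi) ^+ d * \det S') = ln ((2 * pi) ^+ d) + ln (\det S').
  by move=> pS'; rewrite lnM ?posrE ?det_posdef_gt0// exprn_gt0// mulr_gt0// pi_gt0.
pose c := ln ((2 * pi) ^+ d) : R.
have h := has_meanD (has_meanZ 2^-1 (gauss_quadf v pQ (invmx S) m))
  (has_meanD (has_meanZ (- 2^-1) (gauss_quadf v pQ (invmx Q) v))
   (has_mean_cst (gauss_prob v pQ) ((ln (\det S) - ln (\det Q)) / 2))).
have h2 := has_mean_ext (g := fun x => gauss_lnpdf v Q (col_of_tuple x) - gauss_lnpdf m S (col_of_tuple x)) _ h.
apply: etrans (h2 _).2 _.
  by move=> x; rewrite /gauss_lnpdf !lnE// /cst; field.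
congr EFin; rewrite /cross_entropy /= subrr mul0mx addr0 mulVmx ?posdef_unit// mxtrace1.
by field.
Qed.

(** Concavity of ln det, read off from the nonnegativity of the relative entropy between centered
    Gaussians. *)
Lemma ln_det_le S Q : posdef S -> posdef Q ->
  ln (\det Q) - ln (\det S) <= \tr (invmx S *m (Q - S)).
Proof.
move=> pS pQ; have := KL_ge0 (gauss_prob 0 pQ) (gauss 0 S).
rewrite gauss_KL// lee_fin /cross_entropy /= subrr mul0mx addr0.
rewrite mulmxBr linearB /= mulVmx ?posdef_unit// mxtrace1; lra.
Qed.

(** Mean and covariance are determined by the measure; this makes the choice in [q_par]
    unambiguous. *)
Lemma gauss_inj v Q v' Q' : posdef Q -> posdef Q' ->
  (forall A, measurable A -> gauss v Q A = gauss v' Q' A) -> (v, Q) = (v', Q').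
Proof.
move=> pQ pQ' eqA.
have tr f r := @has_mean_eq_measure R _ _ (gauss_prob v pQ) (gauss_prob v' pQ') f r eqA.
have vv : v = v'.
  by apply/colP => i; apply: has_mean_unique (tr _ _ (gauss_mean v pQ i)) (gauss_mean v' pQ' i).
rewrite -vv in pQ' tr *; congr pair; apply/matrixP => i j.
have := has_mean_unique (tr _ _ (gauss_covariance v pQ v i j)) (gauss_covariance v pQ' v i j).
by rewrite subrr mul0mx !addr0.
Qed.

End gaussian_entropy.

(** * The minimizer of the unbalanced transport problem *)

Section pushforward_mean.
Context {R : realType} {d1 d2 : measure_display}.
Context {T1 : measurableType d1} {T2 : measurableType d2}.

Lemma has_mean_pushforward (g : probability T1 R) (rho : probability T2 R)
    (phi : T1 -> T2) f r : measurable_fun setT phi ->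
  (forall A, measurable A -> g (phi @^-1` A) = rho A) ->
  has_mean rho f r -> has_mean g (fun x => f (phi x)) r.
Proof.
move=> mphi eqA [/integrableP[mf fi] fr].
have mfphi : measurable_fun setT (fun x => (f (phi x))%:E).
  by apply: (measurableT_comp mf).
have ei (h : T2 -> \bar R) : (\int[rho]_x h x = \int[pushforward g phi]_x h x)%E.
  by apply: eq_measure_integral => A mA _; first [exact: (eqA A mA)|exact: (esym (eqA A mA))].
have gi : g.-integrable setT (fun x => (f (phi x))%:E).
  apply/integrableP; split => //; move: fi; rewrite ei ge0_integral_pushforward//.
  exact: measurableT_comp.
by split => //; rewrite -fr ei integral_pushforward.
Qed.

End pushforward_mean.

(** * The candidate pair and its dual potentials *)

Section optimal_pair.
Context {R : realType} {d : nat}.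
Variables (t0 t1 : R).
Hypotheses (t0_gt0 : 0 < t0) (t1_gt0 : 0 < t1).
Implicit Types (mu nu : gpar R d) (S : 'M[R]_d).

(** Stationarity in p of the cost plus t0 times the entropy reads P^-1 = S^-1 + (2 / t0) (1 - L),
    with L the linear part of the transport map; this is the part free of L. For q, L^-1 takes the
    place of L and t1 that of t0. *)
Definition precision t S : 'M[R]_d := invmx S + (2 / t) *: 1%:M.

(* The linear part L of the optimal map from p to q: the Riccati equation is [Q = L P L] for
   the stationary [P^-1 = M0 - (2 / t0) L] and [Q^-1 = M1 - (2 / t1) L^-1]. *)
Definition opt_map (S0 S1 : 'M[R]_d) : 'M[R]_d :=
  xget 0 [set L | [/\ posdef L,
    L *m precision t1 S1 *m L + (2 / t0 - 2 / t1) *: L = precision t0 S0,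
    posdef (precision t0 S0 - (2 / t0) *: L) &
    posdef (L - (2 / t1) *: invmx (precision t1 S1))]].

Lemma opt_mapP S0 S1 : posdef S0 -> posdef S1 -> let L := opt_map S0 S1 in
  [/\ posdef L,
    L *m precision t1 S1 *m L + (2 / t0 - 2 / t1) *: L = precision t0 S0,
    posdef (precision t0 S0 - (2 / t0) *: L) &
    posdef (L - (2 / t1) *: invmx (precision t1 S1))].
Proof.
move=> p0 p1.
have [L hL] := riccati_exists t0_gt0 t1_gt0 (posdef_inv p0) (posdef_inv p1).
exact: (@xgetPex _ 0 [set L | _] (ex_intro _ L hL)).
Qed.

(** The difference of the two optimal means. Stationarity gives p.1 = mu.1 - (2 / t0) mu.2 delta and
    q.1 = nu.1 + (2 / t1) nu.2 delta; subtracting them is the linear system inverted here. *)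
Definition opt_delta mu nu : 'cV[R]_d :=
  invmx (1%:M + (2 / t0) *: mu.2 + (2 / t1) *: nu.2) *m (mu.1 - nu.1).

Definition opt_p mu nu : gpar R d :=
  (mu.1 - (2 / t0) *: (mu.2 *m opt_delta mu nu),
   invmx (precision t0 mu.2 - (2 / t0) *: opt_map mu.2 nu.2)).

Definition opt_q mu nu : gpar R d :=
  (nu.1 + (2 / t1) *: (nu.2 *m opt_delta mu nu),
   invmx (precision t1 nu.2 - (2 / t1) *: invmx (opt_map mu.2 nu.2))).

Variables mu nu : gpar R d.
Hypotheses (pmu : posdef mu.2) (pnu : posdef nu.2).
Let L := opt_map mu.2 nu.2.
Let M0 := precision t0 mu.2.
Let M1 := precision t1 nu.2.
Let delta := opt_delta mu nu.
Let p := opt_p mu nu.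
Let q := opt_q mu nu.

Lemma opt_p_gaussian : posdef p.2.
Proof. by have [_ _ h _] := opt_mapP pmu pnu; exact: posdef_inv. Qed.

(** In terms of covariances P^-1 = L Q^-1 L: the map L carries covariance P to covariance Q. *)
Let M1L : L *m (M1 - (2 / t1) *: invmx L) *m L = M0 - (2 / t0) *: L.
Proof.
have [pL E _ _] := opt_mapP pmu pnu; rewrite -/L -/M0 -/M1 in pL E.
have uL := posdef_unit pL.
rewrite mulmxBr mulmxBl -scalemxAr mulmxV// -scalemxAl mul1mx.
rewrite -E -addrA -scalerBl -scaleNr; congr (_ + _ *: _); ring.
Qed.

Lemma opt_q_precision_posdef : posdef (M1 - (2 / t1) *: invmx L).
Proof.
have [pL _ pP _] := opt_mapP pmu pnu; have uL := posdef_unit pL.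
have -> : M1 - (2 / t1) *: invmx L = (invmx L)^T *m (M0 - (2 / t0) *: L) *m invmx L.
  rewrite -M1L (trmx_posdef_inv pL.1) !mulmxA mulVmx// mul1mx.
  by rewrite -mulmxA mulmxV// mulmx1.
by apply: posdef_congr; rewrite ?unitmx_inv.
Qed.

Lemma opt_q_gaussian : posdef q.2.
Proof. exact/posdef_inv/opt_q_precision_posdef. Qed.

Lemma opt_qE : q.2 = L *m p.2 *m L^T.
Proof.
have [pL _ pP _] := opt_mapP pmu pnu; have uL := posdef_unit pL.
have uP := posdef_unit pP.
rewrite pL.1 /q /p /= -/L -/M0 -/M1.
have H : (M1 - (2 / t1) *: invmx L) *m (L *m invmx (M0 - (2 / t0) *: L) *m L) = 1%:M.
  rewrite -(mulKmx uL (M1 - _)) !mulmxA -(mulmxA (invmx L)) -(mulmxA (invmx L)) mulmxA.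
  rewrite -(mulmxA _ _ L) -(mulmxA _ L) mulmxA -!mulmxA.
  rewrite (mulmxA (M1 - _) L) (mulmxA L (_ *m L)) (mulmxA L (M1 - _) L) M1L.
  by rewrite mulKVmx// mulVmx.
by rewrite -[LHS]mulmx1 -H mulKmx// posdef_unit//; exact: opt_q_precision_posdef.
Qed.

Lemma opt_deltaE : p.1 - q.1 = delta.
Proof.
have pD : posdef (1%:M + (2 / t0) *: mu.2 + (2 / t1) *: nu.2).
  apply: posdefD; first apply: posdefD; first exact: posdef1.
    by apply: posdefZ => //; rewrite divr_gt0.
  by apply: posdefZ => //; rewrite divr_gt0.
have : (1%:M + (2 / t0) *: mu.2 + (2 / t1) *: nu.2) *m delta = mu.1 - nu.1.
  by rewrite /delta /opt_delta mulKVmx// posdef_unit.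
rewrite !mulmxDl mul1mx -!scalemxAl /p /q /= -/delta.
move: (mu.2 *m _) (nu.2 *m _) => a b h.
have -> : mu.1 = delta + (2 / t0) *: a + (2 / t1) *: b + nu.1 by rewrite h subrK.
by apply/colP => i; rewrite !mxE; ring.
Qed.

Definition opt_gain0 (x : 'cV[R]_d) := gauss_lnpdf p.1 p.2 x - gauss_lnpdf mu.1 mu.2 x.
Definition opt_gain1 (x : 'cV[R]_d) := gauss_lnpdf q.1 q.2 x - gauss_lnpdf nu.1 nu.2 x.

(** Completing the square: the formulas for P^-1 and Q^-1 match the quadratic coefficients, and
    [opt_deltaE] matches the linear ones. Dual feasibility and complementary slackness are both
    contained in the sign and the zero set of the remaining square. *)
Lemma opt_identity : exists K, forall x y,
  quadf 1%:M (x - y) + t0 * opt_gain0 x + t1 * opt_gain1 y =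
  K + quadf (invmx L) (y - q.1 - L *m (x - p.1)).
Proof.
have [pL _ pP _] := opt_mapP pmu pnu; have uL := posdef_unit pL.
have s1 : (1%:M : 'M[R]_d)^T = 1%:M by rewrite trmx1.
have smu := trmx_posdef_inv pmu.1; have snu := trmx_posdef_inv pnu.1.
have sL := trmx_posdef_inv pL.1.
pose a0 := p.1 - mu.1; pose a1 := q.1 - nu.1.
have a0E : a0 = - ((2 / t0) *: (mu.2 *m delta)) by rewrite /a0 /p /= -/delta addrAC subrr add0r.
have a1E : a1 = (2 / t1) *: (nu.2 *m delta) by rewrite /a1 /q /= -/delta addrAC subrr add0r.
pose c0 := - ln ((2 * pi) ^+ d * \det p.2) / 2 + ln ((2 * pi) ^+ d * \det mu.2) / 2.
pose c1 := - ln ((2 * pi) ^+ d * \det q.2) / 2 + ln ((2 * pi) ^+ d * \det nu.2) / 2.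
(* The constant is the left-hand side at the two means x = p.1 and y = q.1, where the square
   vanishes. *)
exists (quadf 1%:M delta + t0 * (c0 + quadf (invmx mu.2) a0 / 2) +
  t1 * (c1 + quadf (invmx nu.2) a1 / 2)) => x y.
pose u := x - p.1; pose w := y - q.1.
have xyE : x - y = (u - w) + delta by rewrite -opt_deltaE /u /w; apply/colP => i; rewrite !mxE; ring.
have xE : x - mu.1 = u + a0 by rewrite /u /a0 addrA subrK.
have yE : y - nu.1 = w + a1 by rewrite /w /a1 addrA subrK.
rewrite /opt_gain0 /opt_gain1 /gauss_lnpdf xE yE xyE -/u -/w.
rewrite (quadfDe (u - w) delta s1) (quadfDe u a0 smu) (quadfDe w a1 snu).
rewrite [p.2]/(invmx _) invmxK [q.2]/(invmx _) invmxK -/L -/M0 -/M1.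
rewrite -/p -/q.
have qP z : quadf (M0 - (2 / t0) *: L) z = quadf (invmx mu.2) z + 2 / t0 * quadf 1%:M z - 2 / t0 * quadf L z.
  by rewrite quadfBm quadfZm /M0 /precision quadfE bilfDm bilfZm -!quadfE.
have qQ z : quadf (M1 - (2 / t1) *: invmx L) z = quadf (invmx nu.2) z + 2 / t1 * quadf 1%:M z - 2 / t1 * quadf (invmx L) z.
  by rewrite quadfBm quadfZm /M1 /precision quadfE bilfDm bilfZm -!quadfE.
rewrite qP qQ.
have uw : quadf 1%:M (u - w) = quadf 1%:M u - 2 * bilf 1%:M u w + quadf 1%:M w.
  by rewrite (quadfDe u (- w) s1) bilfNr (quadfE _ (- w)) bilfNl bilfNr opprK -quadfE mulrN.
have b0 : bilf (invmx mu.2) u a0 = - (2 / t0) * bilf 1%:M u delta.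
  by rewrite a0E bilfNr bilfZr bilf_mulr mulVmx ?posdef_unit// mulNr.
have b1 : bilf (invmx nu.2) w a1 = 2 / t1 * bilf 1%:M w delta.
  by rewrite a1E bilfZr bilf_mulr mulVmx ?posdef_unit.
have rL : quadf (invmx L) (w - L *m u) = quadf (invmx L) w - 2 * bilf 1%:M u w + quadf L u.
  rewrite (quadfDe w (- (L *m u)) sL) bilfNr bilf_mulr mulVmx// (bilf_sym w u s1) mulrN.
  rewrite (quadfE _ (- _)) bilfNl bilfNr opprK -quadfE quadf_congr pL.1 mulmxV//.
  by rewrite mul1mx.
rewrite uw b0 b1 rL bilfBl /c0 /c1.
move: (ln _) (ln _) (ln _) (ln _) => l1 l2 l3 l4.
by field; rewrite !gt_eqF.
Qed.

End optimal_pair.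

(** * Transport cost of a map *)

Section transport_cost.
Context {R : realType} {d : nat}.
Local Notation mR := (measurableTypeR R).

Lemma sqdistE (x y : d.-tuple mR) :
  sqdist x y = quadf 1%:M (col_of_tuple x - col_of_tuple y).
Proof. by rewrite quadf1E; apply: eq_bigr => i _; rewrite !mxE. Qed.

Lemma measurable_sqdist :
  measurable_fun setT (fun z : d.-tuple mR * d.-tuple mR => sqdist z.1 z.2).
Proof.
apply: measurable_sum => i; apply: measurable_funX; apply: measurable_funB.
  by apply: measurable_tnth_comp.
by apply: measurable_tnth_comp.
Qed.

Lemma W2sq_map_le (p q : probability (d.-tuple mR) R)
    (phi : d.-tuple mR -> d.-tuple mR) r :
  measurable_fun setT phi -> (forall A, measurable A -> p (phi @^-1` A) = q A) ->
  has_mean p (fun x => sqdist x (phi x)) r -> (W2sq p q <= r%:E)%E.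
Proof.
move=> mphi phi_push h.
have mX : measurable_fun setT (fun x => (x, phi x)) by exact: measurable_fun_pair.
pose X_mixin := isMeasurableFun.Build _ _ _ _ _ mX.
pose X : {mfun (d.-tuple mR) >-> (d.-tuple mR * d.-tuple mR)%type} := HB.pack (fun x => (x, phi x)) X_mixin.
pose g : probability (d.-tuple mR * d.-tuple mR)%type R := distribution p X.
have gc : coupling p q g by move=> A mA; split; [|exact: phi_push].
apply: (@le_trans _ _ (\int[g]_z (sqdist z.1 z.2)%:E)%E).
  by apply: ereal_inf_lbound; exists g.
have mg : measurable_fun setT (fun z : d.-tuple mR * d.-tuple mR => (sqdist z.1 z.2)%:E).
  by apply/measurable_EFinP; exact: measurable_sqdist.
have sg : {in setT, forall z : d.-tuple mR * d.-tuple mR, (0 <= (sqdist z.1 z.2)%:E)%E}.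
  by move=> z _; rewrite lee_fin sqdistE quadf1_ge0.
have -> : (\int[g]_z (sqdist z.1 z.2)%:E = r%:E)%E; last by [].
apply: (etrans (ge0_integral_pushforward mX p measurableT mg sg)).
exact: h.2.
Qed.

End transport_cost.

(** * Optimality and uniqueness *)

Section minimizer.
Context {R : realType} {d : nat}.
Local Notation mR := (measurableTypeR R).
Variables (t0 t1 : R).
Hypotheses (t0_gt0 : 0 < t0) (t1_gt0 : 0 < t1).
Variables mu nu : gpar R d.
Hypotheses (pmu : posdef mu.2) (pnu : posdef nu.2).
Let P := opt_p t0 t1 mu nu.
Let Q := opt_q t0 t1 mu nu.
Let pP : posdef P.2 := opt_p_gaussian t0_gt0 t1_gt0 pmu pnu.
Let pQ : posdef Q.2 := opt_q_gaussian t0_gt0 t1_gt0 pmu pnu.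
Let gain0 (x : d.-tuple mR) := opt_gain0 t0 t1 mu nu (col_of_tuple x).
Let gain1 (x : d.-tuple mR) := opt_gain1 t0 t1 mu nu (col_of_tuple x).
Let L := opt_map t0 t1 mu.2 nu.2.
Let phi (x : d.-tuple mR) := afft L (Q.1 - L *m P.1) x.

Let gain_mean m S (pS : posdef S) v V (pV : posdef V) (rho : probability (d.-tuple mR) R) :
  second_moment rho -> exists r, has_mean rho
    (fun x => gauss_lnpdf v V (col_of_tuple x) - gauss_lnpdf m S (col_of_tuple x)) r.
Proof.
move=> m2; have fi := integrable_lnpdfB m S v V m2.
exists (fine (\int[rho]_x (gauss_lnpdf v V (col_of_tuple x) - gauss_lnpdf m S (col_of_tuple x))%:E)).
by split => //; rewrite fineK//; exact: (integrable_fin_num measurableT fi).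
Qed.

(* [- t0 gain0] and [- t1 gain1] are dual potentials up to the constant K: the cost exceeds
   their sum by a square that vanishes exactly on the graph of the optimal map. *)
Lemma W2sq_lower_bound K (rho0 rho1 : probability (d.-tuple mR) R) r0 r1 :
  (forall x y, quadf 1%:M (x - y) + t0 * opt_gain0 t0 t1 mu nu x +
     t1 * opt_gain1 t0 t1 mu nu y =
     K + quadf (invmx L) (y - Q.1 - L *m (x - P.1))) ->
  has_mean rho0 gain0 r0 -> has_mean rho1 gain1 r1 ->
  ((K - t0 * r0 - t1 * r1)%:E <= W2sq rho0 rho1)%E.
Proof.
move=> idK h0 h1; apply: le_ereal_inf_tmp => _ [g gc <-].
have g0 : has_mean g (fun z => gain0 z.1) r0.
  by apply: (has_mean_pushforward _ _ h0) => // A mA; have [] := gc A mA.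
have g1 : has_mean g (fun z => gain1 z.2) r1.
  by apply: (has_mean_pushforward _ _ h1) => // A mA; have [] := gc A mA.
have h := has_meanD (has_mean_cst g K) (has_meanD (has_meanZ (- t0) g0) (has_meanZ (- t1) g1)).
have pL : psdmx (invmx L).
  by have [pL _ _ _] := opt_mapP t0_gt0 t1_gt0 pmu pnu; exact/posdef_psd/posdef_inv.
have s0 (z : d.-tuple mR * d.-tuple mR) : 0 <= sqdist z.1 z.2.
  by rewrite sqdistE quadf1_ge0.
have [oo|] := ltP (\int[g]_z (sqdist z.1 z.2)%:E)%E +oo%E; last first.
  by rewrite leye_eq => /eqP ->; exact: leey.
have -> : K - t0 * r0 - t1 * r1 = K + (- t0 * r0 + - t1 * r1) by ring.
rewrite -h.2; apply: le_integral => //; first exact: h.1.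
  apply/integrableP; split; first by apply/measurable_EFinP; exact: measurable_sqdist.
  by under eq_integral do rewrite /= ger0_norm//.
move=> z _; rewrite lee_fin sqdistE /cst.
have := idK (col_of_tuple z.1) (col_of_tuple z.2).
have := pL.2 (col_of_tuple z.2 - Q.1 - L *m (col_of_tuple z.1 - P.1)).
by rewrite -/(gain0 z.1) -/(gain1 z.2); lra.
Qed.

Let phi_push A : measurable A -> gauss_prob P.1 pP (phi @^-1` A) = gauss_prob Q.1 pQ A.
Proof.
move=> mA; have [pL _ _ _] := opt_mapP t0_gt0 t1_gt0 pmu pnu.
have uL := posdef_unit pL.
have mi : measurable_fun setT (\1_A : d.-tuple mR -> R) by exact: measurable_indic.
have i0 x : 0 <= (\1_A x : R) by rewrite indicE.
have mphi : measurable_fun setT phi by exact: measurable_afft.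
have mA' : measurable (phi @^-1` A) by rewrite -[X in measurable X]setTI; exact: mphi.
have E1 : Q.1 = L *m P.1 + (Q.1 - L *m P.1) by rewrite addrC subrK.
have E2 : Q.2 = L *m P.2 *m L^T by exact: opt_qE.
have H := integral_gauss_afft P.1 (Q.1 - L *m P.1) uL pP mi i0.
rewrite -E1 -E2 in H.
have I1 := integral_indic (gauss Q.1 Q.2) measurableT mA.
have I0 := integral_indic (gauss P.1 P.2) measurableT mA'.
rewrite setIT in I1; rewrite setIT in I0.
exact: (etrans (esym I0) (etrans H I1)).
Qed.

(** On the graph of [phi] the square in the identity is zero, so the coupling induced by [phi]
    attains the dual bound. *)
Lemma W2sq_opt_le K r0 r1 :
  (forall x y, quadf 1%:M (x - y) + t0 * opt_gain0 t0 t1 mu nu x +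
     t1 * opt_gain1 t0 t1 mu nu y =
     K + quadf (invmx L) (y - Q.1 - L *m (x - P.1))) ->
  has_mean (gauss_prob P.1 pP) gain0 r0 -> has_mean (gauss_prob Q.1 pQ) gain1 r1 ->
  (W2sq (gauss_prob P.1 pP) (gauss_prob Q.1 pQ) <= (K - t0 * r0 - t1 * r1)%:E)%E.
Proof.
move=> idK h0 h1.
have mphi : measurable_fun setT phi by exact: measurable_afft.
have hphi : has_mean (gauss_prob P.1 pP) (fun x => gain1 (phi x)) r1.
  by apply: (has_mean_pushforward mphi phi_push h1).
have h := has_meanD (has_mean_cst (gauss_prob P.1 pP) K)
  (has_meanD (has_meanZ (- t0) h0) (has_meanZ (- t1) hphi)).
have -> : K - t0 * r0 - t1 * r1 = K + (- t0 * r0 + - t1 * r1) by ring.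
apply: (W2sq_map_le mphi phi_push); apply: (has_mean_ext _ h) => x.
rewrite /= sqdistE /cst.
have aff (A : 'M[R]_d) (u v w : 'cV[R]_d) : A *m u + (v - A *m w) - v - A *m (u - w) = 0.
  by rewrite mulmxBr; move: (A *m u) (A *m w) => a b; apply/colP => i; rewrite !mxE; ring.
have := idK (col_of_tuple x) (col_of_tuple (phi x)).
rewrite -/(gain0 x) -/(gain1 (phi x)).
have -> : col_of_tuple (phi x) - Q.1 - L *m (col_of_tuple x - P.1) = 0.
  exact: (etrans (congr1 (fun z => z - _ - _) (col_afft _ _ _)) (aff _ _ _ _)).
rewrite quadf0; lra.
Qed.

Let KL0 (rho : probability (d.-tuple mR) R) r : has_mean rho gain0 r ->
  (r%:E <= KL rho (gaussm mu))%E.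
Proof.
move=> [hi hr]; rewrite -hr; apply: KL_ge_integral => //.
- exact: gaussT.
- exact: measurable_lnpdfB.
- exact: integral_exp_gauss_lnpdf.
Qed.

Let KL1 (rho : probability (d.-tuple mR) R) r : has_mean rho gain1 r ->
  (r%:E <= KL rho (gaussm nu))%E.
Proof.
move=> [hi hr]; rewrite -hr; apply: KL_ge_integral => //.
- exact: gaussT.
- exact: measurable_lnpdfB.
- exact: integral_exp_gauss_lnpdf.
Qed.

Lemma W2sq_ge0 (rho0 rho1 : probability (d.-tuple mR) R) : (0 <= W2sq rho0 rho1)%E.
Proof.
apply: le_ereal_inf_tmp => _ [g gc <-]; apply: integral_ge0 => z _.
by rewrite lee_fin sqdistE quadf1_ge0.
Qed.

(** K is the dual value. Competitors range over all probability measures, Gaussian or not;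
    uniqueness is recorded for the second marginal, the one that enters [moment_map]. *)
Lemma optimal_value : exists K r0 r1,
  [/\ has_mean (gauss_prob P.1 pP) gain0 r0, has_mean (gauss_prob Q.1 pQ) gain1 r1,
   KL (gauss_prob P.1 pP) (gaussm mu) = r0%:E /\
   KL (gauss_prob Q.1 pQ) (gaussm nu) = r1%:E,
   W2sq (gauss_prob P.1 pP) (gauss_prob Q.1 pQ) = (K - t0 * r0 - t1 * r1)%:E /\
   A_inf t0 t1 (gaussm mu) (gaussm nu) = K%:E &
   forall rho0 rho1, A_obj t0 t1 (gaussm mu) (gaussm nu) rho0 rho1 = K%:E ->
     forall A, measurable A -> rho1 A = gauss Q.1 Q.2 A].
Proof.
have [K idK] := opt_identity t0_gt0 t1_gt0 pmu pnu.
have [r0 h0] : exists r, has_mean (gauss_prob P.1 pP) gain0 r.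
  by apply: (gain_mean _ pmu _ pP); exact: gauss_second_moment.
have [r1 h1] : exists r, has_mean (gauss_prob Q.1 pQ) gain1 r.
  by apply: (gain_mean _ pnu _ pQ); exact: gauss_second_moment.
have k0 : KL (gauss_prob P.1 pP) (gaussm mu) = r0%:E.
  rewrite -h0.2; apply: KL_of_density.
  - exact: gaussT.
  - exact: measurable_lnpdfB.
  - exact: integral_exp_gauss_lnpdf.
  - exact: h0.1.
  - exact: gauss_density.
have k1 : KL (gauss_prob Q.1 pQ) (gaussm nu) = r1%:E.
  rewrite -h1.2; apply: KL_of_density.
  - exact: gaussT.
  - exact: measurable_lnpdfB.
  - exact: integral_exp_gauss_lnpdf.
  - exact: h1.1.
  - exact: gauss_density.
have w : W2sq (gauss_prob P.1 pP) (gauss_prob Q.1 pQ) = (K - t0 * r0 - t1 * r1)%:E.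
  apply/eqP; rewrite eq_le; apply/andP; split.
    exact: (W2sq_opt_le idK h0 h1).
  exact: (W2sq_lower_bound idK h0 h1).
have obj : A_obj t0 t1 (gaussm mu) (gaussm nu) (gauss_prob P.1 pP) (gauss_prob Q.1 pQ) = K%:E.
  by rewrite /A_obj k0 k1 w -!EFinM -!EFinD; congr EFin; ring.
(* Weak duality with remainder: each entropy exceeds the mean of its gain, and the weighted excesses
   bound the distance of the objective to K. Finiteness of the objective provides second moments,
   hence the means. *)
have low (rho0 rho1 : probability (d.-tuple mR) R) :
    (A_obj t0 t1 (gaussm mu) (gaussm nu) rho0 rho1 < +oo)%E ->
    exists s0 s1 c0 c1, [/\ has_mean rho0 gain0 s0 /\ has_mean rho1 gain1 s1,
      KL rho0 (gaussm mu) = c0%:E /\ KL rho1 (gaussm nu) = c1%:E, s0 <= c0 /\ s1 <= c1 &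
      ((K + t0 * (c0 - s0) + t1 * (c1 - s1))%:E <= A_obj t0 t1 (gaussm mu) (gaussm nu) rho0 rho1)%E].
  rewrite /A_obj.
  have := W2sq_ge0 rho0 rho1; have := KL_ge0 rho0 (gaussm mu); have := KL_ge0 rho1 (gaussm nu).
  move E0 : (KL rho0 (gaussm mu)) => e0; move E1 : (KL rho1 (gaussm nu)) => e1.
  move EW : (W2sq rho0 rho1) => eW.
  case: eW EW => [eW| |] EW //; case: e0 E0 => [e0| |] E0 //; case: e1 E1 => [e1| |] E1 //;
    rewrite ?gt0_muley ?lte_fin// ?addey// ?addye//= => _ _ _ oo.
  have m0 : second_moment rho0 by apply: (@KL_second_moment _ _ _ mu.1 _ pmu); rewrite [KL _ _]E0 ltry.
  have m1 : second_moment rho1 by apply: (@KL_second_moment _ _ _ nu.1 _ pnu); rewrite [KL _ _]E1 ltry.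
  have [s0 hs0] : exists r, has_mean rho0 gain0 r by exact: (gain_mean _ pmu _ pP).
  have [s1 hs1] : exists r, has_mean rho1 gain1 r by exact: (gain_mean _ pnu _ pQ).
  exists s0, s1, e0, e1; split => //.
    by have := KL0 hs0; have := KL1 hs1; rewrite E0 E1 !lee_fin.
  have := W2sq_lower_bound idK hs0 hs1; rewrite EW -!EFinM -!EFinD !lee_fin; lra.
have Kmin (rho0 rho1 : probability (d.-tuple mR) R) :
    (K%:E <= A_obj t0 t1 (gaussm mu) (gaussm nu) rho0 rho1)%E.
  have [oo|] := ltP (A_obj t0 t1 (gaussm mu) (gaussm nu) rho0 rho1) +oo%E; last first.
    by rewrite leye_eq => /eqP ->; exact: leey.
  have [s0 [s1 [c0 [c1 [_ _ [sc0 sc1]]]]]] := low _ _ oo.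
  by apply: le_trans; rewrite lee_fin -addrA lerDl addr_ge0// mulr_ge0 ?subr_ge0// ltW.
exists K, r0, r1; split => //.
- split => //; apply/eqP; rewrite eq_le; apply/andP; split.
    by rewrite -obj; apply: ereal_inf_lbound; exists (gauss_prob P.1 pP : probability _ _, gauss_prob Q.1 pQ : probability _ _).
  by apply: le_ereal_inf_tmp => _ [[rho0 rho1] _ <-].
- move=> rho0 rho1 objK A mA.
  have oo : (A_obj t0 t1 (gaussm mu) (gaussm nu) rho0 rho1 < +oo)%E by rewrite objK ltry.
  have [s0 [s1 [c0 [c1 [[hs0 hs1] [_ E1] [sc0 sc1]]]]]] := low _ _ oo.
  rewrite objK lee_fin => le.
  (* At the minimum both excesses vanish, and equality in the entropy bound prescribes the density
     of rho1. *)
  have c1E : c1 = s1.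
    have : t0 * (c0 - s0) >= 0 by rewrite mulr_ge0 ?subr_ge0// ltW.
    have : t1 * (c1 - s1) >= 0 by rewrite mulr_ge0 ?subr_ge0// ltW.
    move=> a b; have /eqP : t1 * (c1 - s1) = 0 by lra.
    by rewrite mulf_eq0 gt_eqF//= subr_eq0 => /eqP.
  have E1' : KL rho1 (gaussm nu) = (\int[rho1]_x (gain1 x)%:E)%E by rewrite E1 c1E hs1.2.
  have := @KL_eq_integral_density _ _ _ rho1 (gaussm nu) (gaussT _ pnu) gain1
    (measurable_lnpdfB _ _ _ _) (integral_exp_gauss_lnpdf _ _ pnu pQ) hs1.1 E1' A mA.
  by move=> ->; exact: (esym (gauss_density nu.1 Q.1 pnu pQ mA)).
Qed.

Lemma q_parE : q_par t0 t1 mu nu = Q.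
Proof.
have [K [r0 [r1 [h0 h1 [k0 k1] [w Ainf] uniq]]]] := optimal_value.
apply: xget_unique.
- split; first exact: pQ.
  exists (gauss_prob P.1 pP), (gauss_prob Q.1 pQ); split; last exact: (fun A _ => erefl).
  apply: (etrans _ (esym Ainf)).
  by rewrite /A_obj k0 k1 w -!EFinM -!EFinD; congr EFin; ring.
- move=> [v V] [/= pV [rho0 [rho1 [ismin rhoE]]]].
  rewrite /is_minimizer Ainf in ismin.
  apply: (etrans _ (esym (surjective_pairing Q))).
  apply: (gauss_inj pV pQ) => A mA.
  exact: (etrans (esym (rhoE A mA)) (uniq _ _ ismin A mA)).
Qed.

End minimizer.

Lemma A_val_upper {R : realType} {d : nat} (t0 t1 : R) (mu nu nu' : gpar R d) :
  0 < t0 -> 0 < t1 -> posdef mu.2 -> posdef nu.2 -> posdef nu'.2 ->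
  A_val t0 t1 mu nu' - A_val t0 t1 mu nu <=
  t1 * (cross_entropy (opt_q t0 t1 mu nu) nu' - cross_entropy (opt_q t0 t1 mu nu) nu).
Proof.
move=> t0_gt0 t1_gt0 pmu pnu pnu'.
have [K [r0 [r1 [h0 h1 [k0 k1] [w Ainf] _]]]] := optimal_value t0_gt0 t1_gt0 pmu pnu.
have [K' [_ [_ [_ _ _ [_ Ainf'] _]]]] := optimal_value t0_gt0 t1_gt0 pmu pnu'.
move: h0 h1 k0 k1 w; set pP := opt_p_gaussian _ _ _ _; set pQ := opt_q_gaussian _ _ _ _.
set P := opt_p _ _ _ _; set Q := opt_q _ _ _ _ => h0 h1 k0 k1 w.
have k1' := gauss_KL Q.1 nu'.1 pQ pnu'.
have k1'' := gauss_KL Q.1 nu.1 pQ pnu.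
rewrite -!surjective_pairing in k1' k1''.
have r1E : r1 = cross_entropy Q nu - (ln (\det Q.2) + d%:R) / 2.
  by have := etrans (esym k1) k1'' => -[].
have le : (A_inf t0 t1 (gaussm mu) (gaussm nu') <=
    A_obj t0 t1 (gaussm mu) (gaussm nu') (gauss_prob P.1 pP) (gauss_prob Q.1 pQ))%E.
  by apply: ereal_inf_lbound; exists (gauss_prob P.1 pP : probability _ _, gauss_prob Q.1 pQ : probability _ _).
have {}k1' : KL (gauss_prob Q.1 pQ) (gaussm nu') =
  (cross_entropy Q nu' - (ln (\det Q.2) + d%:R) / 2)%:E := k1'.
move: le; rewrite /A_obj k0 w k1' /A_val Ainf Ainf' -!EFinM -!EFinD lee_fin /= r1E.
by move: (_ / 2) => c; lra.
Qed.

(** * Differential calculus of matrix-valued maps *)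

Section differentials.
Context {R : realType} {V : normedModType R}.

(** Differentiability in epsilon form; with its converse [is_diff_approx] it lets the later
    arguments compare functions through inequalities. *)
Lemma is_diff_intro (W : normedModType R) (f df : V -> W) x :
  linear df -> continuous df ->
  (forall e, 0 < e -> \forall y \near x, `|f y - f x - df (y - x)| <= e * `|y - x|) ->
  is_diff x f df.
Proof.
move=> ldf cdf h.
pose M := GRing.isLinear.Build _ _ _ _ df ldf.
pose L : {linear V -> W} := HB.pack df M.
have E : f \o shift x = cst (f x) + (L : V -> W) +o_ 0 id.
  apply/eqaddoP => e e0; have := h e e0.
  rewrite (near_shift 0 x _) subr0; apply: filterS => y /=.
  rewrite addrK => h1; suff : `|f (y + x) - (f x + df y)| <= e * `|y| by [].
  by rewrite opprD addrA.
have D := diff_unique (cdf : continuous L) E.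
by apply: DiffDef => //; apply/diff_locallyP; rewrite D.
Qed.

Lemma is_diff_approx (W : normedModType R) (f df : V -> W) x : is_diff x f df ->
  forall e, 0 < e -> \forall y \near x, `|f y - f x - df (y - x)| <= e * `|y - x|.
Proof.
move=> [dfx <-] e e0.
have /diff_locally /eqaddoP /(_ e e0) H := dfx.
have {H} : \forall h \near 0, `|(f \o shift x - (cst (f x) + 'd f x)) h| <= e * `|h| := H.
rewrite (near_shift x 0 _) sub0r; apply: filterS => y /=.
move=> h1; have {h1} : `|f (y - x + x) - (f x + 'd f x (y - x))| <= e * `|y - x| := h1.
by rewrite opprD addrA subrK.
Qed.

Lemma is_diff_linear (W : normedModType R) (f df : V -> W) x : is_diff x f df -> linear df.
Proof. by move=> [dfx <-]; exact: linearP. Qed.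

Lemma is_diff_continuous (W : normedModType R) (f df : V -> W) x :
  is_diff x f df -> continuous df.
Proof. by move=> [dfx <-]; exact: diff_continuous. Qed.

Lemma is_diff_bound (W : normedModType R) (f df : V -> W) x : is_diff x f df ->
  exists2 C, 0 < C & forall h, `|df h| <= C * `|h|.
Proof. by move=> [dfx <-]; exact/linear_lipschitz/diff_continuous. Qed.

Lemma is_diff_cvg (W : normedModType R) (f df : V -> W) x :
  is_diff x f df -> f y @[y --> x] --> f x.
Proof. by move=> [dfx _]; exact: (differentiable_continuous dfx). Qed.

Lemma near_eq_is_diff (W : normedModType R) (f g df : V -> W) x :
  (\forall y \near x, f y = g y) -> is_diff x f df -> is_diff x g df.
Proof.
move=> fg dfx; apply: is_diff_intro.
- exact: is_diff_linear dfx.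
- exact: is_diff_continuous dfx.
move=> e e0; have := is_diff_approx dfx e0.
rewrite (nbhs_singleton fg); move: fg; apply: filterS2.
by move=> y ->.
Qed.

Lemma is_diff_ext (W : normedModType R) (f df dg : V -> W) x :
  df =1 dg -> is_diff x f df -> is_diff x f dg.
Proof. by move=> /funext ->. Qed.

(* The Caratheodory form of the product rule. *)
Lemma is_diff_mul0 (k g dg : V -> R) x : k y @[y --> x] --> k x ->
  is_diff x g dg -> g x = 0 -> is_diff x (fun y => k y * g y) (fun h => k x * dg h).
Proof.
move=> ck dgx gx0; apply: is_diff_intro.
- by move=> a u v; rewrite (is_diff_linear dgx) mulrDr -!scalerAr.
- by move=> u; apply: cvgM; [exact: cvg_cst|exact: (is_diff_continuous dgx)].
move=> e e0; have [C C0 hC] := is_diff_bound dgx.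
have e1 : 0 < e / (2 * (`|k x| + 1)) by rewrite divr_gt0// mulr_gt0// ltr_wpDl.
have e2 : 0 < e / (2 * C) by rewrite divr_gt0// mulr_gt0.
have := is_diff_approx dgx e1; rewrite gx0.
have /cvgrPdist_le /(_ _ e2) ck2 := ck.
have /cvgrPdist_le /(_ _ ltr01) ck1 := ck.
move: ck1 ck2; apply: filterS3 => y k1 k2 g1.
rewrite mulr0 !subr0 in g1 *.
have -> : k y * g y - k x * dg (y - x) = k y * (g y - dg (y - x)) - (k x - k y) * dg (y - x).
  by ring.
have ky : `|k y| <= `|k x| + 1.
  have := ler_normB (k x) (k x - k y); rewrite subKr => /le_trans; apply.
  by rewrite lerD2l.
apply: (le_trans (ler_normB _ _)); rewrite !normrM.
have h1 : `|k y| * `|g y - dg (y - x)| <= (`|k x| + 1) * (e / (2 * (`|k x| + 1)) * `|y - x|).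
  by apply: ler_pM.
have h2 : `|k x - k y| * `|dg (y - x)| <= e / (2 * C) * (C * `|y - x|).
  by apply: ler_pM.
apply: (le_trans (lerD h1 h2)); rewrite le_eqVlt; apply/orP; left; apply/eqP.
by field; rewrite !gt_eqF// ltr_wpDl.
Qed.

Lemma is_diff_squeeze (f l u D : V -> R) x : l x = 0 -> u x = 0 ->
  is_diff x l D -> is_diff x u D ->
  (\forall y \near x, l y <= f y - f x <= u y) -> is_diff x f D.
Proof.
move=> l0 u0 dl du h; apply: is_diff_intro.
- exact: is_diff_linear dl.
- exact: is_diff_continuous dl.
move=> e e0; have := is_diff_approx dl e0; have := is_diff_approx du e0.
rewrite l0 u0; move: h; apply: filterS3 => y /andP[ly uy].
by rewrite !subr0 !ler_norml => /andP[? ?] /andP[? ?]; apply/andP; split; lra.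
Qed.

Lemma is_diff_sum (W : normedModType R) n (f df : 'I_n -> V -> W) x :
  (forall i, is_diff x (f i) (df i)) ->
  is_diff x (fun y => \sum_i f i y) (fun h => \sum_i df i h).
Proof.
elim: n f df => [|n IH] f df h.
  have := is_diff_cst (0 : W) x; congr is_diff_def.
    by apply/funext => y; rewrite big_ord0.
  by apply/funext => y; rewrite big_ord0.
have := is_diffD (h ord0) (IH _ _ (fun i => h (lift ord0 i))); congr is_diff_def.
  by apply/funext => y; rewrite big_ord_recl.
by apply/funext => y; rewrite big_ord_recl.
Qed.

Lemma is_diff_chain (f df : V -> R) (g : R -> R) g' x : is_diff x f df ->
  is_derive (f x) 1 g g' -> is_diff x (fun y => g (f y)) (fun h => g' * df h).
Proof.
move=> dfx [dg gE].
have dg' : differentiable g (f x) by apply/derivable1_diffP.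
have dgx : is_diff (f x) g ('d g (f x)) by exact: differentiableP.
apply: (is_diff_eq (is_diff_comp dfx dgx)); apply/funext => h /=.
by rewrite (deriv1E dg) derive1E gE /= mulrC.
Qed.

End differentials.

(** * Matrix-valued maps *)

Section matrix_differentials.
Context {R : realType} {V : normedModType R}.

Lemma is_diff_mx m n (F dF : V -> 'M[R]_(m, n)) x :
  (forall i j, is_diff x (fun y => F y i j) (fun h => dF h i j)) -> is_diff x F dF.
Proof.
move=> h; apply: is_diff_intro.
- by move=> a u v; apply/matrixP => i j; rewrite (is_diff_linear (h i j)) !mxE.
- by move=> u; apply: cvg_mx => i j; exact: (is_diff_continuous (h i j)).
move=> e e0.
have : \forall y \near x, forall i j, `|F y i j - F x i j - dF (y - x) i j| <= e * `|y - x|.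
  by apply: filter_forall => i; apply: filter_forall => j; exact: (is_diff_approx (h i j) e0).
apply: filterS => y hy; rewrite [X in X <= _]mx_normrE.
apply: bigmax_le; first by rewrite mulr_ge0// ltW.
by move=> [i j] _; rewrite !mxE /=; exact: hy.
Qed.

Lemma is_diff_entry m n (F dF : V -> 'M[R]_(m, n)) x i j :
  is_diff x F dF -> is_diff x (fun y => F y i j) (fun h => dF h i j).
Proof.
move=> dFx; have le m' n' (A : 'M[R]_(m', n')) i' j' : `|A i' j'| <= `|A|.
  by rewrite [X in _ <= X]mx_normrE; exact: (@le_bigmax_cond _ _ _ 0 (i', j') xpredT (fun ij => `|A ij.1 ij.2|)).
apply: is_diff_intro.
- by move=> a u v; rewrite (is_diff_linear dFx) !mxE.
- by move=> u; apply: cvg_mxE; exact: (is_diff_continuous dFx).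
move=> e e0; apply: filterS (is_diff_approx dFx e0) => y.
by apply: le_trans; have := le _ _ (F y - F x - dF (y - x)) i j; rewrite !mxE.
Qed.

(** As in [is_diff_mul0], a factor multiplying one that vanishes at x need only be continuous. *)
Lemma is_diff_mulmxr0 m n p (G dG : V -> 'M[R]_(m, n)) (K : V -> 'M[R]_(n, p)) x :
  K y @[y --> x] --> K x -> is_diff x G dG -> G x = 0 ->
  is_diff x (fun y => G y *m K y) (fun h => dG h *m K x).
Proof.
move=> cK dGx G0; apply: is_diff_mx => i j.
have := @is_diff_sum _ _ R n (fun k y => K y k j * G y i k) (fun k h => K x k j * dG h i k) x.
rewrite (_ : (fun y => \sum__ _) = (fun y => (G y *m K y) i j)); last first.
  by apply/funext => y; rewrite !mxE; apply: eq_bigr => k _; rewrite mulrC.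
rewrite (_ : (fun y => \sum__ _) = (fun h => (dG h *m K x) i j)); last first.
  by apply/funext => y; rewrite !mxE; apply: eq_bigr => k _; rewrite mulrC.
apply=> k; apply: is_diff_mul0.
- exact: (cvg_mxE cK).
- exact: is_diff_entry.
- by rewrite G0 mxE.
Qed.

Lemma is_diff_tr m n (F dF : V -> 'M[R]_(m, n)) x : is_diff x F dF ->
  is_diff x (fun y => (F y)^T) (fun h => (dF h)^T).
Proof.
move=> h; apply: is_diff_mx => i j.
by have := is_diff_entry j i h; congr is_diff_def; apply/funext => y; rewrite mxE.
Qed.

Lemma is_diff_mulmxl0 m n p (G dG : V -> 'M[R]_(n, p)) (K : V -> 'M[R]_(m, n)) x :
  K y @[y --> x] --> K x -> is_diff x G dG -> G x = 0 ->
  is_diff x (fun y => K y *m G y) (fun h => K x *m dG h).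
Proof.
move=> cK dGx G0.
have cKT : (K y)^T @[y --> x] --> (K x)^T by exact: cvg_tr.
have GT0 : (G x)^T = 0 by rewrite G0 trmx0.
have := is_diff_tr (is_diff_mulmxr0 cKT (is_diff_tr dGx) GT0).
by congr is_diff_def; apply/funext => y; rewrite trmx_mul !trmxK.
Qed.

Lemma is_diff_mulmx m n p (F dF : V -> 'M[R]_(m, n)) (G dG : V -> 'M[R]_(n, p)) x :
  is_diff x F dF -> is_diff x G dG ->
  is_diff x (fun y => F y *m G y) (fun h => dF h *m G x + F x *m dG h).
Proof.
move=> dFx dGx.
(* F G = (F - F x) G + F x (G - G x) + F x G x, which reduces the claim to the two rules for
   vanishing factors. *)
have d1 : is_diff x (fun y => F y - F x) dF.
  by have := is_diffB dFx (is_diff_cst (F x) x); rewrite subr0.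
have d2 : is_diff x (fun y => G y - G x) dG.
  by have := is_diffB dGx (is_diff_cst (G x) x); rewrite subr0.
have c2 : F x @[y --> x] --> F x by exact: cvg_cst.
have h1 := is_diff_mulmxr0 (is_diff_cvg dGx) d1 (subrr _).
have h2 := is_diff_mulmxl0 c2 d2 (subrr _).
have := is_diffD (is_diffD h1 h2) (is_diff_cst (F x *m G x) x).
rewrite addr0; congr is_diff_def; apply/funext => y.
suff E : (F y - F x) *m G y + F x *m (G y - G x) + F x *m G x = F y *m G y by exact: E.
by rewrite mulmxBl mulmxBr -addrA !subrK.
Qed.

Lemma is_diff_trace n (F dF : V -> 'M[R]_n) x : is_diff x F dF ->
  is_diff x (fun y => \tr (F y)) (fun h => \tr (dF h)).
Proof. by move=> h; apply: is_diff_sum => i; exact: is_diff_entry. Qed.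

(** The resolvent identity F(y)^-1 = F(x)^-1 - F(y)^-1 (F(y) - F(x)) F(x)^-1 exhibits the increment
    as a vanishing differentiable factor between continuous ones. *)
Lemma is_diff_invmx n (F dF : V -> 'M[R]_n) x : F x \in unitmx ->
  (\forall y \near x, F y \in unitmx) -> is_diff x F dF ->
  is_diff x (fun y => invmx (F y)) (fun h => - (invmx (F x) *m dF h *m invmx (F x))).
Proof.
move=> ux uy dFx.
have d1 : is_diff x (fun y => F y - F x) dF.
  by have := is_diffB dFx (is_diff_cst (F x) x); rewrite subr0.
have c1 : invmx (F y) @[y --> x] --> invmx (F x).
  by apply: cvg_invmx => //; exact: is_diff_cvg dFx.
have c2 : invmx (F x) @[y --> x] --> invmx (F x) by exact: cvg_cst.
have h0 : invmx (F x) *m (F x - F x) = 0 by rewrite subrr mulmx0.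
have h1 := is_diff_mulmxr0 c2 (is_diff_mulmxl0 c1 d1 (subrr _)) h0.
have := is_diffB (is_diff_cst (invmx (F x)) x) h1.
rewrite sub0r; apply: near_eq_is_diff; move: uy; apply: filterS => y uy.
suff E : invmx (F x) - invmx (F y) *m (F y - F x) *m invmx (F x) = invmx (F y) by exact: E.
rewrite mulmxBr mulVmx// mulmxBl mul1mx -mulmxA mulmxV// mulmx1.
by rewrite subKr.
Qed.

End matrix_differentials.

(** * Regularity of the minimizer *)

Section bounded_limits.
Context {R : realType} {T : Type} {F : set_system T} {FF : Filter F}.

(** Meant for factors such as the Riccati solution, which are known to be bounded before they are
    known to converge. *)
Lemma cvg0_mulmx_bounded m n p (A : T -> 'M[R]_(m, n)) (N : T -> 'M[R]_(n, p)) (B : R) :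
  (\forall t \near F, forall i j, `|A t i j| <= B) -> N t @[t --> F] --> (0 : 'M[R]_(n, p)) ->
  A t *m N t @[t --> F] --> (0 : 'M[R]_(m, p)).
Proof.
move=> hA cN; apply: cvg_mx => i j.
rewrite (_ : (fun t => _) = (fun t => \sum_k A t i k * N t k j)); last first.
  by apply/funext => t; rewrite mxE.
have -> : (0 : 'M[R]_(m, p)) i j = \sum_(k < n) 0 by rewrite mxE big1.
apply: cvg_big => [|k _]; first by apply: add_continuous.
have cNk : N t k j @[t --> F] --> (0 : R).
  by rewrite (_ : 0 = (0 : 'M[R]_(n, p)) k j); [exact: cvg_mxE|rewrite mxE].
apply/cvgr0Pnorm_le => e e0.
have B0 : 0 < `|B| + 1 by rewrite ltr_wpDl.
have e1 : 0 < e / (`|B| + 1) by rewrite divr_gt0.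
have /cvgr0Pnorm_le /(_ _ e1) := cNk; move: hA; apply: filterS2 => t hA hN.
rewrite normrM; apply: (@le_trans _ _ ((`|B| + 1) * (e / (`|B| + 1)))).
  apply: ler_pM => //; apply: (le_trans (hA i k)).
  by apply: (le_trans (ler_norm B)); rewrite lerDl.
by rewrite mulrC divfK// gt_eqF.
Qed.

Lemma cvg0_mulmxr_bounded m n p (A : T -> 'M[R]_(n, p)) (N : T -> 'M[R]_(m, n)) (B : R) :
  (\forall t \near F, forall i j, `|A t i j| <= B) -> N t @[t --> F] --> (0 : 'M[R]_(m, n)) ->
  N t *m A t @[t --> F] --> (0 : 'M[R]_(m, p)).
Proof.
move=> hA cN.
have hAT : \forall t \near F, forall i j, `|(A t)^T i j| <= B.
  by apply: filterS hA => t hA i j; rewrite mxE.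
have := cvg_tr cN; rewrite trmx0 => /(_ FF) cNT.
have := cvg_tr (cvg0_mulmx_bounded hAT cNT); rewrite trmx0 => /(_ FF).
by under eq_fun do rewrite trmx_mul !trmxK.
Qed.

End bounded_limits.

(** * The Riccati solution as a function of the covariance *)

Section opt_map_regularity.
Context {R : realType} {d : nat}.
Variables (t0 t1 : R) (S0 : 'M[R]_d).
Hypotheses (t0_gt0 : 0 < t0) (t1_gt0 : 0 < t1) (pS0 : posdef S0).
Let c0 : 0 < 2 / t0. Proof. by rewrite divr_gt0. Qed.
Let c1 : 0 < 2 / t1. Proof. by rewrite divr_gt0. Qed.

Lemma precision_posdef t (S : 'M[R]_d) : 0 < t -> posdef S -> posdef (precision t S).
Proof.
move=> t_gt0 pS; apply: posdefD; first exact: posdef_inv.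
by apply: posdefZ; [rewrite divr_gt0|exact: posdef1].
Qed.

(** The increment L' M L' - L M L is exactly half of E M (L + L') + (L + L') M E, and the term k
    M^-1 in W absorbs k E. The difference of the two Riccati equations is therefore a Lyapunov
    equation for E without remainder. *)
Lemma lyapunov_identity (M M' M0 L L' : 'M[R]_d) k : M \in unitmx ->
  L *m M *m L + k *: L = M0 -> L' *m M' *m L' + k *: L' = M0 ->
  forall E W, E = L' - L -> W = L + L' + k *: invmx M ->
  2^-1 *: (E *m M *m W + W *m M *m E) = - (L' *m (M' - M) *m L').
Proof.
move=> uM h h' E W EE WE.
have kE : k *: E = L *m M *m L - L' *m M' *m L'.
  rewrite EE scalerBr; have -> : k *: L' = M0 - L' *m M' *m L' by rewrite -h' addrC addKr.
  have -> : k *: L = M0 - L *m M *m L by rewrite -h addrC addKr.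
  by rewrite opprB addrC addrA subrK.
have WM : E *m M *m W + W *m M *m E = 2 *: (L' *m M *m L' - L *m M *m L) + 2 *: (k *: E).
  have EMI : E *m M *m invmx M = E by rewrite mulmxK.
  have IME : invmx M *m M *m E = E by rewrite mulVmx// mul1mx.
  rewrite WE !(mulmxDr, mulmxDl) -!scalemxAr -!scalemxAl EMI IME.
  have EL X : E *m X = L' *m X - L *m X by rewrite EE mulmxBl.
  have LE X : X *m E = X *m L' - X *m L by rewrite EE mulmxBr.
  rewrite !EL !mulmxBl !LE.
  move: (L *m M *m L) (L' *m M *m L) (L *m M *m L') (L' *m M *m L') (k *: E) => a b a' b' e.
  by apply/matrixP => i j; rewrite !mxE; ring.
rewrite WM -scalerDr scalerA mulVf// scale1r kE mulmxBr mulmxBl.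
by rewrite addrA subrK opprB.
Qed.

Section pair.
Variables S S' : 'M[R]_d.
Hypotheses (pS : posdef S) (pS' : posdef S').
Let L := opt_map t0 t1 S0 S.
Let L' := opt_map t0 t1 S0 S'.
Let M := precision t1 S.
Let E := L' - L.

Definition lyap_weight : 'M[R]_d := L + L' + (2 / t0 - 2 / t1) *: invmx M.

Lemma opt_map_lyapunov :
  2^-1 *: (E *m M *m lyap_weight + lyap_weight *m M *m E) =
  - (L' *m (invmx S' - invmx S) *m L').
Proof.
have [_ h _ _] := opt_mapP t0_gt0 t1_gt0 pS0 pS.
have [_ h' _ _] := opt_mapP t0_gt0 t1_gt0 pS0 pS'.
have uM : M \in unitmx by exact/posdef_unit/precision_posdef.
rewrite (lyapunov_identity uM h h' erefl erefl); congr (- (_ *m _ *m _)).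
by rewrite /M /precision opprD addrACA subrr addr0.
Qed.

(** The coefficient 2 / t0 - 2 / t1 may be negative. The excess of the weight over (2 / t0) M^-1 is
    L' plus the matrix in the last clause of [opt_mapP], so that clause secures coercivity for all
    t0 and t1. *)
Lemma lyap_weight_posdef : posdef (lyap_weight - (2 / t0) *: invmx M).
Proof.
have [_ _ _ h] := opt_mapP t0_gt0 t1_gt0 pS0 pS.
have [p' _ _ _] := opt_mapP t0_gt0 t1_gt0 pS0 pS'.
rewrite (_ : _ - _ = L' + (L - (2 / t1) *: invmx M)); first exact: posdefD.
rewrite /lyap_weight -/L -/L' scalerBl.
move: L L' (_ *: _) (_ *: _) => a b u v.
by apply/matrixP => i j; rewrite !mxE; move: (a i j) (b i j) (u i j) (v i j) => ? ? ? ?; ring.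
Qed.

Lemma lyap_coercive (A : 'M[R]_d) : 2 / t0 * \tr (M *m A^T *m M *m A) <=
  \tr (M *m A^T *m M *m (2^-1 *: (A *m M *m lyap_weight + lyap_weight *m M *m A))).
Proof. by apply: lyapunov_coercive; [exact: precision_posdef|exact: lyap_weight_posdef]. Qed.

End pair.

Lemma posdef_frobenius_eq0 (M A : 'M[R]_d) : posdef M ->
  \tr (M *m A^T *m M *m A) <= 0 -> A = 0.
Proof.
move=> pM; have [N [pN <-]] := posdef_sqrt pM.
rewrite frobenius_eq0// => h; have uN := posdef_unit pN.
suff h0 : N *m A *m N = 0.
  by rewrite -(mulKmx uN A) -(mulmxK uN (N *m A)) h0 mul0mx mulmx0.
have g0 i : 0 <= \sum_j (N *m A *m N) i j ^+ 2 by apply: sumr_ge0 => j _; exact: sqr_ge0.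
have /eqP := le_anti (introT andP (conj h (sumr_ge0 _ (fun i _ => g0 i)))).
rewrite psumr_eq0// => /allP /= hi; apply/matrixP => i j.
have := hi i (mem_index_enum i); rewrite psumr_eq0; last by move=> k _; exact: sqr_ge0.
by move=> /allP /(_ j (mem_index_enum j)) /=; rewrite sqrf_eq0 => /eqP ->; rewrite mxE.
Qed.

(** Positivity of M0 - (2 / t0) L bounds the diagonal of L by that of M0, which does not involve S,
    and the diagonal controls the other entries. *)
Lemma opt_map_entry (S : 'M[R]_d) i j : posdef S ->
  `|opt_map t0 t1 S0 S i j| <= t0 * (\sum_k precision t0 S0 k k).
Proof.
move=> pS; have [pL _ h _] := opt_mapP t0_gt0 t1_gt0 pS0 pS.
set L := opt_map _ _ _ _; set M0 := precision t0 S0 in h *.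
have pM0 : posdef M0 by exact: precision_posdef.
have diag (A : 'M[R]_d) k : psdmx A -> 0 <= A k k.
  by move=> /(psdmx_entry k k); have := normr_ge0 (A k k); lra.
have dk k : L k k <= t0 / 2 * M0 k k.
  have := diag _ k (posdef_psd h); rewrite !mxE -/L.
  rewrite -(ler_pM2l (x := t0 / 2)) ?divr_gt0// mulr0 mulrBr mulrA.
  by rewrite (_ : t0 / 2 * (2 / t0) = 1) ?mul1r ?subr_ge0//; field; rewrite gt_eqF.
have dM k : M0 k k <= \sum_k M0 k k.
  by rewrite (bigD1 k)//= lerDl; apply: sumr_ge0 => l _; exact/diag/posdef_psd.
apply: (le_trans (psdmx_entry i j (posdef_psd pL))).
have h1 k : L k k <= t0 / 2 * \sum_k M0 k k.
  by apply: (le_trans (dk k)); rewrite ler_wpM2l// divr_ge0// ltW.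
have s0 : 0 <= \sum_k M0 k k by apply: sumr_ge0 => l _; exact/diag/posdef_psd.
have := h1 i; have := h1 j; have := mulr_ge0 (ltW t0_gt0) s0; lra.
Qed.

Lemma entry_le_sum m n (A : 'M[R]_(m, n)) i j : `|A i j| <= \sum_i \sum_j `|A i j|.
Proof.
rewrite (bigD1 i)//= (bigD1 j)//= -addrA lerDl; apply: addr_ge0.
  by apply: sumr_ge0.
by apply: sumr_ge0 => k _; apply: sumr_ge0.
Qed.

(** By coercivity the weighted norm of L' - L is bounded by a trace containing the increment N of
    the inverse covariance. N tends to 0 and all other factors are bounded by [opt_map_entry], so no
    compactness argument is needed. *)
Lemma cvg_opt_map (T : Type) (F : set_system T) {FF : Filter F} (S : T -> 'M[R]_d) S1 :
  posdef S1 -> (\forall t \near F, posdef (S t)) -> S t @[t --> F] --> S1 ->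
  opt_map t0 t1 S0 (S t) @[t --> F] --> opt_map t0 t1 S0 S1.
Proof.
move=> p1 pS cS.
set L := opt_map t0 t1 S0 S1; pose L' t := opt_map t0 t1 S0 (S t).
pose M := precision t1 S1; have pM : posdef M by exact: precision_posdef.
have [Q [pQ QM]] := posdef_sqrt pM; have uQ := posdef_unit pQ.
pose N t := invmx (S t) - invmx S1.
have cN : N t @[t --> F] --> (0 : 'M[R]_d).
  rewrite -(subrr (invmx S1)); apply: cvgB; last exact: cvg_cst.
  by apply: cvg_invmx => //; exact: posdef_unit.
have [B hB] : exists B, \forall t \near F, forall i j, `|L' t i j| <= B.
  by eexists; apply: filterS pS => t pt i j; exact: opt_map_entry.
have hE : \forall t \near F, forall i j, `|(L' t - L)^T i j| <= B + \sum_i \sum_j `|L i j|.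
  apply: filterS hB => t hB i j; rewrite !mxE; apply: (le_trans (ler_normB _ _)).
  by apply: lerD; [exact: hB|exact: (entry_le_sum L j i)].
have hM : \forall t \near F, forall i j, `|M i j| <= \sum_i \sum_j `|M i j|.
  by apply: filterE => _ i j; exact: (entry_le_sum M i j).
have c0' : M *m ((L' t - L)^T *m (M *m (L' t *m N t *m L' t))) @[t --> F] --> (0 : 'M[R]_d).
  apply: (cvg0_mulmx_bounded hM); apply: (cvg0_mulmx_bounded hE).
  apply: (cvg0_mulmx_bounded hM); apply: (cvg0_mulmxr_bounded hB).
  exact: (cvg0_mulmx_bounded hB).
have ct : \tr (M *m ((L' t - L)^T *m (M *m (L' t *m N t *m L' t)))) @[t --> F] --> (0 : R).
  by have := cvg_mxtrace c0'; rewrite mxtrace0 => /(_ FF).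
have bound : \forall t \near F, forall i j, (Q *m (L' t - L) *m Q) i j ^+ 2 <=
    t0 / 2 * `|\tr (M *m ((L' t - L)^T *m (M *m (L' t *m N t *m L' t))))|.
  apply: filterS pS => t pt i j.
  have trN (A : 'M[R]_d) : \tr (- A) = - \tr A by rewrite linearN.
  have := lyap_coercive p1 pt (L' t - L); rewrite opt_map_lyapunov// -/M -/(N t) -/(L' t).
  rewrite mulmxN trN => h; rewrite -!mulmxA in h.
  have e2 : \tr (M *m ((L' t - L)^T *m (M *m (L' t - L)))) =
      \sum_i \sum_j (Q *m (L' t - L) *m Q) i j ^+ 2.
    by rewrite -frobenius_eq0// QM !mulmxA.
  have sq : (Q *m (L' t - L) *m Q) i j ^+ 2 <= \tr (M *m ((L' t - L)^T *m (M *m (L' t - L)))).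
    rewrite e2 (bigD1 i)//= (bigD1 j)//= -addrA lerDl addr_ge0//.
      by apply: sumr_ge0 => k _; exact: sqr_ge0.
    by apply: sumr_ge0 => k _; apply: sumr_ge0 => l _; exact: sqr_ge0.
  apply: (le_trans sq); rewrite -(ler_pM2l c0) mulrA.
  rewrite (_ : 2 / t0 * (t0 / 2) = 1) ?mul1r; last by field; rewrite gt_eqF.
  by apply: (le_trans h); rewrite -!mulmxA -normrN; exact: ler_norm.
have cQ : Q *m (L' t - L) *m Q @[t --> F] --> (0 : 'M[R]_d).
  apply: cvg_mx => i j; rewrite mxE; apply/cvgr0Pnorm_le => e e0.
  have e1 : 0 < e ^+ 2 / (t0 / 2) by rewrite divr_gt0 ?exprn_gt0// divr_gt0.
  have /cvgr0Pnorm_le /(_ _ e1) := ct; move: bound; apply: filterS2 => t hb hc.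
  rewrite -(@ler_pXn2r _ 2) ?nnegrE ?normr_ge0 ?(ltW e0)// real_normK ?num_real//.
  apply: (le_trans (hb i j)); by rewrite mulrC -ler_pdivlMr// divr_gt0.
have cc (A : 'M[R]_d) : A @[t --> F] --> A by exact: cvg_cst.
have : invmx Q *m (Q *m (L' t - L) *m Q) *m invmx Q @[t --> F] --> invmx Q *m 0 *m invmx Q.
  by apply: cvg_mulmx; [apply: cvg_mulmx; [exact: cc|exact: cQ]|exact: cc].
rewrite mulmx0 mul0mx (_ : (fun t => _) = (fun t => L' t - L)); last first.
  by apply/funext => t; rewrite -(mulmxA _ _ Q) mulKmx// mulmxK.
move=> h; rewrite -(add0r L) (_ : (fun t => _) = (fun t => L' t - L + L)); last first.
  by apply/funext => t; rewrite subrK.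
exact: (cvgD h (cc L)).
Qed.

Definition lyap_op (M W A : 'M[R]_d) : 'M[R]_d := 2^-1 *: (A *m M *m W + W *m M *m A).

Lemma lyap_op_linear M W : linear (lyap_op M W).
Proof.
move=> k A A'; rewrite /lyap_op !mulmxDl mulmxDr -!scalemxAl -scalemxAr.
move: (A *m M *m W) (A' *m M *m W) (W *m M *m A) (W *m M *m A') => a b u v.
by apply/matrixP => i j; rewrite !mxE; move: (a i j) (b i j) (u i j) (v i j) => ? ? ? ?; ring.
Qed.

HB.instance Definition _ M W :=
  GRing.isLinear.Build R 'M[R]_d 'M[R]_d *:%R (lyap_op M W) (lyap_op_linear M W).

Lemma cvg_lyap_op (T : Type) (F : set_system T) {FF : Filter F} M (W : T -> 'M[R]_d) W1 :
  W t @[t --> F] --> W1 -> lin_mx (lyap_op M (W t)) @[t --> F] --> lin_mx (lyap_op M W1).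
Proof.
move=> cW; apply: cvg_mx => i j; rewrite mxE.
under eq_fun do rewrite mxE.
case/mxvec_indexP: j => k l; rewrite /= mxvecE.
under eq_fun do rewrite /= mxvecE.
apply: cvg_mxE; rewrite /lyap_op; apply: cvgZl_tmp; apply: cvgD.
  by apply: cvg_mulmx => //; exact: cvg_cst.
by apply: cvg_mulmx; [apply: cvg_mulmx => //; exact: cvg_cst|exact: cvg_cst].
Qed.

(** Coercivity makes the operator injective, hence invertible in finite dimension. *)
Lemma lyap_op_unit (S S' : 'M[R]_d) : posdef S -> posdef S' ->
  lin_mx (lyap_op (precision t1 S) (lyap_weight S S')) \in unitmx.
Proof.
move=> pS pS'; rewrite -row_free_unit; apply: inj_row_free => v.
rewrite -[v]vec_mxK mul_vec_lin /= => /(congr1 vec_mx); rewrite mxvecK linear0.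
set A := vec_mx v => A0; rewrite (@posdef_frobenius_eq0 (precision t1 S) A) ?linear0//.
  exact: precision_posdef.
have := lyap_coercive pS pS' A; rewrite -[2^-1 *: _]/(lyap_op _ _ A) A0 mulmx0 mxtrace0.
by rewrite pmulr_rle0.
Qed.

(** Inverting the Lyapunov operator expresses L(x) - L(y) through L(y) N(y) L(y). N is
    differentiable and vanishes at x, while L and the inverse operator are continuous, so the
    product rule for vanishing factors applies. *)
Lemma differentiable_opt_map (V : normedModType R) (S : V -> 'M[R]_d) x :
  (\forall y \near x, posdef (S y)) -> differentiable S x ->
  differentiable (fun y => opt_map t0 t1 S0 (S y)) x.
Proof.
move=> pS dS.
have pSx : posdef (S x) := nbhs_singleton pS.
have cS : S y @[y --> x] --> S x by exact: (differentiable_continuous dS).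
have cL : opt_map t0 t1 S0 (S y) @[y --> x] --> opt_map t0 t1 S0 (S x).
  exact: cvg_opt_map.
pose L' y := opt_map t0 t1 S0 (S y).
pose N y := invmx (S y) - invmx (S x).
have dN : is_diff x N (fun h => - (invmx (S x) *m 'd S x h *m invmx (S x))).
  have uy : \forall y \near x, S y \in unitmx.
    by apply: filterS pS => y; exact: posdef_unit.
  have dI := is_diff_invmx (posdef_unit pSx) uy (differentiableP dS).
  by have := is_diffB dI (is_diff_cst (invmx (S x)) x); rewrite subr0.
have N0 : N x = 0 by rewrite /N subrr.
have dG0 := is_diff_mulmxl0 cL dN N0.
have G0 : opt_map t0 t1 S0 (S x) *m N x = 0 by rewrite N0 mulmx0.
have [dg dG] : exists dg, is_diff x (fun y => L' y *m N y *m L' y) dg.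
  by eexists; exact: (is_diff_mulmxr0 cL dG0 G0).
have dV : is_diff x (fun y => mxvec (L' y *m N y *m L' y)) (fun h => mxvec (dg h)).
  apply: is_diff_mx => i j; case/mxvec_indexP: j => k l; rewrite (ord1 i).
  have := is_diff_entry k l dG; congr is_diff_def; apply/funext => y; by rewrite mxvecE.
have V0 : mxvec (L' x *m N x *m L' x) = 0 by rewrite G0 mul0mx linear0.
(* As a matrix acting on vectorized matrices the operator falls under [cvg_invmx]; it depends on y
   through the weight only. *)
have cLam : invmx (lin_mx (lyap_op (precision t1 (S x)) (lyap_weight (S x) (S y)))) @[y --> x] -->
    invmx (lin_mx (lyap_op (precision t1 (S x)) (lyap_weight (S x) (S x)))).
  apply: cvg_invmx; first exact: lyap_op_unit.
  apply: cvg_lyap_op; rewrite /lyap_weight; apply: cvgD; last exact: cvg_cst.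
  by apply: cvgD; [exact: cvg_cst|exact: cL].
have [de dE] := ex_intro (fun de => is_diff x _ de) _ (is_diff_mulmxr0 cLam dV V0).
have dE' : is_diff x (fun y => L' x - L' y) (fun h => vec_mx (de h)).
  apply: is_diff_mx => i j.
  have := is_diff_entry 0 (mxvec_index i j) dE.
  rewrite (_ : (fun h => de h 0 _) = (fun h => vec_mx (de h) i j)); last first.
    by apply/funext => h; rewrite mxE.
  apply: near_eq_is_diff; apply: filterS pS => y py.
  have := opt_map_lyapunov pSx py; rewrite -[LHS]/(lyap_op _ _ _) => h.
  have h2 : lyap_op (precision t1 (S x)) (lyap_weight (S x) (S y)) (L' x - L' y) = L' y *m N y *m L' y.
    have lN A : lyap_op (precision t1 (S x)) (lyap_weight (S x) (S y)) (- A) =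
      - lyap_op (precision t1 (S x)) (lyap_weight (S x) (S y)) A by rewrite linearN.
    by rewrite -(opprB (L' y)) lN h opprK.
  by rewrite -h2 -mul_vec_lin mulmxK ?lyap_op_unit// mxvecE.
have := is_diffB (is_diff_cst (L' x) x) dE'.
rewrite (_ : _ - _ = L'); last first.
  by apply/funext => y; suff : L' x - (L' x - L' y) = L' y by []; rewrite subKr.
by move=> [].
Qed.

End opt_map_regularity.

(** * Closure rules for differentiability *)

Section differentiable_combinators.
Context {R : realType} {V : normedModType R}.

Lemma differentiable_add (W : normedModType R) (f g : V -> W) x :
  differentiable f x -> differentiable g x -> differentiable (fun y => f y + g y) x.
Proof. exact: differentiableD. Qed.

Lemma differentiable_sub (W : normedModType R) (f g : V -> W) x :
  differentiable f x -> differentiable g x -> differentiable (fun y => f y - g y) x.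
Proof. exact: differentiableB. Qed.

Lemma differentiable_scale (W : normedModType R) (f : V -> W) k x :
  differentiable f x -> differentiable (fun y => k *: f y) x.
Proof. exact: differentiableZ. Qed.

Lemma differentiable_scaler m n (k : V -> R) (F : V -> 'M[R]_(m, n)) x :
  differentiable k x -> differentiable F x -> differentiable (fun y => k y *: F y) x.
Proof.
move=> dk dF.
suff [] : is_diff x (fun y => k y *: F y) (fun h => k x *: 'd F x h + 'd k x h *: F x) by [].
apply: is_diff_mx => i j.
have := is_diffM (differentiableP dk) (is_diff_entry i j (differentiableP dF)).
congr is_diff_def; apply/funext => y; rewrite !mxE//.
by rewrite [_ * F x i j]mulrC.
Qed.

Lemma differentiable_mulmx m n p (F : V -> 'M[R]_(m, n)) (G : V -> 'M[R]_(n, p)) x :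
  differentiable F x -> differentiable G x -> differentiable (fun y => F y *m G y) x.
Proof. by move=> dF dG; have [] := is_diff_mulmx (differentiableP dF) (differentiableP dG). Qed.

Lemma differentiable_trmx m n (F : V -> 'M[R]_(m, n)) x :
  differentiable F x -> differentiable (fun y => (F y)^T) x.
Proof. by move=> dF; have [] := is_diff_tr (differentiableP dF). Qed.

Lemma differentiable_invmx n (F : V -> 'M[R]_n) x :
  (\forall y \near x, F y \in unitmx) -> differentiable F x ->
  differentiable (fun y => invmx (F y)) x.
Proof.
by move=> uF dF; have [] := is_diff_invmx (nbhs_singleton uF) uF (differentiableP dF).
Qed.

Lemma differentiable_sumf (W : normedModType R) n (f : 'I_n -> V -> W) x :
  (forall i, differentiable (f i) x) -> differentiable (fun y => \sum_i f i y) x.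
Proof. by move=> h; have [] := is_diff_sum (fun i => differentiableP (h i)). Qed.

End differentiable_combinators.

(** * Derivatives of the value and of the minimizer *)

Section value_derivative.
Context {R : realType} {d : nat} {V : normedModType R}.
Implicit Types (mu nu q : gpar R d).

(* Up to a factor, the Fisher-Rao gradient of [cross_entropy q] at [nu]. *)
Definition gauss_score q nu : gpar R d :=
  (q.1 - nu.1, q.2 + (q.1 - nu.1) *m (q.1 - nu.1)^T - nu.2).

Variables (x : V) (m dm : V -> 'cV[R]_d) (S dS : V -> 'M[R]_d).
Hypotheses (pS : \forall y \near x, posdef (S y)).
Hypotheses (dmx : is_diff x m dm) (dSx : is_diff x S dS).

Let cm : m y @[y --> x] --> m x. Proof. exact: is_diff_cvg dmx. Qed.
Let cS : S y @[y --> x] --> S x. Proof. exact: is_diff_cvg dSx. Qed.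
Let pSx : posdef (S x) := nbhs_singleton pS.

Lemma near_posdef_unit : \forall y \near x, S y \in unitmx.
Proof. by apply: filterS pS => y; exact: posdef_unit. Qed.

(** The common shape of the two envelope bounds, up to the factor t1 / 2. Every term has a factor
    vanishing at x, so P, C, a and b enter the derivative only through their limits, and both bounds
    get the same derivative. *)
Lemma is_diff_cross (P C : V -> 'M[R]_d) (a b : V -> 'cV[R]_d) (u : 'cV[R]_d) (K : 'M[R]_d) :
  P y @[y --> x] --> invmx (S x) -> C y @[y --> x] --> K ->
  a y @[y --> x] --> u -> b y @[y --> x] --> u ->
  P x = invmx (S x) -> C x = K -> a x = u -> b x = u ->
  is_diff x (fun y => \tr (P y *m (S y - S x)) + \tr ((invmx (S y) - invmx (S x)) *m C y)
      - \tr (invmx (S x) *m ((m y - m x) *m (a y)^T + b y *m (m y - m x)^T)))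
    (fun h => - 2 * fisher_rao (m x, S x) (u, K - S x) (dm h, dS h)).
Proof.
move=> cP cC ca cb Px Cx ax bx.
have dS1 : is_diff x (fun y => S y - S x) dS.
  by have := is_diffB dSx (is_diff_cst (S x) x); rewrite subr0.
have dm1 : is_diff x (fun y => m y - m x) dm.
  by have := is_diffB dmx (is_diff_cst (m x) x); rewrite subr0.
have dI : is_diff x (fun y => invmx (S y) - invmx (S x)) (fun h => - (invmx (S x) *m dS h *m invmx (S x))).
  have dI := is_diff_invmx (posdef_unit pSx) near_posdef_unit dSx.
  by have := is_diffB dI (is_diff_cst (invmx (S x)) x); rewrite subr0.
rewrite -Px in cP; rewrite -Cx in cC; rewrite -ax in ca; rewrite -bx in cb.
have h1 := is_diff_trace (is_diff_mulmxl0 cP dS1 (subrr _)).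
have h2 := is_diff_trace (is_diff_mulmxr0 cC dI (subrr _)).
have caT : (a y)^T @[y --> x] --> (a x)^T by exact: cvg_tr.
have h3 := is_diff_mulmxr0 caT dm1 (subrr _).
have tm0 : (m x - m x)^T = 0 by rewrite subrr trmx0.
have h4 := is_diff_mulmxl0 cb (is_diff_tr dm1) tm0.
have cI : invmx (S x) @[y --> x] --> invmx (S x) by exact: cvg_cst.
have z5 : (m x - m x) *m (a x)^T + b x *m (m x - m x)^T = 0 by rewrite subrr mul0mx trmx0 mulmx0 addr0.
have h5 := is_diff_trace (is_diff_mulmxl0 cI (is_diffD h3 h4) z5).
have h := is_diffB (is_diffD h1 h2) h5.
apply: (is_diff_ext _ h) => v {h h1 h2 h3 h4 h5}.
rewrite Px Cx ax bx /fisher_rao /=.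
suff E : \tr (invmx (S x) *m dS v) + \tr (- (invmx (S x) *m dS v *m invmx (S x)) *m K) -
   \tr (invmx (S x) *m (dm v *m u^T + u *m (dm v)^T)) =
   -2 * ((u^T *m invmx (S x) *m dm v) 0 0 + \tr (invmx (S x) *m (K - S x) *m invmx (S x) *m dS v) / 2) by exact: E.
have sI := trmx_posdef_inv pSx.1; have uS := posdef_unit pSx.
have t1 : \tr (invmx (S x) *m (dm v *m u^T)) = (u^T *m invmx (S x) *m dm v) 0 0.
  by rewrite mulmxA mxtrace_mulC mulmxA [LHS]big_ord1.
have t2 : \tr (invmx (S x) *m (u *m (dm v)^T)) = (u^T *m invmx (S x) *m dm v) 0 0.
  rewrite mulmxA mxtrace_mulC mulmxA [LHS]big_ord1.
  exact: (bilf_sym (dm v) u sI).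
have t3 : \tr (invmx (S x) *m (K - S x) *m invmx (S x) *m dS v) =
    \tr (invmx (S x) *m dS v *m invmx (S x) *m K) - \tr (invmx (S x) *m dS v).
  rewrite mulmxBr mulVmx// !mulmxBl mul1mx linearB /=; congr (_ - _).
  by rewrite -(mulmxA _ _ (dS v)) mxtrace_mulC !mulmxA.
rewrite mulmxDr linearD /= t1 t2 t3 mulNmx linearN /=.
by move: (\tr _) (\tr _) (_ 0 0) => p q r; field.
Qed.

(* The envelope theorem: [f] is trapped between two functions with the same
   derivative at [x]. *)
Lemma is_diff_envelope (t1 : R) (f : V -> R) (v : V -> 'cV[R]_d) (Q : V -> 'M[R]_d) :
  0 < t1 -> v y @[y --> x] --> v x -> Q y @[y --> x] --> Q x ->
  (\forall y \near x, f y - f x <= t1 * (cross_entropy (v x, Q x) (m y, S y) -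
     cross_entropy (v x, Q x) (m x, S x))) ->
  (\forall y \near x, f x - f y <= t1 * (cross_entropy (v y, Q y) (m x, S x) -
     cross_entropy (v y, Q y) (m y, S y))) ->
  is_diff x f
    (fun h => - t1 * fisher_rao (m x, S x) (gauss_score (v x, Q x) (m x, S x)) (dm h, dS h)).
Proof.
move=> t1_gt0 cv cQ upper lower.
have cst1 (W : normedModType R) (w : W) : w @[y --> x] --> w by exact: cvg_cst.
have cI : invmx (S y) @[y --> x] --> invmx (S x) by apply: cvg_invmx => //; exact: posdef_unit.
pose u := v x - m x; pose K := Q x + u *m u^T.
have cau : v x - m y @[y --> x] --> u by exact: (cvgB (cst1 _ _) cm).
have cal : v y - m y @[y --> x] --> u by exact: (cvgB cv cm).
have cbl : v y - m x @[y --> x] --> u by exact: (cvgB cv (cst1 _ _)).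
have cCu : Q x + (v x - m y) *m (v x - m y)^T @[y --> x] --> K.
  by apply: cvgD; [exact: cst1|apply: cvg_mulmx; [exact: cau|exact: cvg_tr]].
have cCl : Q y + (v y - m y) *m (v y - m y)^T @[y --> x] --> K.
  by apply: cvgD => //; apply: cvg_mulmx; [exact: cal|exact: cvg_tr].
have du := is_diff_cross (cst1 _ (invmx (S x))) cCu cau (cst1 _ u) erefl erefl erefl erefl.
have dl := is_diff_cross cI cCl cal cbl erefl erefl erefl erefl.
have {}du := is_diffZ (t1 / 2) du; have {}dl := is_diffZ (t1 / 2) dl.
have ext : (t1 / 2) *: (fun h => - 2 * fisher_rao (m x, S x) (u, K - S x) (dm h, dS h)) =1
    (fun h => - t1 * fisher_rao (m x, S x) (gauss_score (v x, Q x) (m x, S x)) (dm h, dS h)).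
  move=> h; suff E : t1 / 2 * (- 2 * fisher_rao (m x, S x) (u, K - S x) (dm h, dS h)) =
    - t1 * fisher_rao (m x, S x) (u, K - S x) (dm h, dS h) by exact: E.
  by move: (fisher_rao _ _ _) => g; field.
have z0 (P C : 'M[R]_d) (a b : 'cV[R]_d) : t1 / 2 * (\tr (P *m (S x - S x)) +
    \tr ((invmx (S x) - invmx (S x)) *m C) -
    \tr (invmx (S x) *m ((m x - m x) *m a^T + b *m (m x - m x)^T))) = 0.
  by rewrite !subrr mulmx0 !mul0mx trmx0 mulmx0 addr0 mulmx0 !mxtrace0 addr0 subr0 mulr0.
apply: (is_diff_squeeze _ _ (is_diff_ext ext dl) (is_diff_ext ext du)); [exact: z0|exact: z0|].
(* The change of the trace term of [cross_entropy], separated into the change of the precision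
   matrix and that of the mean, in the shape required by [is_diff_cross]. *)
have key (p k : 'cV[R]_d) (C : 'M[R]_d) (m' : 'cV[R]_d) (J J' : 'M[R]_d) :
    \tr (J' *m (C + (p - m') *m (p - m')^T)) - \tr (J *m (C + (p - k) *m (p - k)^T)) =
    \tr ((J' - J) *m (C + (p - m') *m (p - m')^T)) -
    \tr (J *m ((m' - k) *m (p - m')^T + (p - k) *m (m' - k)^T)).
  have -> : C + (p - k) *m (p - k)^T = C + (p - m') *m (p - m')^T +
      ((m' - k) *m (p - m')^T + (p - k) *m (m' - k)^T).
    have sq (w z : 'cV[R]_d) : (w + z) *m (w + z)^T = w *m w^T + (z *m w^T + (w + z) *m z^T).
      by apply/matrixP => i j; rewrite !mxE !big_ord1 !mxE; ring.
    have -> : p - k = (p - m') + (m' - k) by rewrite addrA subrK.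
    by rewrite sq addrA.
  move: (C + _) ((m' - k) *m _ + _) => X Y.
  have trD (A B : 'M[R]_d) : \tr (A + B) = \tr A + \tr B by rewrite linearD.
  have trB (A B : 'M[R]_d) : \tr (A - B) = \tr A - \tr B by rewrite linearB.
  by rewrite mulmxDr mulmxBl trD trB opprD addrA.
move: upper lower pS; apply: filterS3 => y up lo py.
(* Concavity of ln det, used from either endpoint, replaces the difference of log-determinants by a
   trace: one version serves the upper bound, the other the lower. *)
have lu := ln_det_le pSx py; have ll := ln_det_le py pSx.
apply/andP; split.
  suff E : t1 / 2 * (\tr (invmx (S y) *m (S y - S x)) + \tr ((invmx (S y) - invmx (S x)) *m
       (Q y + (v y - m y) *m (v y - m y)^T)) -
     \tr (invmx (S x) *m ((m y - m x) *m (v y - m y)^T + (v y - m x) *m (m y - m x)^T)))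
     <= f y - f x by exact: E.
  rewrite -addrA -key; rewrite /cross_entropy /= -mulrBl in lo.
  have trN : \tr (invmx (S y) *m (S x - S y)) = - \tr (invmx (S y) *m (S y - S x)).
    by rewrite -opprB mulmxN linearN.
  rewrite trN in ll; move: lo ll.
  move: (\tr _) (\tr _) (\tr _) (ln _) (ln _) => A B C D E lo ll.
  rewrite -lerN2 opprB; apply: (le_trans lo).
  have h1 : 0 <= D - E - A by lra.
  have := mulr_ge0 (ltW t1_gt0) h1; lra.
suff E : f y - f x <= t1 / 2 * (\tr (invmx (S x) *m (S y - S x)) + \tr ((invmx (S y) - invmx (S x)) *m
       (Q x + (v x - m y) *m (v x - m y)^T)) -
     \tr (invmx (S x) *m ((m y - m x) *m (v x - m y)^T + (v x - m x) *m (m y - m x)^T))) by exact: E.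
rewrite -addrA -key; rewrite /cross_entropy /= -mulrBl in up.
apply: (le_trans up); move: lu.
move: (\tr _) (\tr _) (\tr _) (ln _) (ln _) => A B C D E lu.
have h1 : 0 <= C - (E - D) by lra.
have := mulr_ge0 (ltW t1_gt0) h1; lra.
Qed.

Variables (t0 t1 : R) (mu : gpar R d).
Hypotheses (t0_gt0 : 0 < t0) (t1_gt0 : 0 < t1) (pmu : posdef mu.2).
Let q y := opt_q t0 t1 mu (m y, S y).

Lemma differentiable_opt_q1 : differentiable (fun y => (q y).1) x.
Proof.
have [dm' _] := dmx; have [dS' _] := dSx.
apply: differentiable_add => //; apply: differentiable_scale.
apply: differentiable_mulmx => //; apply: differentiable_mulmx; last first.
  by apply: differentiable_sub => //; exact: differentiable_cst.
apply: differentiable_invmx.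
  apply: filterS pS => y py; apply: posdef_unit.
  apply: posdefD; first apply: posdefD; first exact: posdef1.
    by apply: posdefZ => //; rewrite divr_gt0.
  by apply: posdefZ => //; rewrite divr_gt0.
apply: differentiable_add; first exact: differentiable_cst.
exact: differentiable_scale.
Qed.

Lemma differentiable_opt_q2 : differentiable (fun y => (q y).2) x.
Proof.
have [dm' _] := dmx; have [dS' _] := dSx.
apply: differentiable_invmx.
  by apply: filterS pS => y py; exact/posdef_unit/opt_q_precision_posdef.
apply: differentiable_sub.
  apply: differentiable_add; last exact: differentiable_cst.
  by apply: differentiable_invmx => //; exact: near_posdef_unit.
apply: differentiable_scale; apply: differentiable_invmx.
  by apply: filterS pS => y py; apply: posdef_unit; have [] := opt_mapP t0_gt0 t1_gt0 pmu py.
exact: differentiable_opt_map.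
Qed.

Lemma is_diff_A_val : is_diff x (fun y => A_val t0 t1 mu (m y, S y))
  (fun h => - t1 * fisher_rao (m x, S x) (gauss_score (q x) (m x, S x)) (dm h, dS h)).
Proof.
have cq1 : (q y).1 @[y --> x] --> (q x).1 by exact: differentiable_continuous differentiable_opt_q1.
have cq2 : (q y).2 @[y --> x] --> (q x).2 by exact: differentiable_continuous differentiable_opt_q2.
have h := @is_diff_envelope t1 (fun y => A_val t0 t1 mu (m y, S y)) _ _ t1_gt0 cq1 cq2.
apply: h; apply: filterS pS => y py; rewrite -surjective_pairing; exact: A_val_upper.
Qed.

End value_derivative.

(** * The gradient of the barycenter functional *)

Section fisher_rao_form.
Context {R : realType} {d : nat}.
Implicit Types (nu u w : gpar R d).

Lemma fisher_raoE nu u w : fisher_rao nu u w =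
  bilf (invmx nu.2) u.1 w.1 + \tr (invmx nu.2 *m u.2 *m invmx nu.2 *m w.2) / 2.
Proof. by []. Qed.

Lemma fisher_rao_suml nu n (c : 'I_n -> R) (u : 'I_n -> gpar R d) w :
  fisher_rao nu (\sum_i c i *: (u i).1, \sum_i c i *: (u i).2) w =
  \sum_i c i * fisher_rao nu (u i) w.
Proof.
have trS (A : 'I_n -> 'M[R]_d) : \tr (\sum_i A i) = \sum_i \tr (A i).
  exact: (big_morph _ (fun A B => mxtraceD A B) (mxtrace0 _ _)).
rewrite fisher_raoE /= [X in _ + X / 2](_ : _ =
    \sum_i c i * \tr (invmx nu.2 *m (u i).2 *m invmx nu.2 *m w.2)); last first.
  rewrite mulmx_sumr !mulmx_suml trS; apply: eq_bigr => i _.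
  by rewrite -scalemxAr -!scalemxAl mxtraceZ.
have -> : bilf (invmx nu.2) (\sum_i c i *: (u i).1) w.1 =
    \sum_i c i * bilf (invmx nu.2) (u i).1 w.1.
  have s0 := bilf0l (invmx nu.2) w.1.
  rewrite (big_morph (fun z => bilf (invmx nu.2) z w.1) (fun a b => bilfDl _ a b _) s0).
  by apply: eq_bigr => i _; rewrite bilfZl.
rewrite mulr_suml -big_split; apply: eq_bigr => i _ /=.
by rewrite fisher_raoE mulrDr mulrA.
Qed.

Lemma fisher_raoZl nu c u w : fisher_rao nu (c *: u.1, c *: u.2) w = c * fisher_rao nu u w.
Proof.
have := fisher_rao_suml nu (fun _ : 'I_1 => c) (fun _ => u) w.
by rewrite !big_ord1.
Qed.

Lemma fisher_raoC nu u w : (nu.2)^T = nu.2 -> fisher_rao nu u w = fisher_rao nu w u.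
Proof.
move=> sS; have sI := trmx_posdef_inv sS; rewrite !fisher_raoE (bilf_sym _ _ sI).
congr (_ + _ / 2).
by rewrite -(mulmxA _ _ (w.2)) mxtrace_mulC !mulmxA.
Qed.

(* The Fisher-Rao square is a sum of squares, written in terms of the inverse
   square root of the covariance. *)
Lemma fisher_rao_gt0 nu u : posdef nu.2 -> (u.2)^T = u.2 -> u != 0 ->
  0 < fisher_rao nu u u.
Proof.
move=> pS su u0; have pI := posdef_inv pS.
have h1 : 0 <= bilf (invmx nu.2) u.1 u.1 by rewrite -quadfE; exact: (posdef_psd pI).2.
have h2 : 0 <= \tr (invmx nu.2 *m u.2 *m invmx nu.2 *m u.2).
  have := frobenius_eq0 u.2; have [N [pN NI]] := posdef_sqrt pI.
  move=> /(_ N pN); rewrite NI su => ->.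
  by apply: sumr_ge0 => i _; apply: sumr_ge0 => j _; exact: sqr_ge0.
rewrite fisher_raoE lt_neqAle addr_ge0 ?divr_ge0// andbT eq_sym.
apply: contraNneq u0; move/eqP; rewrite paddr_eq0 ?divr_ge0// => /andP[/eqP e1 /eqP e2].
have u20 : u.2 = 0.
  by apply: (posdef_frobenius_eq0 pI); rewrite su; move: e2; lra.
have u10 : u.1 = 0.
  apply/eqP; apply: contraT => n0; have := pI.2 _ n0.
  by rewrite quadfE e1 ltxx.
by apply/eqP; rewrite [u]surjective_pairing u10 u20.
Qed.

End fisher_rao_form.

(** * Symmetrization and openness of positive definiteness *)

Section sympart.
Context {R : realType} {d : nat}.

(** Each product x_i A_ij x_j is at least - c (x_i^2 + x_j^2) / 2; summing over all pairs produces
    the factor n. *)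
Lemma psdmx_of_small n (A : 'M[R]_n) c : A^T = A -> (forall i j, `|A i j| <= c) ->
  psdmx ((n%:R * c) *: 1%:M + A).
Proof.
move=> sA hA; split; first by rewrite linearD /= linearZ /= trmx1 sA.
move=> x; rewrite quadfE bilfDm bilfZm -!quadfE quadf1E quadfE bilfE.
have h : - (\sum_i \sum_j c * ((x i 0 ^+ 2 + x j 0 ^+ 2) / 2)) <=
    \sum_i \sum_j x i 0 * A i j * x j 0.
  rewrite -sumrN; apply: ler_sum => i _; rewrite -sumrN; apply: ler_sum => j _.
  have := hA i j; rewrite ler_norml => /andP[h1 h2].
  have p1 := mulr_ge0 (_ : 0 <= c + A i j) (sqr_ge0 (x i 0 + x j 0)).
  have p2 := mulr_ge0 (_ : 0 <= c - A i j) (sqr_ge0 (x i 0 - x j 0)).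
  by have := p1 (ltac:(lra)); have := p2 (ltac:(lra)); lra.
suff E : \sum_i \sum_j c * ((x i 0 ^+ 2 + x j 0 ^+ 2) / 2) = n%:R * c * \sum_i x i 0 ^+ 2 by lra.
under eq_bigr do rewrite -mulr_sumr -mulr_suml big_split /= sumr_const card_ord.
rewrite -mulr_sumr -mulr_suml big_split /= sumr_const card_ord sumrMnl.
by rewrite -[_ *+ n]mulr_natr; field.
Qed.

(** [posdef] includes symmetry and is open only relative to the symmetric matrices, hence the
    implication inside the neighborhood. *)
Lemma near_posdef (V : normedModType R) (F : V -> 'M[R]_d) x : F y @[y --> x] --> F x ->
  posdef (F x) -> \forall y \near x, (F y)^T = F y -> posdef (F y).
Proof.
move: (F x) => S cF pS; have [c c0 hc] := posdef_lbound pS.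
pose e := c / (2 * (d%:R + 1)).
have e0 : 0 < e by rewrite divr_gt0// mulr_gt0// ltr_wpDl.
have : \forall y \near x, forall i j, `|S i j - F y i j| <= e.
  apply: filter_forall => i; apply: filter_forall => j.
  have cij : F y i j @[y --> x] --> S i j by exact: cvg_mxE.
  by move/cvgrPdist_le : cij => /(_ _ e0).
apply: filterS => y; move: (F y) => S' hS sS'.
have pD := @psdmx_of_small d (S' - S) e.
have {}pD : psdmx ((d%:R * e) *: 1%:M + (S' - S)).
  by apply: pD; [rewrite linearB /= sS' pS.1|move=> i j; rewrite !mxE distrC].
split => // z z0; have := pD.2 z; have := hc z; have := quadf1_gt0 z0.
rewrite (quadfE (_ + _)) bilfDm bilfZm bilfBm -!quadfE => q0 q1 q2.
have de : d%:R * e <= c / 2.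
  rewrite /e mulrA ler_pdivrMr ?mulr_gt0// ?ltr_wpDl//.
  have : (0 : R) <= d%:R by []; nra.
have := ler_wpM2r (ltW q0) de.
have := mulr_gt0 c0 q0; lra.
Qed.

Lemma sympart_sym (z : gpar R d) : ((sympart z).2)^T = (sympart z).2.
Proof. by rewrite /= linearZ /= linearD /= trmxK addrC. Qed.

Lemma sympart_id (z : gpar R d) : (z.2)^T = z.2 -> sympart z = z.
Proof.
move=> sz; rewrite /sympart sz -mulr2n -(scaler_nat 2 z.2) scalerA mulVf ?pnatr_eq0// scale1r.
by rewrite -surjective_pairing.
Qed.

Lemma is_diff_fst (U W : normedModType R) (z : U * W) : is_diff z (fun y : U * W => y.1) (fun h => h.1).
Proof.
apply: is_diff_intro => //; first by move=> h; exact: cvg_fst.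
by move=> e e0; apply: (@filterE _ (nbhs z)) => y; rewrite subrr normr0 mulr_ge0// ltW.
Qed.

Lemma is_diff_snd (U W : normedModType R) (z : U * W) : is_diff z (fun y : U * W => y.2) (fun h => h.2).
Proof.
apply: is_diff_intro => //; first by move=> h; exact: cvg_snd.
by move=> e e0; apply: (@filterE _ (nbhs z)) => y; rewrite subrr normr0 mulr_ge0// ltW.
Qed.

Lemma is_diff_sympart1 (z : gpar R d) :
  is_diff z (fun y : gpar R d => (sympart y).1) (fun h => (sympart h).1).
Proof. exact: is_diff_fst. Qed.

Lemma is_diff_sympart2 (z : gpar R d) :
  is_diff z (fun y : gpar R d => (sympart y).2) (fun h => (sympart h).2).
Proof.
have h := @is_diff_snd 'cV[R]_d 'M[R]_d z.
exact: (is_diffZ 2^-1 (is_diffD h (is_diff_tr h))).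
Qed.

Lemma near_sympart (z : gpar R d) : posdef (sympart z).2 ->
  \forall y \near z, posdef (sympart y).2.
Proof.
move=> pz; have c := is_diff_cvg (is_diff_sympart2 z).
by apply: filterS (near_posdef c pz) => y; apply; exact: (sympart_sym y).
Qed.

End sympart.

(** * Derivative and majorization of the functional *)

Section barycenter_calculus.
Context {R : realType} {d n : nat}.
Variables (t0 t1 : R) (lam a : 'I_n -> R) (mus : 'I_n -> gpar R d).
Hypotheses (n_gt0 : (0 < n)%N) (t0_gt0 : 0 < t0) (t1_gt0 : 0 < t1).
Hypotheses (lam_gt0 : forall i, 0 < lam i) (a_gt0 : forall i, 0 < a i).
Hypothesis mus_gaussian : forall i, gaussians (mus i).
Implicit Types (nu z : gpar R d).
Local Notation Phi := (Phi t0 t1 lam a mus).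
Local Notation b := (mass t0 t1 lam a mus).
Local Notation T := (moment_map t0 t1 lam a mus).
Local Notation om := (omega t0 t1 lam a mus).
Local Notation Zw := (Zweight t0 t1 lam a mus).
Local Notation Z := (Zsum t0 t1 lam a mus).
Let q nu i := opt_q t0 t1 (mus i) nu.

Lemma tsum_gt0 : 0 < tsum t0 t1. Proof. by rewrite addr_gt0. Qed.

Lemma Zweight_gt0 nu i : 0 < Zw nu i.
Proof. by rewrite mulr_gt0 ?expR_gt0// mulr_gt0 ?powR_gt0. Qed.

Lemma Zsum_gt0 nu : 0 < Z nu.
Proof.
rewrite /Zsum (bigD1 (Ordinal n_gt0))//= ltr_pwDl ?Zweight_gt0//.
by apply: sumr_ge0 => i _; exact/ltW/Zweight_gt0.
Qed.

Lemma omega_gt0 nu i : 0 < om nu i.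
Proof. by rewrite divr_gt0 ?Zweight_gt0 ?Zsum_gt0. Qed.

Lemma omega_sum nu : \sum_i om nu i = 1.
Proof. by rewrite -mulr_suml divff// gt_eqF ?Zsum_gt0. Qed.

Lemma mass_gt0 nu : 0 < b nu.
Proof. by rewrite powR_gt0// Zsum_gt0. Qed.

Lemma PhiE nu : Phi nu = t0 * (\sum_i lam i * a i - b nu).
Proof. by []. Qed.

(** The Huygens-Steiner identity: moving the reference point from the mean to m costs a rank-one
    term. With m the current mean it separates the score from its quadratic correction in [T]. *)
Lemma moment_shift (w : 'I_n -> R) (v : 'I_n -> 'cV[R]_d) (Q : 'I_n -> 'M[R]_d) (m : 'cV[R]_d) :
  \sum_i w i = 1 -> let mp := \sum_i w i *: v i in
  \sum_i w i *: (Q i + (v i - mp) *m (v i - mp)^T) =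
  \sum_i w i *: (Q i + (v i - m) *m (v i - m)^T) - (mp - m) *m (mp - m)^T.
Proof.
move=> w1 mp; apply/matrixP => k l; rewrite !(summxE, mxE) !big_ord1 !mxE.
have mE j : mp j 0 = \sum_i w i * v i j 0.
  by rewrite summxE; apply: eq_bigr => i _; rewrite mxE.
transitivity (\sum_i (w i * (Q i k l + (v i k 0 - m k 0) * (v i l 0 - m l 0)) +
    w i * v i k 0 * (m l 0 - mp l 0) + w i * v i l 0 * (m k 0 - mp k 0) +
    w i * (mp k 0 * mp l 0 - m k 0 * m l 0))).
  by apply: eq_bigr => i _; rewrite !mxE !big_ord1 !mxE; ring.
rewrite !big_split /= -!mulr_suml w1 -!mE.
under [in RHS]eq_bigr do rewrite !mxE big_ord1 !mxE.
by move: (\sum__ _) => x; ring.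
Qed.

(** By [is_diff_Phi] the Fisher-Rao gradient of [Phi] is - t1 b times this vector; [moment_mapE]
    relates it to the step made by [T]. *)
Definition bary_score nu : gpar R d :=
  (\sum_i om nu i *: (gauss_score (q nu i) nu).1, \sum_i om nu i *: (gauss_score (q nu i) nu).2).

Lemma moment_mapE nu : posdef nu.2 ->
  T nu = (nu.1 + (bary_score nu).1,
          nu.2 + (bary_score nu).2 - (bary_score nu).1 *m (bary_score nu).1^T).
Proof.
move=> pnu.
have qE i : q_par t0 t1 (mus i) nu = q nu i by exact: (q_parE t0_gt0 t1_gt0 (mus_gaussian i) pnu).
have e1 : \sum_i om nu i *: (q nu i).1 = nu.1 + (bary_score nu).1.
  rewrite /bary_score /=; under [in RHS]eq_bigr do rewrite scalerBr.
  by rewrite sumrB -scaler_suml omega_sum scale1r addrC subrK.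
have -> : T nu = (\sum_i om nu i *: (q nu i).1, \sum_i om nu i *: ((q nu i).2 +
    ((q nu i).1 - \sum_i om nu i *: (q nu i).1) *m ((q nu i).1 - \sum_i om nu i *: (q nu i).1)^T)).
  rewrite /moment_map /=; have -> : \sum_i om nu i *: (q_par t0 t1 (mus i) nu).1 =
    \sum_i om nu i *: (q nu i).1 by apply: eq_bigr => i _; rewrite qE.
  by congr pair; apply: eq_bigr => i _; rewrite qE.
rewrite (moment_shift _ _ nu.1 (omega_sum nu)) e1; congr pair.
rewrite [nu.1 + _]addrC addrK; congr (_ - _).
rewrite /bary_score /=; under [in RHS]eq_bigr do rewrite scalerBr.
by rewrite sumrB -scaler_suml omega_sum scale1r addrC subrK.
Qed.


Lemma gauss_score_sym (p nu : gpar R d) : (p.2)^T = p.2 -> (nu.2)^T = nu.2 ->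
  ((gauss_score p nu).2)^T = (gauss_score p nu).2.
Proof.
rewrite /gauss_score /= => sp sn; move: (_ - nu.1) => w.
by rewrite linearB linearD /= sp sn trmx_mul trmxK.
Qed.

Lemma bary_score_sym nu : posdef nu.2 -> ((bary_score nu).2)^T = (bary_score nu).2.
Proof.
move=> pnu; rewrite /bary_score /= linear_sum; apply: eq_bigr => i _.
have sq := (opt_q_gaussian t0_gt0 t1_gt0 (mus_gaussian i) pnu).1.
by rewrite linearZ /=; congr (_ *: _); exact: gauss_score_sym sq pnu.1.
Qed.

Lemma moment_map_gaussian nu : posdef nu.2 -> posdef (T nu).2.
Proof.
move=> pnu; rewrite /moment_map /=.
have pi i : posdef (om nu i *: ((q_par t0 t1 (mus i) nu).2 +
   ((q_par t0 t1 (mus i) nu).1 - \sum_i om nu i *: (q_par t0 t1 (mus i) nu).1) *m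
   ((q_par t0 t1 (mus i) nu).1 - \sum_i om nu i *: (q_par t0 t1 (mus i) nu).1)^T)).
  rewrite (q_parE t0_gt0 t1_gt0 (mus_gaussian i) pnu).
  apply: posdefZ; first exact: omega_gt0.
  apply: posdefDpsd; first exact: (opt_q_gaussian t0_gt0 t1_gt0 (mus_gaussian i) pnu).
  move: (_ - _) => w; split; first by rewrite trmx_mul trmxK.
  move=> x; rewrite (_ : quadf _ x = (w^T *m x) 0 0 ^+ 2) ?sqr_ge0//.
  rewrite /quadf mulmxA -mulmxA mxE big_ord1 expr2; congr (_ * _).
  by rewrite -[w]trmxK -trmx_mul mxE trmxK.
rewrite (bigD1 (Ordinal n_gt0))//=; apply: posdefDpsd; first exact: pi.
elim/big_ind : _ => [|A B pA pB|i _]; last exact/posdef_psd/pi.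
  by split; [rewrite trmx0|move=> x; rewrite quadfE bilfE big1// => i _; rewrite big1// => j _; rewrite mxE mulr0 mul0r].
split; first by rewrite linearD /= pA.1 pB.1.
by move=> x; rewrite quadfE bilfDm -!quadfE addr_ge0 ?pA.2 ?pB.2.
Qed.

Lemma fixed_point_score nu : posdef nu.2 -> T nu = nu -> bary_score nu = 0.
Proof.
move=> pnu; rewrite moment_mapE//; move: (bary_score nu) => [u w] h.
have {h} [h1 h2] : nu.1 + u = nu.1 /\ nu.2 + w - u *m u^T = nu.2.
  by move: h; case: (nu) => m S /= [-> ->].
have e1 : u = 0 by apply: (addrI nu.1); rewrite h1 addr0.
move: h2; rewrite e1 mul0mx subr0 => h2.
by have -> : w = 0 by apply: (addrI nu.2); rewrite h2 addr0.
Qed.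

Lemma is_diff_Zweight z i : posdef (sympart z).2 ->
  is_diff z (fun y => Zw (sympart y) i) (fun h => t1 / tsum t0 t1 * (Zw (sympart z) i *
    fisher_rao (sympart z) (gauss_score (q (sympart z) i) (sympart z)) (sympart h))).
Proof.
move=> pz; have s0 := tsum_gt0.
have dA := is_diff_A_val (near_sympart pz) (is_diff_sympart1 z) (is_diff_sympart2 z)
  t0_gt0 t1_gt0 (mus_gaussian i).
have dB := is_diffZ (- (tsum t0 t1)^-1) dA.
have dC := is_diffZ (lam i * (a i `^ theta t0 t1)) (is_diff_chain dB (is_derive_expR _)).
have ZE y : Zw (sympart y) i = lam i * a i `^ theta t0 t1 *
    expR (- (tsum t0 t1)^-1 * A_val t0 t1 (mus i) (sympart y)).
  by rewrite /Zweight (_ : - _ / _ = - (tsum t0 t1)^-1 * A_val t0 t1 (mus i) (sympart y))// mulNr mulrC -mulNr.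
rewrite (funext ZE); apply: (is_diff_ext _ dC) => h.
suff E : lam i * a i `^ theta t0 t1 * (expR (- (tsum t0 t1)^-1 * A_val t0 t1 (mus i) (sympart z)) *
   (- (tsum t0 t1)^-1 * (- t1 * fisher_rao (sympart z) (gauss_score (q (sympart z) i) (sympart z)) (sympart h)))) =
   t1 / tsum t0 t1 * (Zw (sympart z) i *
    fisher_rao (sympart z) (gauss_score (q (sympart z) i) (sympart z)) (sympart h)) by exact: E.
rewrite ZE.
by move: (fisher_rao _ _ _) (expR _) (_ `^ _) => ? ? ?; ring.
Qed.

Lemma is_diff_Phi z : posdef (sympart z).2 ->
  is_diff z (fun y => Phi (sympart y)) (fun h => - t1 * (b (sympart z) *
    fisher_rao (sympart z) (bary_score (sympart z)) (sympart h))).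
Proof.
move=> pz; have s0 := tsum_gt0.
have ti : 0 < (theta t0 t1)^-1 by rewrite invr_gt0 divr_gt0.
have dZ := is_diff_sum (fun i => is_diff_Zweight i pz).
have dP := is_diff_chain dZ (is_derive1_powR (theta t0 t1)^-1 (Zsum_gt0 (sympart z))).
have dF := is_diffZ t0 (is_diffB (is_diff_cst (\sum_i lam i * a i) z) dP).
apply: (is_diff_ext _ dF) => h.
suff E : t0 * (0 - (theta t0 t1)^-1 * Z (sympart z) `^ ((theta t0 t1)^-1 - 1) *
   \sum_i (t1 / tsum t0 t1 * (Zw (sympart z) i *
    fisher_rao (sympart z) (gauss_score (q (sympart z) i) (sympart z)) (sympart h)))) =
  - t1 * (b (sympart z) * fisher_rao (sympart z) (bary_score (sympart z)) (sympart h)) by exact: E.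
(* Z^(1 / theta) = Z Z^(1 / theta - 1) turns the sum weighted by [Zw] into b times the average
   weighted by [om], and the constants combine to t0 (1 / theta) (t1 / s) = t1. *)
rewrite fisher_rao_suml /mass -(mulr_powRB1 (ltW (Zsum_gt0 _)) ti).
rewrite -mulr_sumr.
have -> : \sum_i om (sympart z) i * fisher_rao (sympart z) (gauss_score (q (sympart z) i) (sympart z)) (sympart h) =
  (\sum_i Zw (sympart z) i * fisher_rao (sympart z) (gauss_score (q (sympart z) i) (sympart z)) (sympart h)) / Z (sympart z).
  by rewrite mulr_suml; apply: eq_bigr => i _; rewrite mulrAC.
have := Zsum_gt0 (sympart z).
move: (\sum__ _) (Z (sympart z) `^ ((theta t0 t1)^-1 - 1)) (Z _) => x y u u0; rewrite /theta.
by field; rewrite !gt_eqF.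
Qed.

Lemma differentiable_omega z i : posdef (sympart z).2 ->
  differentiable (fun y => om (sympart y) i) z.
Proof.
move=> pz; have dZ := is_diff_sum (fun i => is_diff_Zweight i pz).
have [dZ' _] := dZ; have [dW _] := is_diff_Zweight i pz.
have dI : differentiable (fun y => (Z (sympart y))^-1) z.
  by apply: (differentiableV dZ'); rewrite gt_eqF ?Zsum_gt0.
exact: (differentiableM dW dI).
Qed.

Lemma differentiable_gauss_score z i : posdef (sympart z).2 ->
  differentiable (fun y => (gauss_score (q (sympart y) i) (sympart y)).1) z /\
  differentiable (fun y => (gauss_score (q (sympart y) i) (sympart y)).2) z.
Proof.
move=> pz.
have [d1 _] := is_diff_sympart1 z; have [d2 _] := is_diff_sympart2 z.
have q1 := differentiable_opt_q1 (near_sympart pz) (is_diff_sympart1 z) (is_diff_sympart2 z)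
  t0_gt0 t1_gt0 (mus_gaussian i).
have q2 := differentiable_opt_q2 (near_sympart pz) (is_diff_sympart1 z) (is_diff_sympart2 z)
  t0_gt0 t1_gt0 (mus_gaussian i).
have s1 := differentiable_sub q1 d1.
split; first exact: s1.
exact: (differentiable_sub (differentiable_add q2 (differentiable_mulmx s1 (differentiable_trmx s1))) d2).
Qed.

Lemma differentiable_bary_score z : posdef (sympart z).2 ->
  differentiable (fun y => (bary_score (sympart y)).1) z /\
  differentiable (fun y => (bary_score (sympart y)).2) z.
Proof.
move=> pz; split; apply: differentiable_sumf => i; apply: differentiable_scaler.
- exact: differentiable_omega.
- by have [] := differentiable_gauss_score i pz.
- exact: differentiable_omega.
- by have [] := differentiable_gauss_score i pz.
Qed.

Lemma Phi_majorization nu nu' : posdef nu.2 -> posdef nu'.2 ->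
  Phi nu' <= Phi nu + t1 * b nu *
    \sum_i om nu i * (cross_entropy (q nu i) nu' - cross_entropy (q nu i) nu).
Proof.
move=> pnu pnu'; have s0 := tsum_gt0.
pose c i := cross_entropy (q nu i) nu' - cross_entropy (q nu i) nu.
rewrite -/(c _); set C := \sum_i _.
have [k kE] : exists k, k = t1 / tsum t0 t1 by exists (t1 / tsum t0 t1).
have Zle : Z nu * expR (- k * C) <= Z nu'.
  (* The tangent line of exp at the averaged exponent - k C stands in for Jensen's inequality: its
     linear terms cancel after averaging with the weights [om]. *)
  have h i : Zw nu i * (expR (- k * C) * (1 + (- k * c i + k * C))) <= Zw nu' i.
    rewrite /Zweight -!mulrA !ler_pM2l ?powR_gt0// mulrA -expRD.
    apply: (@le_trans _ _ (expR (- A_val t0 t1 (mus i) nu / tsum t0 t1 + - k * C) * expR (- k * c i + k * C))).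
      by rewrite ler_pM2l ?expR_gt0// expR_ge1Dx.
    rewrite -expRD ler_expR.
    have := A_val_upper t0_gt0 t1_gt0 (mus_gaussian i) pnu pnu'.
    rewrite -/(c i) => up.
    rewrite (_ : - A_val t0 t1 (mus i) nu / _ + - k * C + (- k * c i + k * C) =
      - (A_val t0 t1 (mus i) nu + t1 * c i) / tsum t0 t1).
      by apply: ler_wpM2r; [rewrite invr_ge0 ltW|rewrite lerN2 -lerBlDl].
    by rewrite kE; field; rewrite gt_eqF.
  apply: le_trans (ler_sum _ (fun i _ => h i)).
  rewrite le_eqVlt; apply/orP; left; apply/eqP.
  transitivity (expR (- k * C) * (Z nu * \sum_i om nu i * (1 + (- k * c i + k * C)))).
    rewrite (_ : \sum_i om nu i * _ = 1); first by rewrite mulr1 mulrC.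
    transitivity ((1 + k * C) * (\sum_i om nu i) - k * C).
      transitivity (\sum_i ((1 + k * C) * om nu i - k * (om nu i * c i))).
        by apply: eq_bigr => i _; ring.
      by rewrite sumrB -!mulr_sumr.
    by rewrite omega_sum; ring.
  rewrite mulr_sumr mulr_sumr; apply: eq_bigr => i _; rewrite /omega.
  by rewrite [Z _ * _]mulrA [Z _ * (_ / _)]mulrC divfK ?gt_eqF ?Zsum_gt0//; rewrite mulrCA.
have r0 : 0 < (theta t0 t1)^-1 by rewrite invr_gt0 divr_gt0.
(* The power 1 / theta multiplies the exponent by s / t0, and k s / t0 = t1 / t0; then 1 + x <= exp
   x. *)
have ble : b nu * (1 - t1 / t0 * C) <= b nu'.
  apply: (@le_trans _ _ ((Z nu * expR (- k * C)) `^ (theta t0 t1)^-1)); last first.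
    rewrite ge0_ler_powR ?nnegrE ?(ltW r0) ?(ltW (Zsum_gt0 _))//.
    by apply: mulr_ge0; [exact/ltW/Zsum_gt0|exact: expR_ge0].
  rewrite (powRM _ (ltW (Zsum_gt0 _)) (expR_ge0 _)) -expRM; apply: ler_wpM2l; first exact/ltW/mass_gt0.
  apply: le_trans (expR_ge1Dx _); rewrite lerD2l le_eqVlt; apply/orP; left; apply/eqP.
  by rewrite kE /theta; field; rewrite !gt_eqF.
rewrite !PhiE.
have : t0 * (b nu * (1 - t1 / t0 * C)) <= t0 * b nu' by rewrite ler_pM2l.
rewrite (_ : t0 * (b nu * (1 - t1 / t0 * C)) = t0 * b nu - t1 * b nu * C).
  by move: (b nu) (b nu') (\sum_i lam i * a i) C {ble Zle} => x y u w; lra.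
by field; rewrite gt_eqF.
Qed.

(** A cross entropy is affine in the first two moments of its first argument, so a mixture may be
    replaced by the Gaussian with the same moments; [moment_map] is exactly this replacement. *)
Lemma cross_entropy_mix (w : 'I_n -> R) (p : 'I_n -> gpar R d) nu :
  \sum_i w i = 1 ->
  \sum_i w i * cross_entropy (p i) nu = cross_entropy (\sum_i w i *: (p i).1,
    \sum_i w i *: ((p i).2 + ((p i).1 - \sum_i w i *: (p i).1) *m
      ((p i).1 - \sum_i w i *: (p i).1)^T)) nu.
Proof.
move=> w1; rewrite /cross_entropy /= (moment_shift _ _ nu.1 w1) subrK.
have trS (A : 'I_n -> 'M[R]_d) : \tr (\sum_i A i) = \sum_i \tr (A i).
  exact: (big_morph _ (fun A B => mxtraceD A B) (mxtrace0 _ _)).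
rewrite mulmx_sumr trS mulrDl mulr_suml.
under [in RHS]eq_bigr do rewrite -scalemxAr mxtraceZ -mulrA.
under eq_bigr do rewrite mulrDl mulrDr.
by rewrite big_split /= -mulr_suml w1 mul1r.
Qed.

Lemma Phi_fixed_point_majorization nu nu' : posdef nu.2 -> posdef nu'.2 -> T nu = nu ->
  Phi nu' <= Phi nu + t1 * b nu * (cross_entropy nu nu' - cross_entropy nu nu).
Proof.
move=> pnu pnu' fixT.
have mix nu'' : \sum_i om nu i * cross_entropy (q nu i) nu'' = cross_entropy nu nu''.
  have -> : cross_entropy nu nu'' = cross_entropy (T nu) nu'' by rewrite fixT.
  rewrite (cross_entropy_mix _ _ (omega_sum nu)) /moment_map /=.
  have -> : \sum_i om nu i *: (q_par t0 t1 (mus i) nu).1 = \sum_i om nu i *: (q nu i).1.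
    by apply: eq_bigr => i _; rewrite (q_parE t0_gt0 t1_gt0 (mus_gaussian i) pnu).
  congr (cross_entropy (_, _) _); apply: eq_bigr => i _.
  by rewrite (q_parE t0_gt0 t1_gt0 (mus_gaussian i) pnu).
apply: (le_trans (Phi_majorization pnu pnu')); rewrite lerD2l.
under eq_bigr do rewrite mulrBr.
by rewrite sumrB !mix.
Qed.

End barycenter_calculus.

(** * Norms and generalized spectra *)

Section column_norm.
Context {R : realType} {n : nat}.
Implicit Types (A : 'M[R]_n) (h : 'cV[R]_n).

Lemma entry_le_norm h i : `|h i 0| <= `|h|.
Proof.
rewrite [X in _ <= X]mx_normrE.
exact: (@le_bigmax_cond _ _ _ 0 (i, 0) xpredT (fun ij => `|h ij.1 ij.2|)).
Qed.

Lemma norm_le_quadf1 h : `|h| ^+ 2 <= quadf 1%:M h.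
Proof.
have s0 := quadf1_ge0 h.
suff le : `|h| <= Num.sqrt (quadf 1%:M h).
  by rewrite -(sqr_sqrtr s0) ler_pXn2r ?nnegrE ?sqrtr_ge0.
rewrite [X in X <= _]mx_normrE; apply: bigmax_le; first exact: sqrtr_ge0.
move=> [i j] _ /=; rewrite (ord1 j) -(sqrtr_sqr (h i 0)) ler_wsqrtr//.
rewrite quadf1E (bigD1 i)//= lerDl; apply: sumr_ge0 => k _; exact: sqr_ge0.
Qed.

Lemma quadf_le_norm A : exists2 C, 0 < C & forall h, `|quadf A h| <= C * `|h| ^+ 2.
Proof.
have s0 : 0 <= \sum_i \sum_j `|A i j| by apply: sumr_ge0 => i _; apply: sumr_ge0.
exists (\sum_i \sum_j `|A i j| + 1); first by rewrite ltr_wpDl.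
move=> h; rewrite quadfE bilfE; apply: (@le_trans _ _ ((\sum_i \sum_j `|A i j|) * `|h| ^+ 2)).
  apply: (le_trans (ler_norm_sum _ _ _)); rewrite mulr_suml; apply: ler_sum => i _.
  apply: (le_trans (ler_norm_sum _ _ _)); rewrite mulr_suml; apply: ler_sum => j _.
  rewrite !normrM mulrAC mulrC expr2; apply: ler_wpM2l => //.
  by apply: ler_pM => //; exact: entry_le_norm.
by apply: ler_wpM2r; rewrite ?sqr_ge0// lerDl.
Qed.

Lemma norm_le_posdef A : posdef A -> exists2 C, 0 < C & forall h, `|h| ^+ 2 <= C * quadf A h.
Proof.
move=> pA; have [c c0 hc] := posdef_lbound pA.
exists c^-1; first by rewrite invr_gt0.
by move=> h; rewrite mulrC ler_pdivlMr// mulrC; apply: le_trans (hc h); rewrite ler_pM2l// norm_le_quadf1.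
Qed.

Lemma col_basis h : h = \sum_i h i 0 *: basis_vec (R := R) i.
Proof.
apply/colP => j; rewrite summxE (bigD1 j)//= big1 ?addr0; last first.
  by move=> i ij; rewrite !mxE [j == i]eq_sym (negbTE ij) mulr0.
by rewrite !mxE !eqxx mulr1.
Qed.

End column_norm.

(** * Second-order expansion at a critical point *)

Section second_order.
Context {R : realType} {n : nat}.
Variables (f : 'cV[R]_n -> R) (x : 'cV[R]_n).
Variables (Df : 'cV[R]_n -> 'cV[R]_n -> R) (dp : 'I_n -> 'cV[R]_n -> R).
Hypotheses (fD : \forall y \near x, is_diff y f (Df y)).
Hypotheses (pD : forall j, is_diff x (fun y => Df y (basis_vec j)) (dp j)).
Hypothesis Dfx0 : forall j, Df x (basis_vec j) = 0.
Let M : 'M[R]_n := \matrix_(i, j) dp j (basis_vec i).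

Lemma hessian_mxE : hessian_mx f x = M.
Proof.
apply/matrixP => i j; rewrite !mxE.
have E : \forall y \near x, 'D_(basis_vec j) f y = Df y (basis_vec j).
  by apply: filterS fD => y [df <-]; rewrite deriveE.
rewrite (near_eq_derive (basis_vec i) E).
by have [df dfE] := pD j; rewrite deriveE// dfE.
Qed.

Lemma is_diff_linear_sum (V W : normedModType R) (g dg : V -> W) (z : V) m (c : 'I_m -> R)
    (u : 'I_m -> V) : is_diff z g dg -> dg (\sum_i c i *: u i) = \sum_i c i *: dg (u i).
Proof.
by move=> [_ <-]; rewrite linear_sum; apply: eq_bigr => i _; rewrite linearZ.
Qed.

Lemma is_derive_segment (h : 'cV[R]_n) (t : R) : is_diff (x + t *: h) f (Df (x + t *: h)) ->
  is_derive t 1 (fun t => f (x + t *: h)) (Df (x + t *: h) h).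
Proof.
move=> dfx.
have dl : is_diff t (fun t : R => x + t *: h) (fun s : R => s *: h).
  have := is_diffD (is_diff_cst x (t : R^o)) (is_diff_scalel t h).
  by rewrite add0r.
have [dc dcE] := is_diff_comp dl dfx.
apply: DeriveDef; first exact: diff_derivable.
by rewrite deriveE// dcE /= scale1r.
Qed.

(** The partial derivatives are differentiable at x only, so the mean value theorem is applied on
    the segment and the gradient at the intermediate point is expanded to first order. An unknown xi
    replaces the factor 1 / 2; as xi also scales the error, conclusions about sign and order are
    unaffected. *)
Lemma second_order e : 0 < e -> \forall y \near x, exists xi, 0 < xi < 1 /\
  `|f y - f x - xi * quadf M (y - x)| <= xi * e * `|y - x| ^+ 2.
Proof.
(* The errors of n coordinates are summed; the added 1 covers n = 0. *)
move=> e0; pose e' := e / (n%:R + 1).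
have e'0 : 0 < e' by rewrite divr_gt0// ltr_wpDl.
have : \forall y \near x, is_diff y f (Df y) /\
    forall j, `|Df y (basis_vec j) - dp j (y - x)| <= e' * `|y - x|.
  apply: filterS2 fD (filter_forall _ (fun j => is_diff_approx (pD j) e'0)).
  by move=> y h1 h2; split => // j; have := h2 j; rewrite Dfx0 subr0.
move=> /nbhs_ballP[r /= r0 hr].
apply/nbhs_ballP; exists r => //= y; rewrite -ball_normE /= distrC => hr'.
have yE : y = x + (y - x) by rewrite addrC subrK.
rewrite {1}yE; move: (y - x) hr' => h {y yE} hr'.
have near_seg (t : R) : 0 <= t <= 1 -> ball x r (x + t *: h).
  move=> /andP[t0 t1]; rewrite -ball_normE /= opprD addNKr normrN normrZ ger0_norm//.
  by apply: le_lt_trans hr'; rewrite ler_piMl.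
have der (t : R) : t \in `]0, 1[%R -> is_derive t 1 (fun t => f (x + t *: h)) (Df (x + t *: h) h).
  rewrite in_itv /= => /andP[t0 t1]; apply: is_derive_segment.
  by have [] := hr _ (near_seg t (introT andP (conj (ltW t0) (ltW t1)))).
have cont : {within `[0, 1], continuous (fun t => f (x + t *: h))}.
  apply: derivable_within_continuous => t; rewrite in_itv /= => t01.
  have [d _] := hr _ (near_seg t t01).
  by have [] := is_derive_segment d.
have [xi] := MVT ltr01 der cont; rewrite in_itv /= scale1r scale0r addr0 subr0 mulr1 => xi01 E.
exists xi; split => //; rewrite E; have [x0 x1] := andP xi01.
have [d happ] := hr _ (near_seg xi (introT andP (conj (ltW x0) (ltW x1)))).
have hE : Df (x + xi *: h) h = \sum_j h j 0 * Df (x + xi *: h) (basis_vec j).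
  have := is_diff_linear_sum (fun j => h j 0) (fun j => basis_vec (R := R) j) d.
  by rewrite -col_basis.
have qE : xi * quadf M h = \sum_j h j 0 * dp j (xi *: h).
  rewrite quadfE bilfE exchange_big mulr_sumr; apply: eq_bigr => j _.
  have hb : xi *: h = \sum_i (xi * h i 0) *: basis_vec (R := R) i.
    by rewrite [in LHS](col_basis h) scaler_sumr; apply: eq_bigr => i _; rewrite scalerA.
  rewrite hb (is_diff_linear_sum _ _ (pD j)) !mulr_sumr; apply: eq_bigr => i _.
  suff : xi * (h i 0 * M i j * h j 0) = h j 0 * (xi * h i 0 * dp j (basis_vec i)) by [].
  by rewrite mxE; ring.
rewrite hE qE -sumrB; apply: (le_trans (ler_norm_sum _ _ _)).
apply: (@le_trans _ _ (\sum_(j < n) `|h| * (e' * (xi * `|h|)))).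
  apply: ler_sum => j _; rewrite -mulrBr normrM; apply: ler_pM => //; first exact: entry_le_norm.
  by have := happ j; rewrite addrAC subrr add0r normrZ ger0_norm// ltW.
rewrite sumr_const card_ord -mulr_natl.
have : n%:R * e' <= e.
  by rewrite /e' mulrA ler_pdivrMr ?ltr_wpDl// mulrC ler_wpM2l ?(ltW e0)// lerDl.
have h2 := mulr_ge0 (ltW x0) (sqr_ge0 `|h|).
move=> /(ler_wpM2r h2) h3.
have -> : n%:R * (`|h| * (e' * (xi * `|h|))) = n%:R * e' * (xi * `|h| ^+ 2) by ring.
by have -> : xi * e * `|h| ^+ 2 = e * (xi * `|h| ^+ 2) by ring.
Qed.

Lemma strict_local_min : posdef M -> \forall y \near x, y != x -> f x < f y.
Proof.
move=> pM; have [C C0 hC] := norm_le_posdef pM.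
have e0 : 0 < (2 * C)^-1 by rewrite invr_gt0 mulr_gt0.
apply: filterS (second_order e0) => y [xi [/andP[x0 x1]]].
move=> h yx; have := pM.2 (y - x); rewrite subr_eq0 => /(_ yx) q0.
have := hC (y - x); move: h; rewrite ler_norml => /andP[h _] hq.
have h2 : (2 * C)^-1 * `|y - x| ^+ 2 <= quadf M (y - x) / 2.
  have : C^-1 * `|y - x| ^+ 2 <= quadf M (y - x) by rewrite mulrC ler_pdivrMr// mulrC.
  by rewrite invfM -mulrA; lra.
have := mulr_gt0 x0 q0; have := ler_wpM2l (ltW x0) h2; rewrite mulrA.
by move: h; rewrite -mulrA; lra.
Qed.

Lemma second_order_bound : exists2 C, 0 < C & \forall y \near x, `|f y - f x| <= C * `|y - x| ^+ 2.
Proof.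
have [C C0 hC] := quadf_le_norm M.
exists (C + 1); first by rewrite ltr_wpDl// ltW.
apply: filterS (second_order ltr01) => y [xi [/andP[x0 x1]]].
rewrite mulr1 => h; have := hC (y - x).
have n0 := sqr_ge0 `|y - x|.
have h3 : xi * `|y - x| ^+ 2 <= `|y - x| ^+ 2 by rewrite ler_piMl// ltW.
have h4 : `|xi * quadf M (y - x)| <= `|quadf M (y - x)|.
  by rewrite normrM ger0_norm ?(ltW x0)// ler_piMl// ltW.
move=> h5; have := ler_normD (f y - f x - xi * quadf M (y - x)) (xi * quadf M (y - x)).
by rewrite subrK mulrDl mul1r; lra.
Qed.

Lemma local_max_nsd : (\forall y \near x, f y <= f x) -> forall v, quadf M v <= 0.
Proof.
move=> fmax v; rewrite leNgt; apply/negP => q0.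
have v0 : v != 0 by apply: contraTneq q0 => ->; rewrite quadf0 ltxx.
have n0 : 0 < `|v| by rewrite normr_gt0.
(* With this error constant the remainder along v is at most half of the quadratic term. *)
have e0 : 0 < quadf M v / (2 * `|v| ^+ 2) by rewrite divr_gt0// mulr_gt0// exprn_gt0.
have : \forall y \near x, f y <= f x /\ exists xi, 0 < xi < 1 /\
   `|f y - f x - xi * quadf M (y - x)| <= xi * (quadf M v / (2 * `|v| ^+ 2)) * `|y - x| ^+ 2.
  apply: filterS2 fmax (second_order e0) => y h1 h2.
  by split.
move=> /nbhs_ballP[r /= r0 hr].
pose t := r / (2 * `|v|); have t0 : 0 < t by rewrite divr_gt0// mulr_gt0.
have [|h1 [xi [/andP[x0 x1]]]] := hr (x + t *: v).
  rewrite -ball_normE /= opprD addNKr normrN normrZ gtr0_norm//.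
  have -> : t * `|v| = r / 2 by rewrite /t; field; rewrite gt_eqF.
  by lra.
have vE : x + t *: v - x = t *: v by rewrite addrC addKr.
rewrite vE quadfZ normrZ gtr0_norm// ler_norml => /andP[h2 _].
have tt := mulr_gt0 (exprn_gt0 2 t0) q0.
have E : xi * (quadf M v / (2 * `|v| ^+ 2)) * (t * `|v|) ^+ 2 = xi * (t ^+ 2 * quadf M v) / 2.
  by move: (t) => s; field; rewrite gt_eqF.
by rewrite E in h2; have := mulr_gt0 x0 tt; lra.
Qed.

End second_order.

(** * The generalized spectrum *)

Section spectrum.
Context {R : realType} {n : nat}.
Implicit Types (A B H C D : 'M[R]_n) (h w : 'cV[R]_n).

Lemma sqrtmxP B : posdef B -> posdef (sqrtmx B) /\ sqrtmx B *m sqrtmx B = B.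
Proof. by move=> /posdef_sqrt [S hS]; exact: (@xgetPex _ 0 [set S | _] (ex_intro _ S hS)). Qed.

Lemma bnorm_ge0 B h : 0 <= bnorm B h. Proof. exact: sqrtr_ge0. Qed.

Lemma bnorm_sqr B h : posdef B -> bnorm B h ^+ 2 = quadf B h.
Proof. by move=> pB; rewrite sqr_sqrtr// (posdef_psd pB).2. Qed.

Lemma bnorm_gt0 B h : posdef B -> h != 0 -> 0 < bnorm B h.
Proof. by move=> pB h0; rewrite sqrtr_gt0 pB.2. Qed.

Lemma bnorm_le B h h' k : posdef B -> 0 <= k ->
  (bnorm B h <= k * bnorm B h') = (quadf B h <= k ^+ 2 * quadf B h').
Proof.
move=> pB k0; rewrite -!bnorm_sqr// -exprMn ler_pXn2r ?nnegrE ?bnorm_ge0//.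
by rewrite mulr_ge0 ?bnorm_ge0.
Qed.

(* The identity [k D (k - D) = (k - D) D (k - D) + D (k - D) D] avoids a
   simultaneous diagonalization. *)
Lemma psd_contraction D k w : psdmx D -> 0 <= k -> psdmx (k *: 1%:M - D) ->
  quadf 1%:M (D *m w) <= k ^+ 2 * quadf 1%:M w.
Proof.
move=> pD k0 pE; have le z : quadf D z <= k * quadf 1%:M z.
  by have := pE.2 z; rewrite quadfBm quadfZm subr_ge0.
move: k0; rewrite le_eqVlt => /predU1P[k0|k0].
  have Dw : D *m w = 0.
    apply: psd_ker => //; apply/eqP; rewrite eq_le pD.2 andbT.
    by have := le w; rewrite -k0 mul0r.
  by rewrite Dw quadf0 mulr_ge0 ?sqr_ge0 ?quadf1_ge0.
have h1 := pE.2 (D *m w); have h2 := pD.2 ((k *: 1%:M - D) *m w).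
have e1 : quadf 1%:M (D *m w) = bilf (D *m D) w w by rewrite quadf_congr mulmx1 pD.1 quadfE.
have e2 : quadf (k *: 1%:M - D) (D *m w) = k * bilf (D *m D) w w - bilf (D *m D *m D) w w.
  rewrite quadf_congr pD.1 mulmxBr mulmxBl -scalemxAr mulmx1 -scalemxAl.
  by rewrite quadfBm quadfZm -!quadfE.
have e3 : quadf D ((k *: 1%:M - D) *m w) =
    k ^+ 2 * bilf D w w - 2 * k * bilf (D *m D) w w + bilf (D *m D *m D) w w.
  rewrite quadf_congr pE.1 mulmxBl mulmxBr -!scalemxAl mul1mx.
  rewrite !mulmxBl -!scalemxAr !mulmx1 -?scalemxAl quadfE !(bilfBm, bilfZm).
  ring.
have := le w; rewrite quadfE.
have h3 : 0 <= k * (k * bilf D w w - bilf (D *m D) w w).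
  by move: h1 h2; rewrite e2 e3; lra.
move: h3; rewrite pmulr_rge0// subr_ge0 e1 => h3 h4.
by apply: (le_trans h3); rewrite expr2 -mulrA ler_pM2l.
Qed.

Lemma eigenvalue_rank C l : eigenvalue C l = (\rank (C - l%:M)%R < n)%N.
Proof.
rewrite /eigenvalue /eigenspace kermx_eq0 /row_free.
by rewrite ltn_neqAle rank_leq_row andbT.
Qed.

Lemma rank_congr (M A : 'M[R]_n) : M \in unitmx -> \rank (M^T *m A *m M) = \rank A.
Proof.
move=> uM; rewrite mxrankMfree ?row_free_unit// -mxrank_tr trmx_mul trmxK.
by rewrite mxrankMfree ?row_free_unit// mxrank_tr.
Qed.

Section pencil.
Variables H B : 'M[R]_n.
Hypotheses (pB : posdef B) (sH : H^T = H).
Let S := sqrtmx B.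
Let C := invsqrtmx B *m H *m invsqrtmx B.
Let pS : posdef S. Proof. by have [] := sqrtmxP pB. Qed.
Let SS : S *m S = B. Proof. by have [] := sqrtmxP pB. Qed.
Let uS : S \in unitmx := posdef_unit pS.
Let CE : C = (invmx S)^T *m H *m invmx S. Proof. by rewrite trmx_posdef_inv// pS.1. Qed.

(** C - l is congruent to H - l B through the inverse square root of B, and congruence preserves
    rank. The spectrum of C is thereby described without the square root. *)
Lemma pencil_eigenvalue l : eigenvalue C l = (0 < gen_eig_mult H B l)%N.
Proof.
rewrite eigenvalue_rank; have -> : C - l%:M = (invmx S)^T *m (H - l *: B) *m invmx S.
  rewrite mulmxBr mulmxBl -CE; congr (_ - _).
  rewrite -SS -scalemxAr -scalemxAl trmx_posdef_inv ?pS.1// -!mulmxA mulmxV// mulmx1.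
  by rewrite mulVmx// scalemx1.
by rewrite rank_congr ?unitmx_inv// /gen_eig_mult subn_gt0.
Qed.

(** S turns the B-norm into the Euclidean norm and A into 1 - C, which lies between 0 and 1 - mu as
    a form; [psd_contraction] gives the bound. *)
Lemma pencil_spectrum : (0 < n)%N -> posdef H -> psdmx (B - H) ->
  let mu := lambda_min C in let A := 1%:M - invmx B *m H in
  [/\ 0 < mu <= 1, forall h, bnorm B (A *m h) <= (1 - mu) * bnorm B h &
      opbnorm B A = 1 - mu].
Proof.
move=> n0 pH pD mu A.
have pC : posdef C by rewrite CE; apply: posdef_congr; rewrite ?unitmx_inv.
have [l [v [v1 Cv ray]]] := rayleigh_min n0 pC.1.
have vn0 : v != 0 by apply: contra_eq_neq v1 => ->; rewrite quadf0 eq_sym oner_neq0.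
(* The infimum is identified by showing that l is an eigenvalue and a lower bound for all of them;
   [eigenvalue] concerns row vectors, hence the transposes. *)
have muE : mu = l.
  apply/eqP; rewrite eq_le; apply/andP; split; last first.
    apply: lb_le_inf.
      exists l; apply/eigenvalueP; exists v^T; last by rewrite trmx_eq0.
      by rewrite -[C]trmxK -trmx_mul pC.1 Cv linearZ.
    move=> a /= /eigenvalueP[u uC u0].
    have := ray u^T; have -> : quadf C u^T = a * quadf 1%:M u^T.
      by rewrite /quadf trmxK uC -scalemxAl mxE mulmx1.
    by rewrite ler_pM2r// quadf1_gt0// trmx_eq0.
  apply: ge_inf.
    exists l => a /= /eigenvalueP[u uC u0].
    have := ray u^T; have -> : quadf C u^T = a * quadf 1%:M u^T.
      by rewrite /quadf trmxK uC -scalemxAl mxE mulmx1.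
    by rewrite ler_pM2r// quadf1_gt0// trmx_eq0.
  apply/eigenvalueP; exists v^T; last by rewrite trmx_eq0.
  by rewrite -[C]trmxK -trmx_mul pC.1 Cv linearZ.
have Cvl : quadf C v = l by rewrite /quadf -mulmxA Cv -scalemxAr mxE -[v^T]mulmx1 -/(quadf 1%:M v) v1 mulr1.
have l0 : 0 < l by rewrite -Cvl pC.2.
have pI : psdmx (1%:M - C).
  rewrite (_ : 1%:M - C = (invmx S)^T *m (B - H) *m invmx S); first exact: psdmx_congr.
  rewrite mulmxBr mulmxBl -CE -SS; congr (_ - _).
  by rewrite trmx_posdef_inv ?pS.1// mulmxA mulVmx// mul1mx mulmxV.
have l1 : l <= 1 by have := pI.2 v; rewrite quadfBm v1 Cvl subr_ge0.
have k0 : 0 <= 1 - l by rewrite subr_ge0.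
have pE : psdmx ((1 - l) *: 1%:M - (1%:M - C)).
  rewrite scalerBl scale1r opprB addrC addrA subrK.
  split; first by rewrite linearB /= linearZ /= trmx1 pC.1.
  by move=> x; rewrite quadfBm quadfZm subr_ge0.
have SA h : S *m (A *m h) = (1%:M - C) *m (S *m h).
  have SB : S *m invmx B = invmx S.
    by rewrite -[LHS](mulKmx uS) (mulmxA S S) SS mulmxV ?mulmx1// posdef_unit.
  rewrite /A CE trmx_posdef_inv ?pS.1// !mulmxBl !mul1mx mulmxBr; congr (_ - _).
  by rewrite !mulmxA SB -(mulmxA (_ *m H)) mulVmx// mulmx1.
have QS y : quadf B y = quadf 1%:M (S *m y) by rewrite quadf_congr mulmx1 pS.1 SS.
have contr h : bnorm B (A *m h) <= (1 - l) * bnorm B h.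
  by rewrite bnorm_le// !QS SA; exact: psd_contraction.
rewrite muE; split => //; first by rewrite l0 l1.
(* The norm is attained at the preimage of the eigenvector of the least eigenvalue. *)
pose h0 := invmx S *m v.
have Sh0 : S *m h0 = v by rewrite mulKVmx.
have h0n0 : h0 != 0 by apply: contra_neq vn0 => h00; rewrite -Sh0 h00 mulmx0.
have b1 : bnorm B h0 = 1 by rewrite /bnorm QS Sh0 v1 sqrtr1.
have b2 : bnorm B (A *m h0) = 1 - l.
  rewrite /bnorm QS SA Sh0 mulmxBl mul1mx Cv -{1}[v]scale1r -scalerBl quadfZ v1 mulr1.
  by rewrite sqrtr_sqr ger0_norm.
apply/eqP; rewrite eq_le; apply/andP; split.
  apply: ge_sup; first by exists (bnorm B (A *m h0) / bnorm B h0), h0.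
  by move=> _ [h /= hn0 <-]; rewrite ler_pdivrMr ?bnorm_gt0.
apply: ub_le_sup; last by exists h0 => //; rewrite b2 b1 divr1.
by exists (1 - l) => _ [h /= hn0 <-]; rewrite ler_pdivrMr ?bnorm_gt0.
Qed.

End pencil.
End spectrum.

(** * Contraction near a fixed point *)

Section local_contraction.
Context {R : realType} {n : nat}.

Lemma quadfD_young (B : 'M[R]_n) u w e : psdmx B -> 0 < e ->
  quadf B (u + w) <= (1 + e) * quadf B u + (1 + e^-1) * quadf B w.
Proof.
move=> pB e0; rewrite quadfDe ?pB.1//.
have := pB.2 (e *: u - w); rewrite (quadfDe (e *: u) (- w) pB.1) quadfZ bilfNr bilfZl.
rewrite (quadfE _ (- w)) bilfNl bilfNr opprK -quadfE => h.
have h2 : 0 <= e^-1 * (e ^+ 2 * quadf B u + 2 * - (e * bilf B u w) + quadf B w).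
  by rewrite mulr_ge0// invr_ge0 ltW.
have E : e^-1 * (e ^+ 2 * quadf B u + 2 * - (e * bilf B u w) + quadf B w) =
    e * quadf B u - 2 * bilf B u w + e^-1 * quadf B w by field; rewrite gt_eqF.
by rewrite E in h2; lra.
Qed.

Lemma near_contraction (g dg : 'cV[R]_n -> 'cV[R]_n) (B : 'M[R]_n) x k q : posdef B ->
  is_diff x g dg -> g x = x -> (forall h, bnorm B (dg h) <= k * bnorm B h) ->
  0 <= k < q -> \forall y \near x, bnorm B (g y - x) <= q * bnorm B (y - x).
Proof.
move=> pB dgx gx hk /andP[k0 kq].
have [C C0 hC] := norm_le_posdef pB; have [K K0 hK] := quadf_le_norm B.
have q0 : 0 < q by apply: le_lt_trans kq.
have kq2 : 0 < q ^+ 2 - k ^+ 2 by rewrite subr_gt0 ltr_pXn2r ?nnegrE// ltW.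
(* The margin q^2 - k^2 is shared equally: e spends at most half of it on the linear part, and m
   below spends the other half on the remainder. *)
pose e := (q ^+ 2 - k ^+ 2) / (2 * (k ^+ 2 + 1)).
have k1 : 0 < k ^+ 2 + 1 by rewrite ltr_wpDl ?sqr_ge0.
have e0 : 0 < e by rewrite divr_gt0// mulr_gt0.
pose m := (q ^+ 2 - k ^+ 2) / (2 * (1 + e^-1) * K * C).
have e1 : 0 < 1 + e^-1 by rewrite addr_gt0 ?invr_gt0.
have m0 : 0 < m by rewrite divr_gt0// !mulr_gt0.
have s0 : 0 < Num.sqrt m by rewrite sqrtr_gt0.
apply: filterS (is_diff_approx dgx s0) => y; rewrite gx => hy.
rewrite bnorm_le ?(ltW q0)//.
have -> : g y - x = dg (y - x) + (g y - x - dg (y - x)) by rewrite [RHS]addrC subrK.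
apply: (le_trans (quadfD_young _ _ (posdef_psd pB) e0)).
have h1 : quadf B (dg (y - x)) <= k ^+ 2 * quadf B (y - x) by rewrite -bnorm_le.
have h2 : quadf B (g y - x - dg (y - x)) <= K * (m * (C * quadf B (y - x))).
  apply: (le_trans (ler_norm _)); apply: (le_trans (hK _)); rewrite ler_pM2l//.
  apply: (@le_trans _ _ ((Num.sqrt m * `|y - x|) ^+ 2)).
    by rewrite ler_pXn2r ?nnegrE// mulr_ge0// ltW.
  by rewrite exprMn sqr_sqrtr ?(ltW m0)// ler_pM2l.
have b0 := (posdef_psd pB).2 (y - x).
have h3 : (1 + e) * quadf B (dg (y - x)) <= (1 + e) * (k ^+ 2 * quadf B (y - x)).
  by rewrite ler_pM2l// addr_gt0.
have h4 : (1 + e^-1) * quadf B (g y - x - dg (y - x)) <= (1 + e^-1) * (K * (m * (C * quadf B (y - x)))).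
  by rewrite ler_pM2l.
apply: (le_trans (lerD h3 h4)).
have E : (1 + e^-1) * (K * (m * (C * quadf B (y - x)))) = (q ^+ 2 - k ^+ 2) / 2 * quadf B (y - x).
  rewrite /m; move: (1 + e^-1) e1 => z z0; field; rewrite !gt_eqF//.
have h5 : e * k ^+ 2 <= (q ^+ 2 - k ^+ 2) / 2.
  rewrite /e mulrAC ler_pdivrMr ?mulr_gt0//.
  have : (q ^+ 2 - k ^+ 2) * k ^+ 2 <= (q ^+ 2 - k ^+ 2) * (k ^+ 2 + 1) by rewrite ler_pM2l// lerDl.
  by lra.
have := ler_wpM2r b0 h5; rewrite E; lra.
Qed.

Lemma bnorm_ball_sub (B : 'M[R]_n) (x : 'cV[R]_n) V : posdef B -> nbhs x V ->
  exists2 r, 0 < r & [set y | bnorm B (y - x) <= r] `<=` V.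
Proof.
move=> pB /nbhs_ballP[e /= e0 he]; have [C C0 hC] := norm_le_posdef pB.
(* The factor 2 turns the closed bound on the B-norm into a strict one for the open ball. *)
pose m := e ^+ 2 / (2 * C); have m0 : 0 < m by rewrite divr_gt0 ?mulr_gt0// exprn_gt0.
exists (Num.sqrt m); first by rewrite sqrtr_gt0.
move=> y /= hy; apply: he; rewrite -ball_normE /= distrC.
rewrite -(@ltr_pXn2r _ 2) ?nnegrE ?(ltW e0)//; apply: (le_lt_trans (hC _)).
have : quadf B (y - x) <= m.
  by rewrite -bnorm_sqr// -(sqr_sqrtr (ltW m0)) ler_pXn2r ?nnegrE ?bnorm_ge0 ?sqrtr_ge0.
rewrite -(ler_pM2l C0) => /le_lt_trans; apply.
have -> : C * m = e ^+ 2 / 2 by rewrite /m; field; rewrite gt_eqF.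
by rewrite ltr_pdivrMr// ltr_pMr ?exprn_gt0// ltr1n.
Qed.

End local_contraction.

(** * The Hessian at a fixed point *)

Section fisher_rao_product.
Context {R : realType} {d : nat} {V : normedModType R}.

Lemma fisher_rao0l (nu w : gpar R d) : fisher_rao nu 0 w = 0.
Proof. by have := fisher_raoZl nu 0 0 w; rewrite !scale0r mul0r. Qed.

Lemma is_diff_ext2 (W : normedModType R) (f g df dg : V -> W) x :
  f =1 g -> df =1 dg -> is_diff x f df -> is_diff x g dg.
Proof. by move=> /funext -> /funext ->. Qed.

(** Since u vanishes at x, the metric and the direction w need only be continuous there. In a chart
    w is a coordinate field, so one continuous derivative of the chart suffices. *)
Lemma is_diff_fisher_rao0 (nu u w : V -> gpar R d) (du1 : V -> 'cV[R]_d) (du2 : V -> 'M[R]_d) x :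
  posdef (nu x).2 -> (nu y).2 @[y --> x] --> (nu x).2 ->
  is_diff x (fun y => (u y).1) du1 -> is_diff x (fun y => (u y).2) du2 -> u x = 0 ->
  (w y).1 @[y --> x] --> (w x).1 -> (w y).2 @[y --> x] --> (w x).2 ->
  is_diff x (fun y => fisher_rao (nu y) (u y) (w y))
    (fun h => fisher_rao (nu x) (du1 h, du2 h) (w x)).
Proof.
move=> pS cS e1 e2 u0 cw1 cw2.
have cP : invmx (nu y).2 @[y --> x] --> invmx (nu x).2.
  by apply: (cvg_invmx _ cS); exact: posdef_unit.
have z2 : (u x).2 = 0 by rewrite u0.
have zt : ((u x).1)^T = 0 by rewrite u0 trmx0.
have h1 := is_diff_mulmxr0 cP (is_diff_tr e1) zt.
have z3 : ((u x).1)^T *m invmx (nu x).2 = 0 by rewrite zt mul0mx.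
have h2 := is_diff_entry 0 0 (is_diff_mulmxr0 cw1 h1 z3).
have k1 := is_diff_mulmxl0 cP e2 z2.
have z4 : invmx (nu x).2 *m (u x).2 = 0 by rewrite z2 mulmx0.
have k2 := is_diff_mulmxr0 cP k1 z4.
have z5 : invmx (nu x).2 *m (u x).2 *m invmx (nu x).2 = 0 by rewrite z4 mul0mx.
have k3 := is_diff_trace (is_diff_mulmxr0 cw2 k2 z5).
apply: is_diff_ext2 (is_diffD h2 (is_diffZ 2^-1 k3)) => y.
  by rewrite /fisher_rao [_ / 2]mulrC.
by rewrite /fisher_rao [_ / 2]mulrC.
Qed.

End fisher_rao_product.

(** * Calculus in a chart *)

Section chart_calculus.
Context {R : realType} {d : nat}.
Variable c : smooth_chart R d.
Local Notation N := (gdim d).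
Local Notation gam := (ch_inv c).
Local Notation phi := (ch_map c \o sympart).

Lemma is_diff_unique (V W : normedModType R) (f df dg : V -> W) x :
  is_diff x f df -> is_diff x f dg -> df = dg.
Proof. by move=> [_ <-] [_ <-]. Qed.

Lemma is_diff_sympart (z : gpar R d) : is_diff z sympart sympart.
Proof. exact: (is_diff_pair (is_diff_sympart1 z) (is_diff_sympart2 z)). Qed.

Lemma ch_dom_gaussian nu : ch_dom c nu -> posdef nu.2.
Proof. by have [U _ ->] := ch_dom_open c => -[]. Qed.

Lemma ch_dom_sympart nu : ch_dom c nu -> sympart nu = nu.
Proof. by move=> h; apply: sympart_id; exact: (ch_dom_gaussian h).1. Qed.

Lemma near_ch_dom nu : ch_dom c nu -> \forall z \near nu, posdef z.2 -> ch_dom c z.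
Proof.
move=> h; have [U oU E] := ch_dom_open c; rewrite E in h *.
have : nbhs nu U by apply: open_nbhs_nbhs; split => //; exact: h.2.
by apply: filterS => z Uz pz; split.
Qed.

Lemma near_ch_dom_sympart nu : ch_dom c nu -> \forall z \near nu, ch_dom c (sympart z).
Proof.
move=> h; have sn := ch_dom_sympart h.
have cs : sympart z @[z --> nu] --> nu by rewrite -{2}sn; exact: is_diff_cvg (is_diff_sympart nu).
have ps : \forall z \near nu, posdef (sympart z).2.
  by apply: near_sympart; rewrite sn; exact: ch_dom_gaussian.
have dz : \forall z \near nu, posdef (sympart z).2 -> ch_dom c (sympart z).
  exact: cs _ (near_ch_dom h).
by apply: filterS2 dz ps => z; exact.
Qed.

Lemma near_ch_cod x : ch_cod c x -> \forall y \near x, ch_cod c y.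
Proof. by move=> h; apply: open_nbhs_nbhs; split => //; exact: ch_cod_open. Qed.

Lemma ch_inv_dom x : ch_cod c x -> ch_dom c (gam x). Proof. by move=> /ch_invK[]. Qed.

Lemma ch_inv_sympart x : ch_cod c x -> sympart (gam x) = gam x.
Proof. by move=> h; apply: ch_dom_sympart; exact: ch_inv_dom. Qed.

Lemma is_diff_ch_inv x : ch_cod c x -> is_diff x gam ('d gam x).
Proof. by move=> h; apply: differentiableP; have [+ _] := ch_inv_smooth c 1; exact. Qed.

Lemma cvg_diff_ch_inv x v : ch_cod c x -> 'd gam y v @[y --> x] --> 'd gam x v.
Proof. by move=> h; have [_ /(_ v)] := ch_inv_smooth c 1; exact. Qed.

Lemma is_diff_ch_map nu : ch_dom c nu -> is_diff nu phi ('d phi nu).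
Proof.
move=> h; apply: differentiableP; have [+ _] := ch_map_smooth c 1; apply.
by rewrite /preimage /= ch_dom_sympart.
Qed.

Section at_point.
Variable x : 'cV[R]_N.
Hypothesis cx : ch_cod c x.
Let nu := gam x.
Let dnu : ch_dom c nu := ch_inv_dom cx.
Let J := 'd gam x : 'cV[R]_N -> gpar R d.
Let K := 'd phi nu : gpar R d -> 'cV[R]_N.

Lemma chart_KJ h : K (J h) = h.
Proof.
have dc : is_diff x (phi \o gam) (K \o J).
  exact: is_diff_comp (is_diff_ch_inv cx) (is_diff_ch_map dnu).
have did : is_diff x (phi \o gam) id.
  apply: near_eq_is_diff (is_diff_id x); apply: filterS (near_ch_cod cx) => y cy /=.
  by rewrite ch_inv_sympart// (ch_invK cy).2.
by have /funeqP := is_diff_unique dc did; exact.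
Qed.

(** [gam \o phi] coincides with [sympart] near nu, and differentials are unique. With [chart_KJ]
    this makes J a bijection onto the symmetric tangent vectors. *)
Lemma chart_JK w : J (K w) = sympart w.
Proof.
have phx : phi nu = x by rewrite /= ch_inv_sympart// (ch_invK cx).2.
have dJ : is_diff (phi nu) gam J by rewrite phx; exact: is_diff_ch_inv.
have dc : is_diff nu (gam \o phi) (J \o K) by exact: is_diff_comp (is_diff_ch_map dnu) dJ.
have did : is_diff nu (gam \o phi) sympart.
  apply: near_eq_is_diff (is_diff_sympart nu); apply: filterS (near_ch_dom_sympart dnu) => z hz /=.
  by rewrite (ch_mapK hz).2.
by have /funeqP := is_diff_unique dc did; exact.
Qed.

Lemma chart_sympart h : sympart (J h) = J h.
Proof. by rewrite -chart_JK chart_KJ. Qed.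

Lemma chart_sym h : ((J h).2)^T = (J h).2.
Proof. by rewrite -chart_sympart; exact: sympart_sym. Qed.

Lemma is_diff_along (W : normedModType R) (f df : gpar R d -> W) :
  is_diff nu (fun z => f (sympart z)) df -> is_diff x (fun y => f (gam y)) (fun h => df (J h)).
Proof.
move=> dfn; have h := is_diff_comp (is_diff_ch_inv cx) dfn.
apply: near_eq_is_diff h; apply: filterS (near_ch_cod cx) => y cy /=.
by rewrite ch_inv_sympart.
Qed.

Lemma is_diff_fisher_rao_field (G : gpar R d -> gpar R d) dG1 dG2 v :
  is_diff nu (fun z => (G (sympart z)).1) dG1 ->
  is_diff nu (fun z => (G (sympart z)).2) dG2 -> G nu = 0 ->
  is_diff x (fun y => fisher_rao (gam y) (G (gam y)) ('d gam y v))
    (fun h => fisher_rao nu (dG1 (J h), dG2 (J h)) (J v)).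
Proof.
move=> d1 d2 G0.
have e1 := @is_diff_along _ (fun z => (G z).1) _ d1.
have e2 := @is_diff_along _ (fun z => (G z).2) _ d2.
have cS : (gam y).2 @[y --> x] --> nu.2.
  exact: is_diff_cvg (is_diff_comp (is_diff_ch_inv cx) (is_diff_snd nu)).
have cw : 'd gam y v @[y --> x] --> 'd gam x v by exact: cvg_diff_ch_inv.
have cw1 : ('d gam y v).1 @[y --> x] --> (J v).1.
  exact: (cvg_comp _ _ cw (is_diff_cvg (is_diff_fst _))).
have cw2 : ('d gam y v).2 @[y --> x] --> (J v).2.
  exact: (cvg_comp _ _ cw (is_diff_cvg (is_diff_snd _))).
exact: (@is_diff_fisher_rao0 R d _ gam (fun y => G (gam y)) (fun y => 'd gam y v) _ _ x
  (ch_dom_gaussian dnu) cS e1 e2 G0 cw1 cw2).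
Qed.

Let frm := fisher_rao_mx c nu.

Lemma fisher_rao_chart_suml (h : 'cV[R]_N) w :
  fisher_rao nu (J h) w = \sum_i h i 0 * fisher_rao nu (J (basis_vec i)) w.
Proof.
have d1 := is_diff_comp (is_diff_ch_inv cx) (is_diff_fst nu).
have d2 := is_diff_comp (is_diff_ch_inv cx) (is_diff_snd nu).
rewrite -fisher_rao_suml; congr fisher_rao.
have l1 := is_diff_linear_sum (fun i => h i 0) (fun i => basis_vec (R := R) i) d1.
have l2 := is_diff_linear_sum (fun i => h i 0) (fun i => basis_vec (R := R) i) d2.
rewrite -col_basis in l1; rewrite -col_basis in l2.
by rewrite [LHS]surjective_pairing; congr pair; [exact: l1|exact: l2].
Qed.

Lemma fisher_rao_bilf h k : bilf frm h k = fisher_rao nu (J h) (J k).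
Proof.
have sn := (ch_dom_gaussian dnu).1; have xE : ch_map c nu = x by rewrite (ch_invK cx).2.
rewrite fisher_rao_chart_suml bilfE; apply: eq_bigr => i _.
rewrite (fisher_raoC _ _ sn) fisher_rao_chart_suml mulr_sumr; apply: eq_bigr => j _.
by rewrite mxE xE (fisher_raoC _ _ sn) -mulrA; congr (_ * _); rewrite mulrC.
Qed.

Lemma fisher_rao_mx_posdef : posdef frm.
Proof.
have xE : ch_map c nu = x by rewrite (ch_invK cx).2.
have pn := ch_dom_gaussian dnu.
split.
  by apply/matrixP => i j; rewrite !mxE fisher_raoC// pn.1.
move=> h h0; rewrite quadfE fisher_rao_bilf; apply: fisher_rao_gt0 => //; first exact: chart_sym.
by apply: contra_neq h0 => Jh; rewrite -(chart_KJ h) Jh /K linear0.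
Qed.

End at_point.
End chart_calculus.

(** * First and second derivatives at the fixed point *)

Section fixed_point.
Context {R : realType} {d n : nat}.
Variables (t0 t1 : R) (lam a : 'I_n -> R) (mus : 'I_n -> gpar R d) (nus : gpar R d).
Hypotheses (n_gt0 : (0 < n)%N) (t0_gt0 : 0 < t0) (t1_gt0 : 0 < t1).
Hypotheses (lam_gt0 : forall i, 0 < lam i) (a_gt0 : forall i, 0 < a i).
Hypotheses (mus_gaussian : forall i, gaussians (mus i)) (pnus : posdef nus.2).
Local Notation Phi := (Phi t0 t1 lam a mus).
Local Notation b := (mass t0 t1 lam a mus).
Local Notation T := (moment_map t0 t1 lam a mus).
Local Notation score := (bary_score t0 t1 lam a mus).
Hypothesis fixT : T nus = nus.
Local Notation N := (gdim d).

Let snus : sympart nus = nus. Proof. by apply: sympart_id; exact: pnus.1. Qed.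
Let psnus : posdef (sympart nus).2. Proof. by rewrite snus. Qed.
Let score0 : score nus = 0.
Proof. exact: (fixed_point_score n_gt0 t0_gt0 t1_gt0 lam_gt0 a_gt0 mus_gaussian pnus fixT). Qed.

(** With [dscore2], the derivative of [T] minus the identity on symmetric tangent vectors: the
    correction quadratic in the score has zero derivative at the fixed point. *)
Definition dscore1 := 'd (fun z => (score (sympart z)).1) nus : gpar R d -> 'cV[R]_d.
Definition dscore2 := 'd (fun z => (score (sympart z)).2) nus : gpar R d -> 'M[R]_d.

Let dE1 : is_diff nus (fun z => (score (sympart z)).1) dscore1.
Proof.
apply: differentiableP; have [+ _] := differentiable_bary_score n_gt0 t0_gt0 t1_gt0
  lam_gt0 a_gt0 mus_gaussian psnus; exact.
Qed.

Let dE2 : is_diff nus (fun z => (score (sympart z)).2) dscore2.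
Proof.
apply: differentiableP; have [_ +] := differentiable_bary_score n_gt0 t0_gt0 t1_gt0
  lam_gt0 a_gt0 mus_gaussian psnus; exact.
Qed.

Lemma dscore2_sym w : (dscore2 w)^T = dscore2 w.
Proof.
have h : is_diff nus (fun z => (score (sympart z)).2) (fun w => (dscore2 w)^T).
  apply: near_eq_is_diff (is_diff_tr dE2); apply: filterS (near_sympart psnus) => z pz.
  by apply: bary_score_sym.
by have /funeqP := is_diff_unique h dE2; exact.
Qed.

Lemma is_diff_scale0 (V : normedModType R) m p (k : V -> R) (F dF : V -> 'M[R]_(m, p)) x :
  k y @[y --> x] --> k x -> is_diff x F dF -> F x = 0 ->
  is_diff x (fun y => k y *: F y) (fun h => k x *: dF h).
Proof.
move=> ck dFx F0; apply: is_diff_mx => i j.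
have := is_diff_mul0 ck (is_diff_entry i j dFx) (_ : F x i j = 0).
rewrite F0 mxE => /(_ erefl).
by congr is_diff_def; apply/funext => y; rewrite mxE.
Qed.

(** The mass is an affine function of [Phi], whose continuity comes with its derivative. *)
Lemma cvg_mass : b (sympart z) @[z --> nus] --> b (sympart nus).
Proof.
have cP := is_diff_cvg (is_diff_Phi n_gt0 t0_gt0 t1_gt0 lam_gt0 a_gt0 mus_gaussian psnus).
have bE z : b z = \sum_i lam i * a i - t0^-1 * Phi z.
  by rewrite PhiE mulKf ?gt_eqF// subKr.
rewrite bE (_ : (fun z => b (sympart z)) = (fun z => \sum_i lam i * a i - t0^-1 * Phi (sympart z))).
  by apply: cvgB; [exact: cvg_cst|apply: cvgM; [exact: cvg_cst|exact: cP]].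
by apply/funext => z; exact: bE.
Qed.

Lemma is_diff_moment_map1 : is_diff nus (fun z => (T (sympart z)).1) (fun h => (sympart h).1 + dscore1 h).
Proof.
apply: near_eq_is_diff (is_diffD (is_diff_sympart1 nus) dE1).
apply: filterS (near_sympart psnus) => z pz.
by rewrite (moment_mapE n_gt0 t0_gt0 t1_gt0 lam_gt0 a_gt0 mus_gaussian pz).
Qed.

Lemma is_diff_moment_map2 : is_diff nus (fun z => (T (sympart z)).2) (fun h => (sympart h).2 + dscore2 h).
Proof.
have h0 : (score (sympart nus)).1 = 0 by rewrite snus score0.
have := is_diffB (is_diffD (is_diff_sympart2 nus) dE2) (is_diff_mulmx dE1 (is_diff_tr dE1)).
rewrite h0 (_ : (fun h => _ + _) = 0); last first.
  by apply/funext => h; rewrite trmx0 mulmx0 mul0mx addr0.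
rewrite subr0; apply: near_eq_is_diff.
apply: filterS (near_sympart psnus) => z pz.
by rewrite (moment_mapE n_gt0 t0_gt0 t1_gt0 lam_gt0 a_gt0 mus_gaussian pz).
Qed.

Lemma is_diff_moment_map : is_diff nus (fun z => T (sympart z))
  (fun h => ((sympart h).1 + dscore1 h, (sympart h).2 + dscore2 h)).
Proof. exact: (is_diff_pair is_diff_moment_map1 is_diff_moment_map2). Qed.

Section in_chart.
Variable c : smooth_chart R d.
Hypothesis cnus : ch_dom c nus.
Let x := ch_map c nus.
Let cx : ch_cod c x. Proof. by have [] := ch_mapK cnus. Qed.
Let gx : ch_inv c x = nus. Proof. by have [] := ch_mapK cnus. Qed.
Let J := 'd (ch_inv c) x : 'cV[R]_N -> gpar R d.
Let dE h : gpar R d := (dscore1 (J h), dscore2 (J h)).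
Let f := Phi \o ch_inv c.
Let Bc := (t1 * b nus) *: fisher_rao_mx c nus.
Let Df y h := - t1 * (b (ch_inv c y) *
  fisher_rao (ch_inv c y) (score (ch_inv c y)) ('d (ch_inv c) y h)).

Lemma is_diff_Phi_chart y : ch_cod c y -> is_diff y f (Df y).
Proof.
move=> cy; have sy := ch_inv_sympart cy.
have py : posdef (sympart (ch_inv c y)).2 by rewrite sy; exact/ch_dom_gaussian/ch_inv_dom.
have h := is_diff_Phi n_gt0 t0_gt0 t1_gt0 lam_gt0 a_gt0 mus_gaussian py.
apply: is_diff_ext (is_diff_along cy h) => v.
by rewrite sy (chart_sympart cy).
Qed.

Lemma is_diff_Phi_gradient v : is_diff x (fun y => Df y v)
  (fun h => - t1 * (b nus * fisher_rao nus (dE h) (J v))).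
Proof.
have s1 : (score (sympart nus)).1 = 0 by rewrite snus score0.
have s2 : (score (sympart nus)).2 = 0 by rewrite snus score0.
have G1 := is_diff_scale0 cvg_mass dE1 s1.
have G2 := is_diff_scale0 cvg_mass dE2 s2.
pose G nu : gpar R d := (b nu *: (score nu).1, b nu *: (score nu).2).
have G0 : G (ch_inv c x) = 0 by rewrite gx /G score0 !scaler0.
rewrite snus -gx in G1 G2.
have h := is_diffZ (- t1) (@is_diff_fisher_rao_field _ _ c x cx G _ _ v G1 G2 G0).
have e1 y : - t1 * fisher_rao (ch_inv c y) (G (ch_inv c y)) ('d (ch_inv c) y v) = Df y v.
  exact: (congr1 (fun r => - t1 * r) (fisher_raoZl _ _ _ _)).
have e2 k : - t1 * fisher_rao (ch_inv c x) (b (ch_inv c x) *: dscore1 (J k),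
    b (ch_inv c x) *: dscore2 (J k)) (J v) = - t1 * (b nus * fisher_rao nus (dE k) (J v)).
  by rewrite (fisher_raoZl _ _ (dE k)) gx.
exact: (is_diff_ext2 e1 e2 h).
Qed.

Let Df0 v : Df x v = 0.
Proof. by rewrite /Df gx score0 fisher_rao0l !mulr0. Qed.

Let Dfp j := is_diff_Phi_gradient (basis_vec j).

Let near_f : \forall y \near x, is_diff y f (Df y).
Proof. by apply: filterS (near_ch_cod cx) => y; exact: is_diff_Phi_chart. Qed.

Let hessE := hessian_mxE near_f Dfp.

(** Derivatives of the mass, of the metric and of the chart would multiply the score, which is zero
    here. What remains depends on h and k only through the tangent vectors J h and J k, which is the
    source of all chart independence. *)
Lemma hessian_bilf h k :
  bilf (hessian_mx f x) h k = - (t1 * b nus) * fisher_rao nus (dE h) (J k).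
Proof.
rewrite hessE bilfE exchange_big /= -[in RHS]gx (fisher_raoC _ _ _) ?gx ?pnus.1//.
rewrite -[in RHS]gx (fisher_rao_chart_suml cx) mulr_sumr; apply: eq_bigr => j _.
rewrite gx (fisher_raoC _ _ pnus.1).
have l := is_diff_linear_sum (fun i => h i 0) (fun i => basis_vec (R := R) i) (Dfp j).
rewrite -col_basis in l.
rewrite (_ : - (t1 * b nus) * (k j 0 * fisher_rao nus (dE h) (J (basis_vec j))) =
  k j 0 * (- t1 * (b nus * fisher_rao nus (dE h) (J (basis_vec j))))); last by ring.
rewrite l mulr_sumr; apply: eq_bigr => i _; rewrite mxE.
suff E : forall u v w : R, u * v * w = w * (u *: v) by exact: E.
by move=> u v w; rewrite mulrC.
Qed.

Lemma chart_metric_bilf h k : bilf Bc h k = t1 * b nus * fisher_rao nus (J h) (J k).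
Proof.
have h2 := fisher_rao_bilf cx h k; rewrite gx in h2.
by rewrite bilfZm; exact: (congr1 (fun r => t1 * b nus * r) h2).
Qed.

Lemma chart_metric_posdef : posdef Bc.
Proof.
apply: posdefZ; last by rewrite -gx; exact: fisher_rao_mx_posdef.
by rewrite mulr_gt0// mass_gt0.
Qed.

(** The envelope lemma with q held fixed, where both required bounds are equalities. *)
Lemma is_diff_cross_entropy k (q z : gpar R d) : 0 < k -> posdef (sympart z).2 ->
  is_diff z (fun z => k * cross_entropy q (sympart z))
    (fun h => - k * fisher_rao (sympart z) (gauss_score q (sympart z)) (sympart h)).
Proof.
move=> k0 pz; have cst1 (W : normedModType R) (w : W) : w @[y --> z] --> w by exact: cvg_cst.
apply: (is_diff_envelope (near_sympart pz) (is_diff_sympart1 z) (is_diff_sympart2 z)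
  (v := fun=> q.1) (Q := fun=> q.2) k0 (cst1 _ _) (cst1 _ _)).
  by apply: (@filterE _ (nbhs z)) => y; rewrite mulrBr.
by apply: (@filterE _ (nbhs z)) => y; rewrite mulrBr.
Qed.

Lemma hessian_le_metric : (hessian_mx f x)^T = hessian_mx f x -> psdmx (Bc - hessian_mx f x).
Proof.
move=> sH.
have k0 : 0 < t1 * b nus by rewrite mulr_gt0// mass_gt0.
pose g y := Phi (ch_inv c y) - t1 * b nus * cross_entropy nus (ch_inv c y).
pose Dg y h := Df y h + t1 * b nus * fisher_rao (ch_inv c y) (gauss_score nus (ch_inv c y)) ('d (ch_inv c) y h).
pose dg j h := - t1 * (b nus * fisher_rao nus (dE h) (J (basis_vec j))) +
  t1 * b nus * (- 1 * fisher_rao nus (J h) (J (basis_vec j))).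
have gsc0 : gauss_score nus nus = 0.
  by rewrite /gauss_score subrr mul0mx addr0 subrr.
have near_g : \forall y \near x, is_diff y g (Dg y).
  apply: filterS (near_ch_cod cx) => y cy; have sy := ch_inv_sympart cy.
  have py : posdef (sympart (ch_inv c y)).2 by rewrite sy; exact/ch_dom_gaussian/ch_inv_dom.
  have h := @is_diff_along _ _ c y cy _ (fun z => t1 * b nus * cross_entropy nus z) _ (is_diff_cross_entropy nus k0 py).
  apply: is_diff_ext (is_diffB (is_diff_Phi_chart cy) h) => v.
  rewrite [LHS]/(Df y v - _) /Dg sy (chart_sympart cy).
  by rewrite mulNr opprK.
have dgp j : is_diff x (fun y => Dg y (basis_vec j)) (dg j).
  (* The derivative of [gauss_score nus] at nus is minus the symmetrization, so the cross entropy
     contributes exactly - B to the Hessian of g. *)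
  have h1 : is_diff nus (fun z : gpar R d => (gauss_score nus (sympart z)).1) (fun h => -1 *: (sympart h).1).
    have h := is_diffB (is_diff_cst nus.1 nus) (is_diff_sympart1 nus).
    by apply: is_diff_ext h => v; rewrite scaleN1r [LHS]sub0r.
  have w0 : nus.1 - (sympart nus).1 = 0 by rewrite snus subrr.
  have h2 : is_diff nus (fun z : gpar R d => (gauss_score nus (sympart z)).2) (fun h => -1 *: (sympart h).2).
    have hm := is_diff_mulmx h1 (is_diff_tr h1).
    have h := is_diffB (is_diffD (is_diff_cst nus.2 nus) hm) (is_diff_sympart2 nus).
    apply: is_diff_ext h => v.
    suff E : 0 + ((-1 *: (sympart v).1) *m (nus.1 - (sympart nus).1)^T +
      (nus.1 - (sympart nus).1) *m (-1 *: (sympart v).1)^T) - (sympart v).2 = -1 *: (sympart v).2 by exact: E.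
    by rewrite w0 trmx0 mulmx0 mul0mx !addr0 sub0r scaleN1r.
  have [h3 h4] : is_diff (ch_inv c x) (fun z : gpar R d => (gauss_score nus (sympart z)).1) (fun h => -1 *: (sympart h).1) /\
    is_diff (ch_inv c x) (fun z : gpar R d => (gauss_score nus (sympart z)).2) (fun h => -1 *: (sympart h).2).
    by rewrite gx; split; [exact: h1|exact: h2].
  have G0 : gauss_score nus (ch_inv c x) = 0 by rewrite gx.
  have h := is_diffZ (t1 * b nus) (@is_diff_fisher_rao_field _ _ c x cx (gauss_score nus) _ _ (basis_vec j) h3 h4 G0).
  apply: is_diff_ext (is_diffD (Dfp j) h) => v.
  have e2 : fisher_rao (ch_inv c x) (-1 *: (sympart (J v)).1, -1 *: (sympart (J v)).2) (J (basis_vec j)) =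
      -1 * fisher_rao nus (J v) (J (basis_vec j)).
    by rewrite (chart_sympart cx) (fisher_raoZl _ _ (J v)) gx.
  exact: (congr1 (fun r => - t1 * (b nus * fisher_rao nus (dE v) (J (basis_vec j))) + t1 * b nus * r) e2).
have Dg0 j : Dg x (basis_vec j) = 0.
  by rewrite /Dg Df0 gx gsc0 fisher_rao0l mulr0 addr0.
have gmax : \forall y \near x, g y <= g x.
  apply: filterS (near_ch_cod cx) => y cy; rewrite /g gx.
  have := Phi_fixed_point_majorization n_gt0 t0_gt0 t1_gt0 lam_gt0 a_gt0 mus_gaussian pnus
    (ch_dom_gaussian (ch_inv_dom cy)) fixT.
  have aux (p r k u v : R) : p <= r + k * (u - v) -> p - k * u <= r - k * v by lra.
  exact: aux.
have nsd := local_max_nsd near_g dgp Dg0 gmax.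
split; first by rewrite linearB /= sH chart_metric_posdef.1.
move=> v; have := nsd v.
have -> : \matrix_(i, j) dg j (basis_vec i) = hessian_mx f x - Bc.
  apply/matrixP => i j; rewrite hessE.
  have e := chart_metric_bilf (basis_vec i) (basis_vec j).
  have dE' (A : 'M[R]_N) : bilf A (basis_vec i) (basis_vec j) = A i j.
    by rewrite /bilf /basis_vec trmx_delta -rowE -colE !mxE.
  rewrite dE' in e.
  rewrite [LHS]mxE [RHS]mxE [in RHS]mxE [(- Bc) i j]mxE e /dg; congr (_ + _).
  by rewrite mulN1r mulrN.
by rewrite !quadfBm; lra.
Qed.

Let That := ch_map c \o T \o ch_inv c.
Let K := 'd (ch_map c \o sympart) (ch_inv c x) : gpar R d -> 'cV[R]_N.

Lemma is_diff_That : is_diff x That (fun h => h + K (dE h)).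
Proof.
have dT : is_diff (ch_inv c x) (fun z : gpar R d => T (sympart z))
    (fun h => ((sympart h).1 + dscore1 h, (sympart h).2 + dscore2 h)).
  by rewrite gx; exact: is_diff_moment_map.
have dTc := @is_diff_along _ _ c x cx _ T _ dT.
have dphi : is_diff (T (ch_inv c x)) (ch_map c \o sympart) K.
  have -> : T (ch_inv c x) = ch_inv c x by rewrite gx.
  exact/is_diff_ch_map/ch_inv_dom.
have h := is_diff_comp dTc dphi.
have E : \forall y \near x, ((ch_map c \o sympart) \o (fun y => T (ch_inv c y))) y = That y.
  apply: filterS (near_ch_cod cx) => y cy /=.
  (* T takes values in the positive definite matrices, so the symmetrization inserted before
     [ch_map] is invisible. *)
  rewrite sympart_id//; apply: (proj1 _); apply: moment_map_gaussian => //.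
  exact/ch_dom_gaussian/ch_inv_dom.
have h2 := near_eq_is_diff E h.
apply: is_diff_ext h2 => v.
have lin u w : K (u + w) = K u + K w by rewrite /K linearD.
have e : ((sympart (J v)).1 + dscore1 (J v), (sympart (J v)).2 + dscore2 (J v)) = J v + dE v.
  by rewrite (chart_sympart cx).
exact: etrans (congr1 K e) (etrans (lin _ _) (congr1 (fun r => r + K (dE v)) (chart_KJ cx v))).
Qed.

(** The chart domain is open only relative to the Gaussians, so continuity of T at the fixed point
    is combined with the positive definiteness of its values. *)
Lemma near_That_dom : \forall y \near x, ch_dom c (T (ch_inv c y)).
Proof.
have cT : T (ch_inv c y) @[y --> x] --> nus.
  have dT := is_diff_moment_map.
  have c1 : T (sympart z) @[z --> nus] --> T (sympart nus) by exact: is_diff_cvg dT.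
  have c2 : ch_inv c y @[y --> x] --> nus by rewrite -[X in _ --> X]gx; exact: is_diff_cvg (is_diff_ch_inv cx).
  have c3 : T (sympart (ch_inv c y)) @[y --> x] --> nus.
    by rewrite snus fixT in c1; exact: (cvg_comp _ _ c2 c1).
  have E : \forall y \near x, T (sympart (ch_inv c y)) = T (ch_inv c y).
    by apply: filterS (near_ch_cod cx) => y cy; rewrite ch_inv_sympart.
  move=> P /c3 hP; have {hP} : \forall y \near x, P (T (sympart (ch_inv c y))) := hP.
  by apply: filterS2 E => y ->.
have h1 : \forall y \near x, posdef (T (ch_inv c y)).2 -> ch_dom c (T (ch_inv c y)).
  exact: cT _ (near_ch_dom cnus).
apply: filterS2 h1 (near_ch_cod cx) => y h1 cy; apply: h1.
by apply: moment_map_gaussian => //; exact/ch_dom_gaussian/ch_inv_dom.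
Qed.

Lemma That_fixed : That x = x. Proof. by rewrite /That /= gx fixT. Qed.

(** Multiplied by B, the claim compares two bilinear forms on basis vectors. [chart_JK] removes J K
    on the symmetric derivative of the score, and [hessian_bilf] identifies the result as - H; the
    symmetry of H swaps the two arguments. *)
Lemma jacobian_That : (hessian_mx f x)^T = hessian_mx f x ->
  jacobian_mx That x = 1%:M - invmx Bc *m hessian_mx f x.
Proof.
move=> sH; have [_ dTE] := is_diff_That.
have uB : Bc \in unitmx by exact/posdef_unit/chart_metric_posdef.
pose M : 'M[R]_N := \matrix_(i, j) (K (dE (basis_vec j))) i 0.
have -> : jacobian_mx That x = 1%:M + M.
  apply/matrixP => i j; rewrite [LHS]mxE dTE [RHS]mxE [M i j]mxE [LHS]mxE.
  by congr (_ + _); rewrite !mxE eqxx andbT.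
congr (_ + _); rewrite -mulmxN -[LHS](mulKmx uB); congr (_ *m _).
apply/matrixP => i j.
have eE (A : 'M[R]_N) (k l : 'I_N) : bilf A (basis_vec k) (basis_vec l) = A k l.
  by rewrite /bilf /basis_vec trmx_delta -rowE -colE !mxE.
have cE : M *m basis_vec j = K (dE (basis_vec j)).
  by rewrite -colE; apply/colP => k; rewrite !mxE.
rewrite -[LHS]eE -bilf_mulr cE chart_metric_bilf.
have -> : J (K (dE (basis_vec j))) = dE (basis_vec j).
  by rewrite /J /K (chart_JK cx) sympart_id// /dE /= dscore2_sym.
rewrite [RHS]mxE -sH mxE -[in RHS]eE hessian_bilf mulNr opprK.
by rewrite (fisher_raoC _ _ pnus.1).
Qed.

Lemma strict_local_min_chart : posdef (hessian_mx f x) ->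
  \forall y \near x, y != x -> f x < f y.
Proof. by rewrite hessE => pH; exact: (strict_local_min near_f Dfp (fun j => Df0 _) pH). Qed.

Lemma Phi_second_order_bound :
  exists2 C, 0 < C & \forall y \near x, `|f y - f x| <= C * `|y - x| ^+ 2.
Proof. exact: (second_order_bound near_f Dfp (fun j => Df0 _)). Qed.

End in_chart.

Lemma jacobian_mxE p (g dg : 'cV[R]_p -> 'cV[R]_p) x h : is_diff x g dg ->
  jacobian_mx g x *m h = dg h.
Proof.
move=> dgx; have := is_diff_linear_sum (fun i => h i 0) (fun i => basis_vec (R := R) i) dgx.
have [_ gE] := dgx; rewrite -col_basis => ->; apply/colP => i; rewrite mxE summxE.
by apply: eq_bigr => j _; rewrite !mxE gE mulrC.
Qed.

Lemma bilf_congr p (A M : 'M[R]_p) h k : bilf (M^T *m A *m M) h k = bilf A (M *m h) (M *m k).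
Proof. by rewrite /bilf trmx_mul !mulmxA. Qed.

Lemma bilf_inj p (A B : 'M[R]_p) : (forall h k, bilf A h k = bilf B h k) -> A = B.
Proof.
move=> AB; apply/matrixP => i j; have := AB (basis_vec i) (basis_vec j).
by rewrite /bilf /basis_vec trmx_delta -!rowE -!colE !mxE.
Qed.

(** * Change of chart *)

Section transition.
Variables c c' : smooth_chart R d.
Hypotheses (cnus : ch_dom c nus) (cnus' : ch_dom c' nus).
Let x := ch_map c nus.
Let x' := ch_map c' nus.
Let cx : ch_cod c x. Proof. by have [] := ch_mapK cnus. Qed.
Let gx : ch_inv c x = nus. Proof. by have [] := ch_mapK cnus. Qed.
Let cx' : ch_cod c' x'. Proof. by have [] := ch_mapK cnus'. Qed.
Let gx' : ch_inv c' x' = nus. Proof. by have [] := ch_mapK cnus'. Qed.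

Definition transition_mx : 'M[R]_N := jacobian_mx ((ch_map c \o sympart) \o ch_inv c') x'.

Let dtrans : is_diff x' ((ch_map c \o sympart) \o ch_inv c')
  ('d (ch_map c \o sympart) nus \o 'd (ch_inv c') x').
Proof.
apply: is_diff_comp; first exact: is_diff_ch_inv.
by rewrite gx'; exact: is_diff_ch_map.
Qed.

Lemma transition_mxE h : transition_mx *m h = 'd (ch_map c \o sympart) nus ('d (ch_inv c') x' h).
Proof. by rewrite (jacobian_mxE _ dtrans). Qed.

(** J K is the identity on symmetric tangent vectors, so a coordinate vector and its image under the
    transition matrix describe the same tangent vector. *)
Lemma diff_transition h : 'd (ch_inv c) x (transition_mx *m h) = 'd (ch_inv c') x' h.
Proof.
rewrite transition_mxE; have := chart_JK cx ('d (ch_inv c') x' h).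
by rewrite gx (chart_sympart cx').
Qed.

End transition.

Lemma transition_unit c c' : ch_dom c nus -> ch_dom c' nus -> transition_mx c c' \in unitmx.
Proof.
move=> h h'; have [cx gx] := ch_mapK h.
suff : transition_mx c' c *m transition_mx c c' = 1%:M by move/mulmx1_unit => [].
have [cx' gx'] := ch_mapK h'.
have E (k : 'cV[R]_N) : transition_mx c' c *m (transition_mx c c' *m k) = k.
  rewrite (transition_mxE h' h) (diff_transition h h').
  by have := chart_KJ cx' k; rewrite gx'.
apply/matrixP => i j; have := E (basis_vec j); rewrite mulmxA => /colP /(_ i).
by rewrite /basis_vec -colE !mxE eqxx andbT => ->.
Qed.

(** By [hessian_bilf] both Hessians are one bilinear form on tangent vectors read in two charts; at
    a critical point the second derivative of the transition map does not contribute. Positive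
    definiteness in one chart thus passes to every other. *)
Lemma hessian_transition c c' : ch_dom c nus -> ch_dom c' nus ->
  hessian_mx (Phi \o ch_inv c') (ch_map c' nus) =
  (transition_mx c c')^T *m hessian_mx (Phi \o ch_inv c) (ch_map c nus) *m transition_mx c c'.
Proof.
move=> h h'; apply: bilf_inj => u v; rewrite bilf_congr.
have e := hessian_bilf h (transition_mx c c' *m u) (transition_mx c c' *m v).
have e2 := congr2 (fun s t => - (t1 * b nus) * fisher_rao nus (dscore1 s, dscore2 s) t)
  (diff_transition h h' u) (diff_transition h h' v).
exact: (etrans (hessian_bilf h' u v) (esym (etrans e e2))).
Qed.

Lemma metric_transition c c' : ch_dom c nus -> ch_dom c' nus ->
  (t1 * b nus) *: fisher_rao_mx c' nus =
  (transition_mx c c')^T *m ((t1 * b nus) *: fisher_rao_mx c nus) *m transition_mx c c'.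
Proof.
move=> h h'; apply: bilf_inj => u v; rewrite bilf_congr.
have e := chart_metric_bilf h (transition_mx c c' *m u) (transition_mx c c' *m v).
have e2 := congr2 (fun s t => t1 * b nus * fisher_rao nus s t)
  (diff_transition h h' u) (diff_transition h h' v).
exact: (etrans (chart_metric_bilf h' u v) (esym (etrans e e2))).
Qed.

Lemma strict_local_min_gaussian c : ch_dom c nus ->
  posdef (hessian_mx (Phi \o ch_inv c) (ch_map c nus)) ->
  \forall nu \near nus, gaussians nu -> nu != nus -> Phi nus < Phi nu.
Proof.
move=> h pH; have [cx gx] := ch_mapK h.
have c1 : ch_map c (sympart z) @[z --> nus] --> ch_map c nus.
  by have := is_diff_cvg (is_diff_ch_map h); rewrite /= snus.
have h1 : \forall z \near nus, ch_map c (sympart z) != ch_map c nus ->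
    Phi nus < Phi (ch_inv c (ch_map c (sympart z))).
  by have := strict_local_min_chart h pH; rewrite /= gx => /c1.
apply: filterS2 h1 (near_ch_dom_sympart h) => z h1 h2 pz zn.
have sz : sympart z = z by apply: sympart_id; exact: pz.1.
rewrite sz in h1 h2; have [_ gz] := ch_mapK h2; rewrite gz in h1.
by apply: h1; apply: contra_neq zn => e; rewrite -gz e gx.
Qed.

End fixed_point.

(** * Local convergence *)

Lemma iter_contraction {R : realType} {n : nat} (B : 'M[R]_n) (g : 'cV[R]_n -> 'cV[R]_n)
    (x : 'cV[R]_n) (q r : R) : 0 <= q < 1 ->
  (forall y, bnorm B (y - x) < r -> bnorm B (g y - x) <= q * bnorm B (y - x)) ->
  (forall y, bnorm B (y - x) < r -> bnorm B (g y - x) < r) /\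
  forall y k, bnorm B (y - x) < r -> bnorm B (iter k g y - x) < r /\
    bnorm B (iter k g y - x) <= q ^+ k * bnorm B (y - x).
Proof.
move=> /andP[q0 q1] hg.
have inv y : bnorm B (y - x) < r -> bnorm B (g y - x) < r.
  move=> yr; apply: (le_lt_trans _ yr); apply: (le_trans (hg _ yr)).
  by rewrite ler_piMl ?bnorm_ge0// ltW.
split => // y k yr; elim: k => [|k [IHr IH]] /=; first by rewrite expr0 mul1r.
split; first exact: inv.
by apply: (le_trans (hg _ IHr)); rewrite exprS -mulrA ler_wpM2l.
Qed.

Lemma gen_eig_mult_congr {R : realType} {n : nat} (M H B : 'M[R]_n) l : M \in unitmx ->
  gen_eig_mult (M^T *m H *m M) (M^T *m B *m M) l = gen_eig_mult H B l.
Proof.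
move=> uM; rewrite /gen_eig_mult -(rank_congr (H - l *: B) uM) mulmxBr mulmxBl.
by rewrite -scalemxAr -scalemxAl.
Qed.

(** The square roots of B and B' are not compared directly: [pencil_eigenvalue] makes the spectrum a
    function of the multiplicities alone. *)
Lemma lambda_min_pencil {R : realType} {n : nat} (H B H' B' : 'M[R]_n) :
  posdef B -> posdef B' -> (forall l, gen_eig_mult H' B' l = gen_eig_mult H B l) ->
  lambda_min (invsqrtmx B' *m H' *m invsqrtmx B') = lambda_min (invsqrtmx B *m H *m invsqrtmx B).
Proof.
move=> pB pB' E; congr inf; apply/seteqP.
by split => l; rewrite /= !pencil_eigenvalue// E.
Qed.

Theorem theorem5p13 (R : realType) (d n : nat) (tau0 tau1 : R)
    (lam a : 'I_n -> R) (mus : 'I_n -> gpar R d) (nus : gpar R d)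
    (chi : smooth_chart R d)
    (d_ge1 : (1 <= d)%N) (n_ge1 : (1 <= n)%N)
    (tau0_gt0 : 0 < tau0) (tau1_gt0 : 0 < tau1)
    (lam_gt0 : forall i, 0 < lam i) (lam_sum : \sum_i lam i = 1)
    (a_gt0 : forall i, 0 < a i)
    (mus_gaussian : forall i, gaussians (mus i))
    (nus_gaussian : gaussians nus)
    (chi_nus : ch_dom chi nus) :
  let Phi := Phi tau0 tau1 lam a mus in
  let b := mass tau0 tau1 lam a mus in
  let T := moment_map tau0 tau1 lam a mus in
  let H (c : smooth_chart R d) :=
    hessian_mx (Phi \o ch_inv c) (ch_map c nus) in
  let B (c : smooth_chart R d) := (tau1 * b nus) *: fisher_rao_mx c nus in
  let mu_ (c : smooth_chart R d) :=
    lambda_min (invsqrtmx (B c) *m H c *m invsqrtmx (B c)) in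
  let rho_ (c : smooth_chart R d) := 1 - mu_ c in
  let xs := ch_map chi nus in
  let That := ch_map chi \o T \o ch_inv chi in
  T nus = nus ->
  posdef (H chi) ->
  (forall c, ch_dom c nus ->
     [/\ posdef (H c),
         forall l, gen_eig_mult (H c) (B c) l = gen_eig_mult (H chi) (B chi) l,
         mu_ c = mu_ chi & rho_ c = rho_ chi]) /\
  (\forall nu \near nus, gaussians nu -> nu != nus -> Phi nus < Phi nu) /\
  (\forall x \near xs, ch_dom chi (T (ch_inv chi x))) /\
  differentiable That xs /\
  jacobian_mx That xs = 1%:M - invmx (B chi) *m H chi /\
  0 < mu_ chi <= 1 /\
  0 <= rho_ chi < 1 /\
  opbnorm (B chi) (jacobian_mx That xs) = rho_ chi /\
  forall q : R, rho_ chi < q < 1 ->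
    exists (V : set 'cV[R]_(gdim d)) (r : R),
      let U := [set x | bnorm (B chi) (x - xs) < r] in
      [/\ nbhs xs V /\ V `<=` ch_cod chi,
          0 < r,
          forall x, V x -> Phi nus <= Phi (ch_inv chi x),
          [set x | bnorm (B chi) (x - xs) <= r] `<=` V &
          (forall x, U x -> ch_dom chi (T (ch_inv chi x)) /\ U (That x)) /\
          forall x0, U x0 ->
            let x_ k := iter k That x0 in
            [/\ forall k, bnorm (B chi) (x_ k - xs) <=
                           q ^+ k * bnorm (B chi) (x0 - xs),
                (fun k => b (ch_inv chi (x_ k)) - b nus) =O_\oo
                  (fun k => q ^+ k) &
                (fun k => Phi (ch_inv chi (x_ k)) - Phi nus) =O_\oo
                  (fun k => q ^+ (2 * k))]].
Proof.
move=> Phi b T H B mu_ rho_ xs That fixT pH.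
have [cxs gxs] := ch_mapK chi_nus; rewrite -/xs in cxs gxs.
have pB c : ch_dom c nus -> posdef (B c).
  exact: (chart_metric_posdef tau0 mus n_ge1 tau1_gt0 lam_gt0 a_gt0).
have HT c : ch_dom c nus -> H c = (transition_mx nus chi c)^T *m H chi *m transition_mx nus chi c.
  exact: (hessian_transition n_ge1 tau0_gt0 tau1_gt0 lam_gt0 a_gt0 mus_gaussian nus_gaussian fixT chi_nus).
have BT c : ch_dom c nus -> B c = (transition_mx nus chi c)^T *m B chi *m transition_mx nus chi c.
  exact: (metric_transition tau0 tau1 lam a mus chi_nus).
have mult c : ch_dom c nus -> forall l, gen_eig_mult (H c) (B c) l = gen_eig_mult (H chi) (B chi) l.
  by move=> hc l; rewrite (HT _ hc) (BT _ hc) gen_eig_mult_congr//; exact: transition_unit.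
have muE c : ch_dom c nus -> mu_ c = mu_ chi.
  by move=> hc; apply: lambda_min_pencil; [exact: pB|exact: pB|exact: mult].
(* Positive dimension makes the spectrum nonempty, so that its infimum is an eigenvalue. *)
have N0 : (0 < gdim d)%N by rewrite /gdim addn_gt0 d_ge1.
have sH : (H chi)^T = H chi := pH.1.
have pD : psdmx (B chi - H chi).
  exact: (hessian_le_metric n_ge1 tau0_gt0 tau1_gt0 lam_gt0 a_gt0 mus_gaussian nus_gaussian fixT chi_nus sH).
have [mu01 contr opE] := pencil_spectrum (pB _ chi_nus) N0 pH pD.
have dT := is_diff_That n_ge1 tau0_gt0 tau1_gt0 lam_gt0 a_gt0 mus_gaussian nus_gaussian fixT chi_nus.
have jac : jacobian_mx That xs = 1%:M - invmx (B chi) *m H chi.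
  exact: (jacobian_That n_ge1 tau0_gt0 tau1_gt0 lam_gt0 a_gt0 mus_gaussian nus_gaussian fixT chi_nus sH).
have nearT : \forall x \near xs, ch_dom chi (T (ch_inv chi x)).
  exact: (near_That_dom n_ge1 tau0_gt0 tau1_gt0 lam_gt0 a_gt0 mus_gaussian nus_gaussian fixT chi_nus).
have rho01 : 0 <= rho_ chi < 1.
  have /andP[m0 m1] := mu01; rewrite /rho_ subr_ge0.
  by rewrite (m1 : mu_ chi <= 1) /= ltrBlDr ltrDl (m0 : 0 < mu_ chi).
split.
  move=> c hc; split; [|exact: mult|exact: muE|by rewrite /rho_ muE].
  by rewrite HT//; apply: posdef_congr => //; exact: transition_unit.
split.
  exact: (strict_local_min_gaussian n_ge1 tau0_gt0 tau1_gt0 lam_gt0 a_gt0 mus_gaussian nus_gaussian fixT chi_nus pH).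
split; first exact: nearT.
split; first by have [] := dT.
split; first exact: jac.
split; first exact: mu01.
split; first exact: rho01.
split; first by rewrite jac; exact: opE.
move=> q /andP[rq q1].
have q0 : 0 < q by apply: le_lt_trans rq; have /andP[] := rho01.
have pBc := pB _ chi_nus.
have hk h : bnorm (B chi) (jacobian_mx That xs *m h) <= rho_ chi * bnorm (B chi) h.
  by rewrite jac; exact: contr.
have rq' : 0 <= rho_ chi < q by rewrite rq andbT; have /andP[] := rho01.
have fixTh : That xs = xs by exact: That_fixed.
have dT' : is_diff xs That (fun h => jacobian_mx That xs *m h).
  by apply: (is_diff_ext _ dT) => h; exact: (esym (jacobian_mxE h dT)).
have nearC := near_contraction pBc dT' fixTh hk rq'.
have [C C0 nearQ] := Phi_second_order_bound n_ge1 tau0_gt0 tau1_gt0 lam_gt0 a_gt0 mus_gaussian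
  nus_gaussian fixT chi_nus.
have nearM := strict_local_min_chart n_ge1 tau0_gt0 tau1_gt0 lam_gt0 a_gt0 mus_gaussian
  nus_gaussian fixT chi_nus pH.
(* All local properties are gathered in one neighborhood. A closed B-ball inside it is invariant in
   its interior, so they hold along the whole orbit. *)
pose V : set 'cV[R]_(gdim d) := [set x | [/\ ch_cod chi x, ch_dom chi (T (ch_inv chi x)),
   bnorm (B chi) (That x - xs) <= q * bnorm (B chi) (x - xs),
   `|Phi (ch_inv chi x) - Phi nus| <= C * `|x - xs| ^+ 2 &
   Phi nus <= Phi (ch_inv chi x)]].
have nV : nbhs xs V.
  have n1 : \forall x \near xs, ch_cod chi x /\ ch_dom chi (T (ch_inv chi x)).
    by apply: filterS2 (near_ch_cod cxs) nearT => x.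
  have n2 : \forall x \near xs, `|Phi (ch_inv chi x) - Phi nus| <= C * `|x - xs| ^+ 2 /\
      Phi nus <= Phi (ch_inv chi x).
    apply: filterS2 nearQ nearM => x; rewrite /= gxs => h1 h2; split; first exact: h1.
    by have [->|/h2/ltW//] := eqVneq x xs; rewrite gxs.
  by apply: filterS3 n1 nearC n2 => x [h1 h2] h3 [h4 h5]; split.
have [r r0 rV] := bnorm_ball_sub pBc nV.
have UV x : bnorm (B chi) (x - xs) < r -> V x by move=> /ltW; exact: rV.
have q01 : 0 <= q < 1 by rewrite (ltW q0) q1.
have [invU iterU] := iter_contraction q01 (fun x Ux => let: And5 _ _ h _ _ := UV x Ux in h).
exists V, r; split.
- by split; [exact: nV|move=> x []].
- exact: r0.
- by move=> x [].
- exact: rV.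
- split; first by move=> x Ux; split; [have [] := UV x Ux|exact: invU].
  move=> x0 Ux0 x_.
  have [C' C'0 hC'] := norm_le_posdef pBc.
  pose X := bnorm (B chi) (x0 - xs).
  (* The squared distance to xs is at most C' times the squared B-norm, which decays like q^(2k). *)
  have PhiO k : `|Phi (ch_inv chi (x_ k)) - Phi nus| <= C * (C' * X ^+ 2) * q ^+ (2 * k).
    have [Uk bk] := iterU x0 k Ux0; have [_ _ _ h4 _] := UV _ Uk.
    have -> : C * (C' * X ^+ 2) * q ^+ (2 * k) = C * (C' * (X ^+ 2 * q ^+ (2 * k))) by rewrite !mulrA.
    apply: (le_trans h4); rewrite ler_pM2l//.
    apply: (le_trans (hC' _)); rewrite ler_pM2l// -bnorm_sqr//.
    rewrite mulnC exprM -exprMn [X * _]mulrC ler_pXn2r ?nnegrE ?bnorm_ge0//.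
    by rewrite mulr_ge0 ?bnorm_ge0// exprn_ge0// ltW.
  have D0 : 0 <= C * (C' * X ^+ 2).
    by apply: mulr_ge0; [exact: ltW|apply: mulr_ge0; [exact: ltW|exact: sqr_ge0]].
  move: (C * _) D0 PhiO => D D0 PhiO.
  have qk k : 0 <= q ^+ k by rewrite exprn_ge0// ltW.
  split.
  + by move=> k; have [] := iterU x0 k Ux0.
  (* The added 1 keeps the constant positive when D = 0, as for an orbit starting at the fixed
     point. *)
  + apply/eqO_exP; exists (tau0^-1 * D + 1).
      by rewrite ltr_wpDl// mulr_ge0// invr_ge0 ltW.
    apply: nearW => k.
    (* The mass is affine in [Phi], so its error inherits the bound in q^(2k), which is then
       weakened to q^k. *)
    have bE nu : b nu = \sum_i lam i * a i - tau0^-1 * Phi nu.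
      by rewrite /Phi PhiE mulKf ?gt_eqF// subKr.
    have -> : b (ch_inv chi (x_ k)) - b nus = tau0^-1 * (Phi nus - Phi (ch_inv chi (x_ k))).
      by rewrite !bE mulrBr opprB addrC addrA subrK.
    rewrite normrM gtr0_norm ?invr_gt0// distrC (ger0_norm (qk k)) mulrDl mul1r.
    have q2 : q ^+ (2 * k) <= q ^+ k.
      by rewrite mul2n -addnn exprD ler_piMl// exprn_ile1// ltW.
    apply: (@le_trans _ _ (tau0^-1 * D * q ^+ k)); last by rewrite lerDl.
    rewrite -mulrA ler_pM2l ?invr_gt0//; apply: (le_trans (PhiO k)).
    exact: ler_wpM2l.
  + apply/eqO_exP; exists (D + 1); first by rewrite ltr_wpDl.
    apply: nearW => k; rewrite (ger0_norm (qk _)).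
    by apply: (le_trans (PhiO k)); apply: ler_wpM2r => //; rewrite lerDl.
Qed.
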